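(* Let $d\in\mathbb N$. For $n\in\mathbb N$ and $1\le i\le n$ let $\mathbf X_{i,n}=(X^{(1)}_{i,n},\dots,X^{(d)}_{i,n})$ be $d$-dimensional Gaussian random vectors, independent within each row $n$, whose components are standard normal, with correlation matrix $\Sigma_{i,n}$. Let $b_n$ be the solution of $b_n=n\phi(b_n)$, $\phi$ the standard normal density, let $\mathbf 1=(1,\dots,1)^\top\in\mathbb R^d$, and define the probability measure $$\eta_n=\frac1n\sum_{i=1}^n\delta_{\sqrt{b_n^2(\mathbf 1\mathbf 1^\top-\Sigma_{i,n})/2}}$$ on $[0,\infty)^{d\times d}$ (square root taken entrywise). If, as $n\to\infty$, $\eta_n$ converges weakly to some probability measure $\eta$ on $[0,\infty)^{d\times d}$ such that $\eta^2(D_0)=1$, then the normalized componentwise maximum $$\max_{i=1,\dots,n}b_n(\mathbf X_{i,n}-b_n)$$ converges in distribution to a random vector with distribution function $$H_\eta(x_1,\dots,x_d)=\exp\left(\int_{[0,\infty)^{d\times d}}\log H_\Lambda(x_1,\dots,x_d)\,\eta(d\Lambda)\right),\qquad (x_1,\dots,x_d)\in\mathbb R^d,$$ where $\eta^2$, $D_0$ and $H_\Lambda$ are as defined in the context.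
   Context: $[0,\infty)^{d\times d}$ carries the Euclidean distance; squares and square roots of matrices are entrywise; $\delta_a$ is the Dirac measure at $a$; operations between a vector and the scalar $b_n$, and maxima of vectors, are componentwise. For a measure $\tau$ on $[0,\infty)^{d\times d}$, $\tau^2$ is the image measure of $\tau$ under the entrywise squaring map $\Lambda\mapsto\Lambda^2$. $D_0$ is the set of strictly conditionally negative definite matrices: all symmetric $A=(a_{j,k})_{1\le j,k\le d}\in[0,\infty)^{d\times d}$ with $a_{j,j}=0$ for all $j$ and $\mathbf x^\top A\mathbf x<0$ for all $\mathbf x\in\mathbb R^d\setminus\{0\}$ with $\sum_{i=1}^d x_i=0$. For $\Lambda=(\lambda_{j,k})_{1\le j,k\le d}\in[0,\infty)^{d\times d}$, $2\le l\le d$ and $m=(m_1,\dots,m_l)$ with $1\le m_1<\dots<m_l\le d$, put $$\Gamma_{l,m}(\Lambda)=2\left(\lambda_{m_j,m_l}^2+\lambda_{m_k,m_l}^2-\lambda_{m_j,m_k}^2\right)_{1\le j,k\le l-1}.$$ $S(\cdot\,|\,\Psi)$ is the survivor function of a centered normal vector with covariance matrix $\Psi$: $S(\mathbf x|\Psi)=\mathbb P(Y_1>x_1,\dots,Y_r>x_r)$ for $\mathbf Y\sim N(\mathbf 0,\Psi)$ in $\mathbb R^r$; if $\Psi$ is not a covariance matrix, $S(\mathbf x|\Psi)=0$. Define $$H_\Lambda(\mathbf x)=\exp\left(\sum_{l=1}^d(-1)^l\sum_{m:\,1\le m_1<\dots<m_l\le d}h_{l,m,\Lambda}(x_{m_1},\dots,x_{m_l})\right),\qquad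 \mathbf x\in\mathbb R^d,$$ where $h_{1,m,\Lambda}(y)=e^{-y}$ for $m=1,\dots,d$ and, for $2\le l\le d$, $$h_{l,m,\Lambda}(y_1,\dots,y_l)=\int_{y_l}^\infty S\left(\left(y_i-z+2\lambda_{m_i,m_l}^2\right)_{i=1,\dots,l-1}\,\middle|\,\Gamma_{l,m}(\Lambda)\right)e^{-z}\,dz.$$ *)

(* Defs.v *)
From HB Require Import structures.
From mathcomp Require Import all_boot all_order all_algebra.
From mathcomp Require Import all_classical all_reals all_analysis.

Set Implicit Arguments.
Unset Strict Implicit.
Unset Printing Implicit Defensive.

Import Order.TTheory GRing.Theory Num.Theory.
Import numFieldNormedType.Exports.

Local Open Scope classical_set_scope.
Local Open Scope ring_scope.

(* Matrices carry their Borel sigma-algebra; the open sets of the library's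
   max-norm topology are those of the Euclidean distance. *)
HB.instance Definition _ (R : realType) (m n : nat) :=
  @isMeasurable.Build (sigma_display (@open 'M[R]_(m, n))) 'M[R]_(m, n)
    <<s @open 'M[R]_(m, n) >> (@sigma_algebra0 _ setT open)
    (@sigma_algebraC _ open) (@sigma_algebra_bigcup _ setT open).

Definition nonneg_mx (R : realType) (d : nat) : set 'M[R]_d :=
  [set L : 'M[R]_d | forall i j, 0 <= L i j].

(* Weak convergence of measures on the subspace E, for measures on the ambient
   space carried by E; test functions are only required to be continuous and
   bounded on E. *)
Definition weak_cvg_on (R : realType) (m n : nat) (E : set 'M[R]_(m, n))
    (mu_ : nat -> {measure set 'M[R]_(m, n) -> \bar R})
    (mu : {measure set 'M[R]_(m, n) -> \bar R}) : Prop :=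
  forall f : 'M[R]_(m, n) -> R,
    {within E, continuous f} ->
    (exists K : R, forall x, E x -> `|f x| <= K) ->
    \int[mu_ k]_(x in E) f x @[k --> \oo] --> \int[mu]_(x in E) f x.

(* The random vectors Y k may live on different probability spaces. *)
Definition cvg_in_distribution (R : realType) (r : nat)
    (disp : nat -> measure_display) (T : forall k, measurableType (disp k))
    (P : forall k, probability (T k) R) (Y : forall k, T k -> 'rV[R]_r)
    (mu : probability 'rV[R]_r R) : Prop :=
  forall f : 'rV[R]_r -> R,
    continuous f -> (exists K : R, forall x, `|f x| <= K) ->
    \int[P k]_w f (Y k w) @[k --> \oo] --> \int[mu]_y f y.

(* Taking some B i := setT gives the product rule for every subfamily. *)
Definition mutually_independent (R : realType) (d d' : measure_display)
    (T : measurableType d) (T' : measurableType d') (P : probability T R)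
    (I : finType) (X : I -> T -> T') : Prop :=
  forall B : I -> set T', (forall i, measurable (B i)) ->
    fine (P (\bigcap_(i in [set: I]) (X i @^-1` B i))) =
    \prod_(i : I) fine (P (X i @^-1` B i)).

(* The law of r independent standard normal variables. *)
Definition std_normal_law (R : realType) (r : nat)
    (g : probability 'rV[R]_r R) : Prop :=
  forall B : 'I_r -> set R, (forall i, measurable (B i)) ->
    fine (g [set z : 'rV[R]_r | forall i, B i (z 0 i)]) =
    \prod_(i < r) fine (normal_prob 0 1 (B i)).

(* N(a, Psi), possibly degenerate: the law of a + Z A where Z has independent
   standard normal entries and A^T A = Psi. *)
Definition normal_law (R : realType) (r : nat) (a : 'rV[R]_r) (Psi : 'M[R]_r)
    (mu : probability 'rV[R]_r R) : Prop :=
  exists (k : nat) (g : probability 'rV[R]_k R) (A : 'M[R]_(k, r)),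
    [/\ std_normal_law g, A^T *m A = Psi &
        forall B : set 'rV[R]_r, measurable B ->
          mu B = g [set z : 'rV[R]_k | B (a + z *m A)]].

Definition gaussian_vector (R : realType) (d : measure_display)
    (T : measurableType d) (P : probability T R) (r : nat)
    (X : {mfun T >-> 'rV[R]_r}) : Prop :=
  exists (a : 'rV[R]_r) (Psi : 'M[R]_r), normal_law a Psi (distribution P X).

Definition coord (R : realType) (T : Type) (r : nat) (X : T -> 'rV[R]_r)
    (j : 'I_r) : T -> R := fun w => X w 0 j.

Definition std_normal_coords (R : realType) (d : measure_display)
    (T : measurableType d) (P : probability T R) (r : nat)
    (X : T -> 'rV[R]_r) : Prop :=
  forall (j : 'I_r) (B : set R), measurable B ->
    P (coord X j @^-1` B) = normal_prob 0 1 B.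

Definition correlation_mx (R : realType) (d : measure_display)
    (T : measurableType d) (P : probability T R) (r : nat)
    (X : T -> 'rV[R]_r) : 'M[R]_r :=
  \matrix_(j, k) (fine (covariance P (coord X j) (coord X k)) /
    (Num.sqrt (fine 'V_P[coord X j]) * Num.sqrt (fine 'V_P[coord X k]))).

(* A centered normal law with covariance Psi exists iff Psi is a covariance
   matrix, and it is then unique. *)
Definition survivor (R : realType) (r : nat) (x : 'rV[R]_r) (Psi : 'M[R]_r)
    : R :=
  if pselect (exists mu : probability 'rV[R]_r R, normal_law 0 Psi mu) is left e
  then fine (projT1 (cid e) [set y : 'rV[R]_r | forall i, x 0 i < y 0 i])
  else 0.

(* Strictly conditionally negative definite matrices. *)
Definition D0 (R : realType) (d : nat) : set 'M[R]_d :=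
  [set A : 'M[R]_d | [/\ nonneg_mx A, A^T = A, forall j, A j j = 0 &
    forall x : 'rV[R]_d, x != 0 -> \sum_i x 0 i = 0 ->
      (x *m A *m x^T) 0 0 < 0]].

Definition sq_mx (R : realType) (d : nat) (L : 'M[R]_d) : 'M[R]_d :=
  map_mx (fun a => a ^+ 2) L.

Definition sq_measure (R : realType) (d : nat) (tau : set 'M[R]_d -> \bar R)
    : set 'M[R]_d -> \bar R := pushforward tau (@sq_mx R d).

(* An index vector m_1 < ... < m_l with l = k.+1 is an increasing function
   m : 'I_k.+1 -> 'I_d; its last entry m_l is m ord_max, and ini embeds the
   first l - 1 positions. *)
Definition ini (k : nat) (i : 'I_k) : 'I_k.+1 := widen_ord (leqnSn k) i.

Definition increasing_idx (d k : nat) (m : {ffun 'I_k.+1 -> 'I_d}) : bool :=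
  [forall i : 'I_k.+1, forall j : 'I_k.+1, (i < j)%N ==> (m i < m j)%N].

Definition Gam (R : realType) (d k : nat) (m : {ffun 'I_k.+1 -> 'I_d})
    (L : 'M[R]_d) : 'M[R]_k :=
  \matrix_(i, j) (2 * (L (m (ini i)) (m ord_max) ^+ 2
                       + L (m (ini j)) (m ord_max) ^+ 2
                       - L (m (ini i)) (m (ini j)) ^+ 2)).

Definition h_fun (R : realType) (d k : nat) (m : {ffun 'I_k.+1 -> 'I_d})
    (L : 'M[R]_d) (y : 'I_k.+1 -> R) : R :=
  if k == 0%N then expR (- y ord_max) else
  \int[@lebesgue_measure R]_(z in `[y ord_max, +oo[)
    (survivor
       (\row_(i < k) (y (ini i) - z + 2 * L (m (ini i)) (m ord_max) ^+ 2))
       (Gam m L) * expR (- z)).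

Definition H_df (R : realType) (d : nat) (L : 'M[R]_d) (x : 'rV[R]_d) : R :=
  expR (\sum_(k < d) (-1) ^+ k.+1 *
          \sum_(m : {ffun 'I_k.+1 -> 'I_d} | increasing_idx m)
            h_fun m L (fun i => x 0 (m i))).

Definition H_mix (R : realType) (d : nat)
    (eta : {measure set 'M[R]_d -> \bar R}) (x : 'rV[R]_d) : R :=
  expR (\int[eta]_(L in @nonneg_mx R d) ln (H_df L x)).

Definition Lam (R : realType) (d : nat) (b : R) (Sigma : 'M[R]_d) : 'M[R]_d :=
  map_mx Num.sqrt ((b ^+ 2 / 2) *: (const_mx 1 - Sigma)).

(* (n+1)^-1 times the sum of the Dirac masses at L 0, ..., L n. *)
Definition empirical_measure (R : realType) (d n : nat) (L : 'I_n.+1 -> 'M[R]_d)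
    : {measure set 'M[R]_d -> \bar R} :=
  mscale ((n.+1%:R)^-1)%:nng (msum (fun i => \d_(L (inord i))) n.+1).

Definition normalized_max (R : realType) (d n : nat) (b : R) (T : Type)
    (X : 'I_n.+1 -> T -> 'rV[R]_d) (w : T) : 'rV[R]_d :=
  \row_j \big[Num.max/b * (X ord0 w 0 j - b)]_(i < n.+1)
    (b * (X i w 0 j - b)).

(* Main.v *)
(** Let [p n i] be the probability that some coordinate of [X n i] exceeds its
    threshold [b n + x j / b n]. Independence within rows turns the distribution
    function of the maximum into the product of the [1 - p n i], and as
    [p n i = O(1/n)] the product behaves like [exp (- sum_i p n i)]. By
    inclusion-exclusion [(n+1) p n i] is a signed sum of joint exceedance
    probabilities of subvectors; conditioning on the last coordinate
    [b n + z / b n] and rescaling by [b n] turns each of them into an integral of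
    a Gaussian survivor probability against [exp (- z)], which converges to
    [h_fun] at [La] along any rows for which [Lam (b n) (Sigma n i)] tends to [La]
    with [sq_mx La] in [D0]: strict negative definiteness makes the limiting
    covariance matrices positive definite, hence the survivor functions
    continuous. So the sum of the [p n i] is an average, over the empirical
    measure, of values that become close to [- ln (H_df La x)] near each such [La];
    Lipschitz lower and upper envelopes of these values reduce its convergence to
    weak convergence to [eta].

    That the limit [H_mix] is the distribution function of a probability measure,
    and that the convergence is in distribution, follows from tightness: along an
    ultrafilter, the standard part pushes the Loeb measure of the ultraproduct of
    the laws to a limit law. Its distribution function is [H_mix], whose right
    continuity, like tightness, comes from the Gumbel limit of the coordinates. *)

From HB Require Import structures.
From mathcomp Require Import all_boot all_order all_algebra.
From mathcomp Require Import all_classical all_reals all_analysis.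
From mathcomp Require Import measurable_realfun ring lra.
Require Import Defs.

Set Implicit Arguments.
Unset Strict Implicit.
Unset Printing Implicit Defensive.

Import Order.TTheory GRing.Theory Num.Theory.
Import numFieldNormedType.Exports.

Local Open Scope classical_set_scope.
Local Open Scope ring_scope.

(** * Borel sets of matrices *)

(** Two obstacles shape the proof. First, [survivor] chooses a law among those with a given
    covariance, and the covariances that approach a limiting one may be degenerate, so densities of
    vectors and inverse matrices are avoided. A Gaussian law is represented by any factor [A] with
    [A^T *m A] its covariance, with any number of rows, and is handled by conditioning on one
    coordinate at a time. Rotation invariance makes the factor triangular, which turns conditioning
    into Fubini; induction on the dimension then asks for positivity of the limiting covariance
    only. Second, [ln (H_df La x)] is controlled only at the square roots of matrices in [D0], and
    there along sequences: the local statement is proved by contradiction along a sequence of rows,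
    and the Lipschitz envelopes supply the continuous test functions that weak convergence accepts.
    An ultrafilter yields a limit law directly; as a law is determined by its values on orthants,
    all ultrafilters yield the same one, and this upgrades convergence along each of them to
    convergence of the whole sequence. *)

Section BorelMatrix.
Variables (R : realType) (m n : nat).
Implicit Types (S : set (set 'M[R]_(m, n))).
Let rq (q : 'M[rat]_(m, n)) : 'M[R]_(m, n) := map_mx ratr q.

(** Balls with rational centres and radii [k.+1%:R^-1] form a countable base, so a sigma-algebra
    containing them contains all open sets. *)
Lemma open_mx_ball_cover (O : set 'M[R]_(m, n)) : open O -> O =
  \bigcup_(k : nat) \bigcup_(q in [set q : 'M[rat]_(m, n) |
     ball (rq q) k.+1%:R^-1 `<=` O])
    ball (rq q) k.+1%:R^-1.
Proof.
move=> oO; apply/seteqP; split => [M OM|M [k _ [q /= qO]]]; last exact: qO.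
have /nbhs_ballP[e /= e0 eO] : nbhs M O by exact: open_nbhs_nbhs.
have [k ke] : exists k : nat, k.+1%:R^-1 < e / 2.
  have e2 : 0 < e / 2 by rewrite divr_gt0.
  have [k _ /(_ k (leqnn k))] := near_infty_natSinv_lt (PosNum e2).
  by exists k.
have q_ i j : {q : rat | ratr q \in `]M i j - k.+1%:R^-1, M i j + k.+1%:R^-1[ :> bool}.
  by apply/cid; apply: rat_in_itvoo; rewrite ltrD2l gtrN.
pose q : 'M[rat]_(m, n) := \matrix_(i, j) projT1 (q_ i j).
have qM : ball (rq q) k.+1%:R^-1 M.
  split=> // i j; rewrite !mxE /ball /=; case: (q_ i j) => x /=.
  by rewrite in_itv/= => /andP[a b]; rewrite ltr_norml ltrBlDl b ltrBrDl a.
exists k => //; exists q => //= N qN; apply: eO.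
rewrite [e]splitr; apply: (@ball_triangle _ _ (rq q)).
  by apply/ball_sym; exact: (le_ball (ltW ke) qM).
exact: (le_ball (ltW ke) qN).
Qed.

(** [S] is arbitrary so that the lemma serves both for classes of sets with measurable preimage, in
    proving functions measurable, and for classes generated by orthants or rectangles, in proving
    two laws equal. *)
Lemma sigma_algebra_open_mx S : sigma_algebra setT S ->
  (forall i j (a : R), S [set M : 'M[R]_(m, n) | M i j <= a]) -> open `<=` S.
Proof.
move=> [S0 SC SU] Sle O /open_mx_ball_cover ->.
have SI A : (forall k : nat, S (A k)) -> S (\bigcap_k A k).
  move=> SA; rewrite -[X in S X]setCK setC_bigcap -setTD; apply: (SC).
  by apply: SU => k; rewrite -setTD; exact: SC.
have Slt i j a : S [set M : 'M[R]_(m, n) | M i j < a].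
  rewrite [X in S X](_ : _ = \bigcup_k [set M : 'M[R]_(m, n) | M i j <= a - k.+1%:R^-1]).
    by apply: SU => k; exact: Sle.
  apply/seteqP; split => [M /= Ma|M [k _ /=] /le_lt_trans]; last first.
    by apply; rewrite gtrBl.
  have aM : 0 < a - M i j by rewrite subr_gt0.
  have [k _ /(_ k (leqnn k))/= kM] := near_infty_natSinv_lt (PosNum aM).
  by exists k => //=; rewrite lerBrDr addrC -lerBrDr ltW.
have Sgt i j a : S [set M : 'M[R]_(m, n) | a < M i j].
  rewrite [X in S X](_ : _ = setT `\` [set M : 'M[R]_(m, n) | M i j <= a]); first by apply: SC.
  by rewrite setTD; apply/seteqP; split => M /=; rewrite real_ltNge ?num_real// => /negP.
have STT : S setT by rewrite -(setD0 setT); exact: SC.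
have SII A B : S A -> S B -> S (A `&` B).
  move=> SA SB; rewrite (_ : _ `&` _ = \bigcap_k (if k is 0 then A else B)).
    by apply: SI => -[].
  by apply/seteqP; split => [x [? ?] [] //|x h]; split; [apply: (h 0)|apply: (h 1)].
have Sfin (J : finType) (A : J -> set 'M[R]_(m, n)) : (forall i, S (A i)) ->
    S [set M : 'M[R]_(m, n) | forall i, A i M].
  move=> SA; rewrite [X in S X](_ : _ = \bigcap_k (if unpickle k is Some i then A i else setT)).
    by apply: SI => k; case: unpickle.
  apply/seteqP; split => [M /= h k _|M h i].
    by case: unpickle.
  by have := h (pickle i) I; rewrite pickleK.
(* Only unions indexed by [nat] are available, so the rational centres are enumerated by [unpickle],
   with the empty set at the codes to be skipped. *)
have SU' := SU; apply: SU' => k; rewrite (_ : bigcup _ _ = \bigcup_l (if @unpickle 'M[rat]_(m, n) l is Some q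
    then (if `[< ball (rq q) k.+1%:R^-1 `<=` O >]
      then ball (rq q) k.+1%:R^-1 else set0) else set0)).
  apply: SU => l; case: unpickle => // q; case: ifPn => // _.
  (* A max-norm ball is a finite intersection of coordinate strips. *)
  rewrite (_ : ball _ _ = [set M : 'M[R]_(m, n) | forall ij : 'I_m * 'I_n,
      [set M : 'M[R]_(m, n) | ratr (q ij.1 ij.2) - k.+1%:R^-1 < M ij.1 ij.2] M /\
      [set M : 'M[R]_(m, n) | M ij.1 ij.2 < ratr (q ij.1 ij.2) + k.+1%:R^-1] M]).
    by apply: Sfin => ij; apply: SII; [exact: Sgt|exact: Slt].
  apply/seteqP; split => [M [_ h] [i j] /=|M /= h].
    by have := h i j; rewrite mxE /ball /= ltr_distlC => /andP[? ?]; split.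
  split => // i j; have [/=] := h (i, j).
  by rewrite mxE /ball /= ltr_distlC => -> ->.
apply/seteqP; split => [M [q qO qM]|M [l _]].
  by exists (pickle q) => //; rewrite pickleK asboolT.
by case: unpickle => // q; case: ifPn => // /asboolP qO qM; exists q.
Qed.

Lemma measurable_mx_sub S : sigma_algebra setT S ->
  (forall i j (a : R), S [set M : 'M[R]_(m, n) | M i j <= a]) ->
  (measurable : set (set 'M[R]_(m, n))) `<=` S.
Proof.
move=> sS Sle A; apply: smallest_sub => //; exact: sigma_algebra_open_mx.
Qed.

Lemma measurable_fun_mx_le d (T : measurableType d) (f : T -> 'M[R]_(m, n)) :
  (forall i j (a : R), measurable [set x | f x i j <= a]) -> measurable_fun setT f.
Proof.
move=> mf _ B mB; rewrite setTI.
pose S := [set B | measurable (f @^-1` B)].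
apply: (@measurable_mx_sub S) => //.
split; rewrite /S/=; first by rewrite preimage_set0.
  by move=> A mA; rewrite setTD preimage_setC; exact: measurableC.
by move=> A mA; rewrite preimage_bigcup; exact: bigcup_measurable.
Qed.

Lemma measurable_fun_mx d (T : measurableType d) (f : T -> 'M[R]_(m, n)) :
  (forall i j, measurable_fun setT (fun x => f x i j)) -> measurable_fun setT f.
Proof.
move=> mf; apply: measurable_fun_mx_le => i j a; rewrite -[X in measurable X]setTI.
rewrite (_ : [set x | _] = (fun x => f x i j) @^-1` `]-oo, a]); first exact: mf.
by apply/seteqP; split => x /=; rewrite in_itv.
Qed.

Lemma measurable_coord i j : measurable_fun setT (fun M : 'M[R]_(m, n) => M i j).
Proof.
apply: (measurability _ (RGenOpens.measurableE R)) => _ [_ [a [b ->] <-]].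
rewrite setTI; apply: sub_sigma_algebra; apply: open_comp; last exact: interval_open.
by move=> M _; exact: coord_continuous.
Qed.

End BorelMatrix.

Lemma continuous_measurable_mx (R : realType) m n (f : 'M[R]_(m, n) -> R) :
  continuous f -> measurable_fun setT f.
Proof.
move=> cf.
apply: (measurability _ (RGenOpens.measurableE R)) => _ [_ [a [b ->] <-]].
rewrite setTI; apply: sub_sigma_algebra; apply: open_comp; last exact: interval_open.
by move=> M _; exact: cf.
Qed.

Lemma open_measurable_mx (R : realType) m n (O : set 'M[R]_(m, n)) :
  open O -> measurable O.
Proof. exact: sub_sigma_algebra. Qed.

Lemma closed_measurable_mx (R : realType) m n (C : set 'M[R]_(m, n)) :
  closed C -> measurable C.
Proof.
move=> cC; rewrite -(setCK C); apply: measurableC; apply: open_measurable_mx.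
exact: closed_openC.
Qed.

(** * Loeb measures and tight sequences of laws *)

Lemma ultra_fmap (T T' : Type) (f : T -> T') (U : set_system T) :
  UltraFilter U -> UltraFilter (f @ U).
Proof.
move=> FU; split; first exact: fmap_proper_filter.
move=> G GF UG; rewrite predeqE => A; split; last exact: UG.
move=> GA; have [//|UnA] := in_ultra_setVsetC (f @^-1` A) FU.
have GnA : G (~` A) by exact: UG.
by have [x []] := @filter_ex _ _ GF _ (filterI GA GnA).
Qed.

Section UltraLimit.
Variables (R : realType) (U : set_system nat).
Hypothesis FU : UltraFilter U.
Implicit Types a b : nat -> R.

(** [lim] has a default value when there is no limit; for bounded sequences compactness of a segment
    makes this a genuine limit along every ultrafilter. *)
Definition ulim a : R := lim (a @ U).

Lemma ultra_bounded_cvg a m M : U [set n | m <= a n <= M] -> a @ U --> ulim a.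
Proof.
move=> aM; have : compact `[m, M]%classic by exact: segment_compact.
rewrite compact_ultra => /(_ (a @ U) (ultra_fmap _ FU)); case.
  change (U (a @^-1` `[m, M])); apply: filterS aM => n /= anM; by rewrite in_itv.
by move=> x [_ ax]; exact: (cvgP x ax).
Qed.

Lemma ulim_eq a l : a @ U --> l -> ulim a = l.
Proof. exact: cvg_lim. Qed.

Lemma ulim_ge a m M l : U [set n | m <= a n <= M] -> U [set n | l <= a n] -> l <= ulim a.
Proof.
move=> aM la; rewrite -(@ulim_eq (cst l) l); last exact: cvg_cst.
apply: ler_lim; first exact: is_cvg_cst.
  exact: cvgP (ultra_bounded_cvg aM).
by apply: filterS la.
Qed.

End UltraLimit.

Lemma probability_fine01 (R : realType) (d : measure_display) (V : measurableType d)
    (Q : probability V R) (A : set V) : measurable A -> 0 <= fine (Q A) <= 1.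
Proof.
move=> mA; rewrite -!lee_fin fineK ?fin_num_measure//.
by rewrite measure_ge0 probability_le1.
Qed.

Section UltraProbability.
Variables (R : realType) (d : measure_display) (V : measurableType d).
Variables (mu : nat -> probability V R) (U : set_system nat).
Hypothesis FU : UltraFilter U.

Lemma ulim_probability A : (forall n, measurable (A n)) ->
  (fun n => fine (mu n (A n))) @ U --> ulim U (fun n => fine (mu n (A n))).
Proof.
move=> mA; apply: (@ultra_bounded_cvg R U FU _ 0 1).
by apply: filterE => n; exact: probability_fine01.
Qed.

End UltraProbability.

Section Internal.
Variables (V : pointedType) (U : set_system nat).
Hypothesis FU : UltraFilter U.
Hypothesis Uoo : \oo `<=` U.
Implicit Types A B : nat -> set V.

(** Internal set of the ultraproduct, without taking the quotient: sequences that agree [U]-almost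
    everywhere belong to the same internal sets. *)
Definition internal A : set (nat -> V) := [set w | U [set n | A n (w n)]].

Lemma internalC A : ~` internal A = internal (fun n => ~` A n).
Proof.
apply/seteqP; split => w /=; rewrite /internal/= => Aw.
  by have [|//] := in_ultra_setVsetC [set n | A n (w n)] FU.
by move=> Aw'; have [n []] := filter_ex (filterI Aw Aw').
Qed.

Lemma internalI A B : internal A `&` internal B = internal (fun n => A n `&` B n).
Proof.
apply/seteqP; split => [w [Aw Bw]|w ABw]; first exact: filterI.
by split; apply: filterS ABw => n [].
Qed.

Lemma internalU A B : internal A `|` internal B = internal (fun n => A n `|` B n).
Proof.
rewrite -[LHS]setCK setCU !internalC internalI internalC.
by congr internal; apply/funext => n; rewrite -setCU setCK.
Qed.

Lemma internal0 : internal (fun=> set0) = set0.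
Proof.
by apply/seteqP; split => // w /=; rewrite /internal => /filter_ex[n []].
Qed.

(** If [A n] and [B n] differed for [U]-almost all [n], a sequence of points taken from their
    symmetric differences would lie in exactly one of the two internal sets. This makes the content
    of an internal set independent of the sequence representing it. *)
Lemma internal_inj A B : internal A = internal B -> U [set n | A n = B n].
Proof.
move=> AB; have [//|nAB] := in_ultra_setVsetC [set n | A n = B n] FU.
have w_ n : exists w : V, A n <> B n -> ~ (A n w <-> B n w).
  have [E|/eqP nE] := pselect (A n = B n); first by exists point.
  apply: contrapT => /forallNP h; apply: (elimN eqP nE).
  apply/seteqP; split => w; have := h w; move/not_implyP => -[_ /contrapT []]; tauto.
pose w n := projT1 (cid (w_ n)).
have wP n : A n <> B n -> ~ (A n (w n) <-> B n (w n)) by exact: (projT2 (cid (w_ n))).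
have [UA|UA] := in_ultra_setVsetC [set n | A n (w n)] FU.
  have : internal A w by []; rewrite AB => UB.
  by have [n [[An Bn] nABn]] := filter_ex (filterI (filterI UA UB) nAB); have [] := wP n nABn.
have : ~ internal A w by move=> UA'; have [n []] := filter_ex (filterI UA UA').
rewrite AB; have [UB //|UB _] := in_ultra_setVsetC [set n | B n (w n)] FU.
by have [n [[An Bn] nABn]] := filter_ex (filterI (filterI UA UB) nAB); have [] := wP n nABn.
Qed.

(** Countable saturation. If no finite subfamily covers, then [C K], what is left of [B] after
    removing the first [K] sets, is nonempty at [U]-almost every index, and a diagonal choice yields
    a point of [internal B] outside every [internal (A k)]. By [Uoo] the diagonal may ignore the
    indices below [K]. *)
Lemma internal_saturation B (A : nat -> nat -> set V) :
  internal B `<=` \bigcup_k internal (A k) ->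
  exists K, internal B `<=` \bigcup_(k < K) internal (A k).
Proof.
move=> BA; apply: contrapT => /forallNP nK.
pose C K n := B n `\` \bigcup_(k < K) A k n.
have UC K : U [set n | C K n !=set0].
  have /nonsubset [w [Bw nw]] := nK K.
  suff: internal (C K) w by apply: filterS => n ?; exists (w n).
  elim: K nw => [|K IH] nw.
    by apply: filterS Bw => n ?; split => // -[].
  have /IH Cw : ~ (\bigcup_(k < K) internal (A k)) w.
    by apply: contra_not nw => -[k kK Aw]; exists k => //=; exact: ltnW.
  have : (~` internal (A K)) w by apply: contra_not nw => ?; exists K => /=.
  rewrite internalC => nAw.
  have : U ([set n | C K n (w n)] `&` [set n | (~` A K n) (w n)]) by exact: filterI.
  apply: filterS => n [[Bn nA] nAK].
  split => // -[k /=]; rewrite ltnS leq_eqVlt => /predU1P[->//|kK] ?.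
  by apply: nA; exists k.
(* [C K n] decreases with [K], so a point of the last nonempty one with [K <= n] lies in all the
   earlier ones. *)
have w_ n : exists w : V, forall K, (K <= n)%N -> C K n !=set0 -> C K n w.
  suff H m : exists w : V, forall K, (K <= m)%N -> C K n !=set0 -> C K n w by exact: H.
  elim: m => [|m [w wP]].
    have [[w Cw]|nC] := pselect (C 0%N n !=set0).
      by exists w => K; rewrite leqn0 => /eqP ->.
    by exists point => K; rewrite leqn0 => /eqP ->.
  have [[w' [Bw' Cw']]|nC] := pselect (C m.+1 n !=set0).
    exists w' => K Km _; split => // -[k /= kK Ak]; apply: Cw'; exists k => //=.
    exact: leq_trans kK Km.
  by exists w => K; rewrite leq_eqVlt => /predU1P[->//|]; rewrite ltnS; exact: wP.
pose w n := projT1 (cid (w_ n)).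
have wP K : internal (C K) w.
  have UK : U [set n | (K <= n)%N] by apply: Uoo; exists K.
  apply: filterS (filterI UK (UC K)) => n [? ?]; exact: (projT2 (cid (w_ n))).
have Bw : internal B w by apply: filterS (wP 0%N) => n [].
have [k _ Akw] := BA _ Bw.
have [n [[_ nA] An]] := filter_ex (filterI (wP k.+1) Akw).
by apply: nA; exists k => /=.
Qed.

End Internal.

(* [FU] is a phantom argument, from which the algebra of internal sets is inferred. *)
Definition loeb_space d (V : measurableType d) (U : set_system nat)
  (FU : UltraFilter U) : Type := nat -> V.

Section LoebSpace.
Variables (d : measure_display) (V : measurableType d) (U : set_system nat).
Variable FU : UltraFilter U.

Definition internal_sets : set (set (loeb_space V FU)) :=
  [set S | exists2 A : nat -> set V, (forall n, measurable (A n)) & S = internal U A].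

Lemma internal_sets0 : internal_sets set0.
Proof. by exists (fun=> set0); [move=> n; exact: measurable0|rewrite internal0]. Qed.

Lemma internal_setsU : setU_closed internal_sets.
Proof.
move=> _ _ [A mA ->] [B mB ->]; exists (fun n => A n `|` B n); last by rewrite -internalU.
by move=> n; exact: measurableU.
Qed.

Lemma internal_setsC : setC_closed internal_sets.
Proof.
move=> _ [A mA ->]; exists (fun n => ~` A n); last by rewrite -internalC.
by move=> n; exact: measurableC.
Qed.

HB.instance Definition _ := Pointed.copy (loeb_space V FU) (nat -> V).

HB.instance Definition _ := @isAlgebraOfSets.Build default_measure_display
  (loeb_space V FU) internal_sets internal_sets0 internal_setsU internal_setsC.

End LoebSpace.

(** A measure is a total function: a representing sequence is chosen, and sets that are not internal
    get the constant empty sequence. [Uoo] is recorded among the arguments so that the measure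
    instance, whose sigma-additivity rests on saturation, can be inferred. *)
Definition loeb_content (R : realType) d (V : measurableType d) (U : set_system nat)
    (FU : UltraFilter U) (Uoo : \oo `<=` U) (mu : nat -> probability V R) (S : set (loeb_space V FU)) : \bar R :=
  (ulim U (fun n => fine (mu n (xget (fun=> set0)
     [set A | (forall n, measurable (A n)) /\ S = internal U A] n))))%:E.

Section LoebContent.
Variables (R : realType) (d : measure_display) (V : measurableType d).
Variables (U : set_system nat) (FU : UltraFilter U) (mu : nat -> probability V R).
Hypothesis Uoo : \oo `<=` U.
Local Notation lc := (@loeb_content R d V U FU Uoo mu).

Lemma loeb_contentE (A : nat -> set V) : (forall n, measurable (A n)) ->
  lc (internal U A) = (ulim U (fun n => fine (mu n (A n))))%:E.
Proof.
move=> mA; rewrite /loeb_content; set B := xget _ _.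
have [mB AB] : (forall n, measurable (B n)) /\ internal U A = internal U B.
  have := @xgetPex _ (fun=> set0) [set B | (forall n, measurable (B n)) /\
    internal U A = internal U B]; apply; by exists A.
congr EFin; apply: ulim_eq; apply: cvg_trans (ulim_probability FU mA).
apply: near_eq_cvg; move: (internal_inj FU AB); apply: filterS => n /= ->; exact: erefl.
Qed.

Lemma loeb_content_ge0 S : (0 <= lc S)%E.
Proof.
rewrite /loeb_content lee_fin; set B := xget _ _.
have H n : 0 <= fine (mu n (B n)) <= 1.
  apply: probability_fine01; rewrite /B; case: xgetP => [C _ []//|_].
  exact: measurable0.
apply: (ulim_ge FU (m := 0) (M := 1)); apply: filterE => n; first exact: H.
by have /andP[] := H n.
Qed.

Lemma loeb_content0 : lc set0 = 0%E.
Proof.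
rewrite -(internal0 V FU) loeb_contentE; last by move=> n; exact: measurable0.
by congr EFin; apply: ulim_eq; under eq_fun do rewrite measure0; exact: cvg_cst.
Qed.

Lemma loeb_contentU S T : internal_sets S -> internal_sets T -> S `&` T = set0 ->
  lc (S `|` T) = (lc S + lc T)%E.
Proof.
move=> [A mA ->] [B mB ->] AB.
have -> : internal U B = internal U (fun n => B n `&` ~` A n).
  by rewrite -internalI -internalC; apply/esym/setIidPl/subsets_disjoint; rewrite setCK setIC.
have mBA n : measurable (B n `&` ~` A n) by apply: measurableI => //; exact: measurableC.
rewrite internalU// !loeb_contentE//; last by move=> n; exact: measurableU.
rewrite -EFinD; congr EFin; apply: ulim_eq.
rewrite (_ : (fun n => _) = (fun n => fine (mu n (A n)) + fine (mu n (B n `&` ~` A n)))).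
  by apply: cvgD; exact: ulim_probability.
apply/funext => n; rewrite measureU// ?fineD ?fin_num_measure//.
by rewrite setIC -setIA setICl setI0.
Qed.

(** By saturation, a countable disjoint union of internal sets that is itself internal has only
    finitely many nonempty terms, so finite additivity suffices. *)
Lemma loeb_content_sigma_additive : semi_sigma_additive lc.
Proof.
move=> F mF tF mUF.
have [K FK] : exists K, \bigcup_k F k = \bigcup_(k < K) F k.
  pose A k := projT1 (cid2 (mF k)); have FA k : F k = internal U (A k).
    by rewrite /A; case: cid2.
  have [B mB FB] := mUF.
  have /internal_saturation [|K BK] : internal U B `<=` \bigcup_k internal U (A k).
  - by rewrite -FB => x [k _ Fk]; exists k => //; rewrite -FA.
  - exact: Uoo.
  exists K; apply/seteqP; split; last by move=> x [k _ Fk]; exists k.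
  by rewrite FB => x /BK[k kK Ak]; exists k => //; rewrite FA.
have F0 k : (K <= k)%N -> F k = set0.
  move=> Kk; apply/eqP; apply/negPn/negP => /set0P[x Fx].
  have : (\bigcup_k F k) x by exists k.
  rewrite FK => -[l /= lK Fl].
  by have E : l = k by [apply: tF => //; exists x]; move: lK; rewrite E ltnNge Kk.
have sumE n : (\sum_(0 <= i < n) lc (F i))%E = lc (\bigcup_(k < n) F k).
  elim: n => [|n IH]; first by rewrite big_nil bigcup0//; exact/esym/loeb_content0.
  rewrite big_nat_recr//= IH -loeb_contentU//.
  - by congr lc; rewrite !bigcup_mkord big_ord_recr.
  - rewrite bigcup_mkord; apply: (@bigsetU_measurable _ (loeb_space V FU)) => i _; exact: mF.
  - exact: mF.
  - apply/seteqP; split => // x [[k /= kn Fk] Fn].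
    by have E : k = n by [apply: tF => //; exists x]; move: kn; rewrite E ltnn.
rewrite FK; apply: cvg_near_cst; exists K => // n /= Kn; rewrite sumE; congr lc.
apply/seteqP; split => [x [k /= kn Fk]|x [k /= kK Fk]]; last by exists k => //=; exact: leq_trans Kn.
have [kK|/F0 Fk0] := ltnP k K; first by exists k.
by move: Fk; rewrite Fk0.
Qed.

HB.instance Definition _ := isMeasure.Build _ _ _ lc
  loeb_content0 loeb_content_ge0 loeb_content_sigma_additive.

End LoebContent.

Section MeasurableInstances.
Variables (R : realType) (d d' : measure_display).
Variables (T : measurableType d) (T' : measurableType d').

Definition mfun_of (f : T -> T') (mf : measurable_fun setT f) : {mfun T >-> T'} :=
  mfun_Sub (mem_set mf).

Definition law (P : probability T R) (f : T -> T') (mf : measurable_fun setT f) :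
  probability T' R := distribution P (mfun_of mf).

Lemma lawE P f mf A : @law P f mf A = P (f @^-1` A). Proof. by []. Qed.

End MeasurableInstances.

Section LoebMeasure.
Variables (R : realType) (d : measure_display) (V : measurableType d).
Variables (U : set_system nat) (FU : UltraFilter U) (Uoo : \oo `<=` U).
Variable mu : nat -> probability V R.
Local Notation lc := (@loeb_content R d V U FU Uoo mu).

(** Caratheodory extension to the sigma-algebra generated by the internal sets, for which the
    standard part map is measurable. *)
Definition loeb_measure :=
  measure_extension (lc : {measure set (loeb_space V FU) -> \bar R}).

HB.instance Definition _ := Measure.on loeb_measure.

Lemma loeb_measureE (A : nat -> set V) : (forall n, measurable (A n)) ->
  loeb_measure (internal U A) = (ulim U (fun n => fine (mu n (A n))))%:E.
Proof.
move=> mA; rewrite /loeb_measure /measure_extension measurable_mu_extE/=.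
  exact: loeb_contentE.
by exists A.
Qed.

Let loeb_measureT : loeb_measure setT = 1%E.
Proof.
have -> : [set: g_sigma_algebraType (@measurable _ (loeb_space V FU))] =
    internal U (fun=> setT) :> set (nat -> V).
  by apply/seteqP; split => // w _; rewrite /internal/=; exact: filterT.
rewrite loeb_measureE//; congr EFin; apply: ulim_eq.
by under eq_fun do rewrite probability_setT; exact: cvg_cst.
Qed.

HB.instance Definition _ := Measure_isProbability.Build _ _ _ loeb_measure loeb_measureT.

End LoebMeasure.

Lemma measurable_box (R : realType) r (M : R) :
  measurable [set y : 'rV[R]_r | forall j, `|y 0 j| <= M].
Proof.
apply: closed_measurable_mx; rewrite (_ : mkset _ =
  \bigcap_(j in setT) (fun y : 'rV[R]_r => `|y 0 j|) @^-1` [set x | x <= M]).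
  apply: closed_bigI => j _; apply: closed_comp; last exact: closed_le.
  move=> y _; apply: continuous_comp; last exact: norm_continuous.
  exact: coord_continuous.
by apply/seteqP; split => y h; [move=> j _; exact: h|move=> j; exact: (h j)].
Qed.

Section LoebLimit.
Variables (R : realType) (r : nat) (mu : nat -> probability 'rV[R]_r R).
Variables (U : set_system nat) (FU : UltraFilter U) (Uoo : \oo `<=` U).

Hypothesis tight : forall e : R, 0 < e -> exists M : R, \forall n \near \oo,
  1 - e <= fine (mu n [set y : 'rV[R]_r | forall j, `|y 0 j| <= M]).

Let V : measurableType _ := 'rV[R]_r.
Local Notation lm := (@loeb_measure R _ V U FU Uoo mu).
Let Omega := g_sigma_algebraType (@measurable _ (loeb_space V FU)).
Let box (M : R) : set V := [set y : 'rV[R]_r | forall j, `|y 0 j| <= M].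
(** The near-standard points: sequences bounded [U]-almost everywhere, for which the standard part
    exists. *)
Let Bd : set (nat -> V) := \bigcup_k internal U (fun=> box k%:R).
(** Standard part, with the default value 0 off [Bd], a null set by tightness. *)
Let st (w : nat -> V) : V :=
  if `[< Bd w >] then \row_j ulim U (fun n => w n 0 j) else 0.

Let st_cvg w j : Bd w -> (fun n => w n 0 j) @ U --> st w 0 j.
Proof.
move=> Bw; rewrite /st asboolT// mxE.
have [k _ kw] := Bw; apply: (ultra_bounded_cvg FU (m := - k%:R) (M := k%:R)).
by apply: filterS kw => n /= /(_ j); rewrite ler_norml.
Qed.

Let mbox M : measurable (box M) := @measurable_box R r M.

Let measurable_internal (A : nat -> set V) : (forall n, measurable (A n)) ->
  measurable (internal U A : set Omega).
Proof. by move=> mA; apply: sub_sigma_algebra; exists A. Qed.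

Let measurable_Bd : measurable (Bd : set Omega).
Proof. by apply: bigcup_measurable => k _; apply: measurable_internal => n. Qed.

Let measurable_st : measurable_fun (setT : set Omega) (st : Omega -> V).
Proof.
apply: measurable_fun_mx_le => i j a; rewrite (ord1 i) {i}.
pose A (k : nat) : set V := [set y | y 0 j <= a + k.+1%:R^-1].
have mA k : measurable (A k).
  rewrite (_ : A k = (fun y : 'rV[R]_r => y 0 j) @^-1` `]-oo, a + k.+1%:R^-1]).
    by rewrite -[X in measurable X]setTI; exact: measurable_coord.
  by apply/seteqP; split => y; rewrite /A/= in_itv.
(* On [Bd], a coordinate of [st w] is at most [a] iff each slackened bound [a + k.+1%:R^-1] holds
   [U]-almost everywhere; the second piece accounts for the value 0 off [Bd]. *)
rewrite (_ : mkset _ = (Bd `&` \bigcap_k internal U (fun=> A k)) `|`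
    (~` Bd `&` [set _ | 0 <= a])).
  apply: measurableU; last first.
    have [a0|a0] := pselect (0 <= a); last first.
      by rewrite (_ : [set _ | _] = set0) ?setI0//; apply/seteqP; split.
    rewrite (_ : [set _ | _] = setT) ?setIT; last by apply/seteqP; split.
    exact: measurableC.
  apply: measurableI => //; apply: bigcapT_measurable => k.
  exact: measurable_internal.
apply/seteqP; split => w /=.
  have [Bw wa|nBw] := pselect (Bd w); last first.
    by rewrite /st asboolF// mxE => ?; right.
  left; split => // k _; move/st_cvg : (Bw) => /(_ j).
  have k0 : 0 < k.+1%:R^-1 :> R by rewrite invr_gt0.
  move=> /cvgrPdist_lt /(_ _ k0); apply: filterS => n; rewrite /A/= ltr_distlC => /andP[_].
  by move=> /ltW /le_trans; apply; rewrite lerD2r.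
move=> [[Bw Aw]|[nBw a0]]; last by rewrite /st asboolF// mxE.
apply/ler_addgt0Pr => e e0.
have [k _ /(_ k (leqnn k)) /= ke] := near_infty_natSinv_lt (PosNum e0).
apply: le_trans (_ : a + k.+1%:R^-1 <= _); last by rewrite lerD2l ltW.
rewrite -(@ulim_eq R U FU (fun n => w n 0 j) (st w 0 j)); last exact: st_cvg.
have [l _ lw] := Bw.
rewrite -[leRHS](@ulim_eq R U FU (cst (a + k.+1%:R^-1))); last exact: cvg_cst.
apply: ler_lim; last exact: (Aw k).
  by apply: cvgP; exact: st_cvg.
exact: is_cvg_cst.
Qed.

Let probability_Bd : lm (Bd : set Omega) = 1%E.
Proof.
apply/eqP; rewrite eq_le probability_le1//=; apply/lee_addgt0Pr => e e0.
have [M Mm] := tight e0.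
have [k Mk] : exists k : nat, M <= k%:R.
  by exists (Num.bound `|M|); rewrite (le_trans (ler_norm _))// ltW// archi_boundP.
apply: (@le_trans _ _ (lm (internal U (fun=> box k%:R)) + e%:E)%E); last first.
  rewrite leeD2r//; apply: le_measure; rewrite ?inE//; first exact: measurable_internal.
  by move=> w Bw; exists k.
rewrite loeb_measureE// -EFinD lee_fin -lerBlDr.
have H n : 0 <= fine (mu n (box k%:R)) <= 1 by apply: probability_fine01; exact: measurable_box.
apply: (ulim_ge FU (m := 0) (M := 1)); first by apply: filterE => n; exact: H.
apply: filterS (Uoo Mm) => n /= Mn; apply: le_trans Mn _; rewrite fine_le ?fin_num_measure//.
  exact: measurable_box.
apply: le_measure; rewrite ?inE//; try exact: measurable_box.
by move=> y yM j; exact: le_trans (yM j) Mk.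
Qed.

(** A point of [O] has a ball inside [O], so a sequence whose standard part is in [O] is itself in
    [O] at [U]-almost every index. Openness gives only this inequality; complements and sums over
    superlevel sets recover the rest. *)
Lemma ultra_limit_law : exists G : probability 'rV[R]_r R, forall O : set 'rV[R]_r,
  open O -> fine (G O) <= ulim U (fun n => fine (mu n O)).
Proof.
pose G := law (lm) measurable_st.
exists G => O oO; have mO := open_measurable_mx oO.
have mstO : measurable (st @^-1` O : set Omega).
  by rewrite -[X in measurable X]setTI; exact: measurable_st.
rewrite -lee_fin fineK ?fin_num_measure// lawE -(loeb_measureE FU Uoo mu (A := fun=> O))//.
have E : lm (st @^-1` O : set Omega) = lm (st @^-1` O `&` Bd : set Omega).
  rewrite -[X in lm X = _](setIT (st @^-1` O)) -(setUv Bd) setIUr measureU//=.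
  - rewrite [X in (_ + X)%E](_ : _ = 0%E) ?adde0//.
    apply/eqP; rewrite eq_le measure_ge0 andbT.
    apply: (@le_trans _ _ (lm (~` Bd : set Omega))).
      apply: le_measure; rewrite ?inE; [|exact: measurableC|exact: subIsetr].
      by apply: measurableI => //; exact: measurableC.
    by rewrite probability_setC// [X in (_ - X)%E](_ : _ = 1%E) ?subee//.
  - exact: measurableI.
  - by apply: measurableI => //; exact: measurableC.
  - by rewrite setIACA setICr setI0.
apply: (@le_trans _ _ (lm (st @^-1` O `&` Bd : set Omega))); first by rewrite -E.
apply: le_measure; rewrite ?inE//; first exact: measurableI.
  exact: measurable_internal.
move=> w [/= Ow Bw]; have : nbhs (st w) O by exact: open_nbhs_nbhs.
move=> /nbhs_ballP[e /= e0 eO].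
have : \forall n \near U, forall j, `|st w 0 j - w n 0 j| < e.
  apply: filter_forall => j; move: e e0 {eO}; apply/cvgrPdist_lt; exact: st_cvg.
by apply: filterS => n h; apply: eO; split => // i j; rewrite (ord1 i); exact: h.
Qed.

End LoebLimit.

Lemma cvg_sumr (R : realType) (T : Type) (F : set_system T) {FF : Filter F}
    (I : Type) (s : seq I) (P : pred I) (f : I -> T -> R) (l : I -> R) :
  (forall i, P i -> f i @ F --> l i) ->
  (fun x => \sum_(i <- s | P i) f i x) @ F --> \sum_(i <- s | P i) l i.
Proof.
move=> fl; elim: s => [|i s IH].
  by rewrite big_nil; under eq_fun do rewrite big_nil; exact: cvg_cst.
rewrite big_cons; under eq_fun do rewrite big_cons.
by case: ifPn => // Pi; apply: cvgD => //; exact: fl.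
Qed.

(** With the next lemma, a real between 0 and [N.+1%:R] is within 1 of the number of positive
    integers below it; this compares an integral with measures of superlevel sets. *)
Lemma sum_lt_nat_le (R : realType) (N : nat) (s : R) : 0 <= s ->
  \sum_(i < N) (i.+1%:R < s)%R%:R <= s.
Proof.
(* The bound by the minimum is what the induction carries: the step from [N] also uses that the
   first [N] terms sum to at most [N]. *)
move=> s0; suff : \sum_(i < N) (i.+1%:R < s)%R%:R <= Num.min s N%:R.
  by rewrite le_min => /andP[].
elim: N => [|N]; first by rewrite big_ord0 le_min s0 lexx.
rewrite big_ord_recr/= !le_min => /andP[h1 h2].
have [Ns|sN] := ltP N.+1%:R s.
  rewrite -natr1 in Ns *; rewrite lerD2r h2 andbT; apply: le_trans (ltW Ns).
  by rewrite lerD2r.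
rewrite addr0 h1/=; apply: le_trans h2 _; by rewrite ler_nat.
Qed.

Lemma sum_lt_nat_ge (R : realType) (N : nat) (s : R) : s <= N.+1%:R ->
  s <= 1 + \sum_(i < N) (i.+1%:R < s)%R%:R.
Proof.
elim: N => [|N IH] sN; first by rewrite big_ord0 addr0.
have [Ns|sN'] := ltP N.+1%:R s; last first.
  by apply: le_trans (IH sN') _; rewrite lerD2l big_ord_recr/= lerDl.
rewrite (eq_bigr (fun=> 1)); last first.
  by move=> i _; rewrite (le_lt_trans _ Ns)// ler_nat.
by rewrite sumr_const card_ord -(natrD _ 1%N N.+1) add1n.
Qed.

Section BoundedRintegral.
Variables (R : realType) (d : measure_display) (V : measurableType d).
Variable Q : probability V R.
Implicit Types (f : V -> R) (K : R).

Lemma bounded_integrable f K : measurable_fun setT f -> (forall x, `|f x| <= K) ->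
  Q.-integrable setT (EFin \o f).
Proof.
move=> mf fK; apply: measurable_bounded_integrable => //.
  by rewrite (le_lt_trans (probability_le1 Q _))// ltry.
exists K; split; first exact: num_real.
by move=> x Kx y _; apply: le_trans (fK y) (ltW Kx).
Qed.

Lemma Rintegral_affine f K a c : measurable_fun setT f -> (forall x, `|f x| <= K) ->
  \int[Q]_x (a * f x + c) = a * \int[Q]_x f x + c.
Proof.
move=> mf fK; have fi := bounded_integrable mf fK.
have ci : Q.-integrable setT (EFin \o cst c).
  by apply: (@bounded_integrable _ `|c|) => //.
rewrite RintegralD//; last first.
  by apply: (@bounded_integrable _ (`|a| * K)); [exact: measurable_funM|
    move=> x; rewrite normrM ler_wpM2l].
by rewrite RintegralZl// Rintegral_cst// [X in fine X](_ : _ = 1%E) ?mulr1//; exact: probability_setT.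
Qed.

(** Layer-cake formula with error 1, which division by [N.+1%:R] makes small. The levels stop at [N]
    because [N.+1%:R * f x] never exceeds [N.+1%:R]. *)
Lemma layer_cake f N : measurable_fun setT f -> (forall x, 0 <= f x <= 1) ->
  \sum_(i < N) fine (Q [set x | i.+1%:R < N.+1%:R * f x]) <= N.+1%:R * \int[Q]_x f x <=
  1 + \sum_(i < N) fine (Q [set x | i.+1%:R < N.+1%:R * f x]).
Proof.
move=> mf f01; set S := \sum_(i < N) _.
have fK x : `|f x| <= 1 by have /andP[f0 f1] := f01 x; rewrite ger0_norm.
pose A (i : 'I_N) := [set x | i.+1%:R < N.+1%:R * f x].
have mg : measurable_fun setT (fun x => N.+1%:R * f x) by exact: measurable_funM.
have mA i : measurable (A i).
  rewrite (_ : A i = (fun x => N.+1%:R * f x) @^-1` `]i.+1%:R, +oo[).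
    by rewrite -[X in measurable X]setTI; exact: mg.
  by apply/seteqP; split => x; rewrite /A/= in_itv/= andbT.
pose s x := \sum_(i < N) (i.+1%:R < N.+1%:R * f x)%R%:R : R.
have sE x : s x = \sum_(i < N) \1_(A i) x.
  apply: eq_bigr => i _; rewrite indicE; congr (_%:R : R).
  by rewrite (_ : (x \in A i) = (i.+1%:R < N.+1%:R * f x)%R)//; apply/idP/idP; rewrite inE.
have ms : measurable_fun setT s.
  rewrite (_ : s = fun x => \sum_(i < N) \1_(A i) x); last exact/funext.
  by apply: measurable_sum => i; exact: measurable_indic.
have sb x : `|s x| <= N%:R.
  rewrite ger0_norm; last by apply: sumr_ge0.
  rewrite -[N in leRHS]card_ord -sumr_const; apply: ler_sum => i _.
  by case: (_ < _).
have si := bounded_integrable ms sb.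
have -> : S = \int[Q]_x s x.
  rewrite /Rintegral; under eq_integral do rewrite sE -sumEFin.
  rewrite ge0_integral_sum//; last by move=> i; exact/measurable_EFinP/measurable_indic.
  rewrite -sum_fine => [|i _]; last by rewrite integral_indic// setIT fin_num_measure.
  by apply: eq_bigr => i _; rewrite integral_indic// setIT.
have -> : N.+1%:R * \int[Q]_x f x = \int[Q]_x (N.+1%:R * f x + 0).
  by rewrite (Rintegral_affine _ _ mf fK) addr0.
have -> : 1 + \int[Q]_x s x = \int[Q]_x (1 * s x + 1).
  by rewrite (Rintegral_affine _ _ ms sb) mul1r addrC.
have gi : Q.-integrable setT (EFin \o (fun x => N.+1%:R * f x + 0)).
  apply: (@bounded_integrable _ N.+1%:R) => [|x]; first exact: measurable_funD.
  by rewrite addr0 normrM ger0_norm// ler_piMr.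
apply/andP; split; apply: le_Rintegral => //.
- move=> x _; rewrite addr0; apply: sum_lt_nat_le.
  by rewrite mulr_ge0//; have /andP[] := f01 x.
- apply: (@bounded_integrable _ (N%:R + 1)) => [|x].
    by apply: measurable_funD => //; exact: measurable_funM.
  by rewrite mul1r (le_trans (ler_normD _ _))// normr1 lerD2r.
- move=> x _; rewrite addr0 mul1r addrC; apply: sum_lt_nat_ge.
  by rewrite ler_piMr//; have /andP[] := f01 x.
Qed.

End BoundedRintegral.

(** * From limits of distribution functions to weak convergence *)

Section WeakLimit.
Variables (R : realType) (r : nat).
Implicit Types (mu : nat -> probability 'rV[R]_r R) (G : probability 'rV[R]_r R).
Implicit Types (f : 'rV[R]_r -> R) (K : R).

Section AlongUltrafilter.
Variables (mu : nat -> probability 'rV[R]_r R) (G : probability 'rV[R]_r R).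
Variables (U : set_system nat) (FU : UltraFilter U).
Hypothesis GO : forall O : set 'rV[R]_r, open O ->
  fine (G O) <= ulim U (fun n => fine (mu n O)).

(** Superlevel sets of a continuous function are open, so [GO] applies to each term of the
    layer-cake sum, and the error [N.+1%:R^-1] is arbitrarily small. *)
Let Rintegral_le_ulim f : continuous f -> (forall x, 0 <= f x <= 1) ->
  \int[G]_x f x <= ulim U (fun n => \int[mu n]_x f x).
Proof.
move=> cf f01; have mf := continuous_measurable_mx cf.
have cI : (fun n => \int[mu n]_x f x) @ U --> ulim U (fun n => \int[mu n]_x f x).
  apply: (ultra_bounded_cvg FU (m := 0) (M := 1)); apply: filterE => n.
  (* For [N = 0] the upper bound says that the integral of [f] is at most 1. *)
  have /andP[h1] := layer_cake (mu n) 0 mf f01.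
  by rewrite big_ord0 mul1r addr0 /= => ->; rewrite andbT Rintegral_ge0// => x _; have /andP[] := f01 x.
apply/ler_addgt0Pr => e e0.
have [N _ /(_ N (leqnn N)) /= Ne] := near_infty_natSinv_lt (PosNum e0).
have N0 : 0 < N.+1%:R :> R by [].
apply: le_trans (_ : ulim U (fun n => \int[mu n]_x f x) + N.+1%:R^-1 <= _); last first.
  by rewrite lerD2l ltW.
rewrite -(ler_pM2l N0) mulrDr mulfV// addrC.
have /andP[_] := layer_cake G N mf f01; move/le_trans; apply; rewrite lerD2l.
pose A (i : 'I_N) := [set x | i.+1%:R < N.+1%:R * f x].
have oA i : open (A i).
  rewrite (_ : A i = (fun x => N.+1%:R * f x) @^-1` [set x | i.+1%:R < x]) //.
  apply: open_comp; last exact: open_gt.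
  by move=> x _; apply: (@continuousM _ _ (fun=> N.+1%:R) f); [exact: cst_continuous|exact: cf].
apply: (@le_trans _ _ (\sum_(i < N) ulim U (fun n => fine (mu n (A i))))).
  by apply: ler_sum => i _; apply: GO; exact: oA.
have cA : (fun n => \sum_(i < N) fine (mu n (A i))) @ U -->
    \sum_(i < N) ulim U (fun n => fine (mu n (A i))).
  apply: cvg_sumr => i _; apply: ulim_probability => n.
  exact: open_measurable_mx.
have cN : (fun n => N.+1%:R * \int[mu n]_x f x) @ U -->
    N.+1%:R * ulim U (fun n => \int[mu n]_x f x) by apply: cvgM; [exact: cvg_cst|].
rewrite -(ulim_eq FU cA) -(ulim_eq FU cN); apply: ler_lim; [exact: cvgP cA|exact: cvgP cN|].
by apply: filterE => n; have /andP[] := layer_cake (mu n) N mf f01.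
Qed.

(** The one-sided inequality is applied to [f] and to [- f], both mapped affinely into [0, 1]; these
    are the two halves of the equality. *)
Lemma portmanteau_ultra f K : continuous f -> (forall x, `|f x| <= K) ->
  (fun n => \int[mu n]_x f x) @ U --> \int[G]_x f x.
Proof.
move=> cf fK; have mf := continuous_measurable_mx cf.
have [L L0 fL] : exists2 L : R, 0 < L & forall x, - L <= f x <= L.
  exists (`|K| + 1) => [|x]; first by rewrite ltr_wpDl.
  by rewrite -ler_norml (le_trans (fK x))// (le_trans (ler_norm _))// lerDl ler01.
pose a : R := (L + L)^-1; have a0 : 0 < a by rewrite invr_gt0 addr_gt0.
have aL : a * L + a * L = 1 by rewrite -mulrDr mulVf// gt_eqF// addr_gt0.
have cI : (fun n => \int[mu n]_x f x) @ U --> ulim U (fun n => \int[mu n]_x f x).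
  apply: (ultra_bounded_cvg FU (m := - K) (M := K)); apply: filterE => n.
  have fi := bounded_integrable (mu n) mf fK.
  have : `|\int[mu n]_x f x| <= \int[mu n]_x K.
    apply: le_trans (le_normr_Rintegral _ fi) _ => //; apply: le_Rintegral => //.
      by apply: (@bounded_integrable _ _ _ _ _ K) => [|x]; [exact: measurableT_comp|rewrite normr_id].
    by apply: (@bounded_integrable _ _ _ _ _ `|K|).
  rewrite Rintegral_cst// [X in fine X](_ : _ = 1%E) ?mulr1; last exact: probability_setT.
  by rewrite ler_norml.
(* [s] is a sign, and [t |-> a * (s * t + L)] maps [[- L, L]] into [0, 1] because [a] is the inverse
   of [L + L]. *)
have key (s : R) : `|s| = 1 -> a * (s * \int[G]_x f x + L) <=
    a * (s * ulim U (fun n => \int[mu n]_x f x) + L).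
  move=> s1; pose g x := (a * s) * f x + a * L.
  have gE (Q : probability 'rV[R]_r R) : \int[Q]_x g x = a * (s * \int[Q]_x f x + L).
    by rewrite (Rintegral_affine Q _ _ mf fK) mulrDr mulrA.
  have : \int[G]_x g x <= ulim U (fun n => \int[mu n]_x g x).
    apply: Rintegral_le_ulim => [x|x].
      apply: (@continuousD _ _ _ (fun y => (a * s) * f y) (fun=> a * L)); last exact: cst_continuous.
      by apply: (@continuousM _ _ (fun=> a * s) f); [exact: cst_continuous|exact: cf].
    have : `|s * f x| <= L by rewrite normrM s1 mul1r ler_norml.
    rewrite ler_norml /g -mulrA -mulrDr => /andP[h1 h2].
    have h3 : 0 <= s * f x + L by rewrite -lerBlDr sub0r.
    rewrite (mulr_ge0 (ltW a0) h3)/=.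
    by rewrite -aL -mulrDr ler_pM2l// lerD2r.
  rewrite gE (_ : (fun n => _) = (fun n => a * (s * \int[mu n]_x f x + L))); last first.
    by apply/funext => n; exact: gE.
  move/le_trans; apply; rewrite le_eqVlt; apply/orP; left; apply/eqP/ulim_eq => //.
  apply: cvgM; first exact: cvg_cst.
  by apply: cvgD; [apply: cvgM => //; exact: cvg_cst|exact: cvg_cst].
suff <- : ulim U (fun n => \int[mu n]_x f x) = \int[G]_x f x by [].
apply/eqP; rewrite eq_le; apply/andP; split.
  by have := key (-1) (normrN1 _); rewrite !mulN1r ler_pM2l// lerD2r lerN2.
by have := key 1 (normr1 _); rewrite !mul1r ler_pM2l// lerD2r.
Qed.

End AlongUltrafilter.

Definition orthant (x : 'rV[R]_r) : set 'rV[R]_r := [set y | forall j, y 0 j <= x 0 j].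

Lemma measurable_orthant x : measurable (orthant x).
Proof.
rewrite (_ : orthant x = \bigcap_(j in [set: 'I_r]) [set y : 'rV[R]_r | y 0 j <= x 0 j]).
  apply: fin_bigcap_measurable => // j _; rewrite -[X in measurable X]setTI.
  rewrite (_ : mkset _ = (fun y : 'rV[R]_r => y 0 j) @^-1` `]-oo, x 0 j]).
    exact: measurable_coord.
  by apply/seteqP; split => y; rewrite /= in_itv.
by apply/seteqP; split => y h; [move=> j _; exact: h|move=> j; exact: (h j)].
Qed.

(** Orthants are stable under intersection and generate the Borel sets, and those with constant
    integer corners exhaust the space. *)
Lemma eq_probability_orthant (G1 G2 : probability 'rV[R]_r R) :
  (forall x, G1 (orthant x) = G2 (orthant x)) ->
  forall A, measurable A -> G1 A = G2 A.
Proof.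
move=> G12; apply: (@measure_unique _ _ _ (range orthant) (fun k => orthant (const_mx k%:R))).
- apply/seteqP; split.
    apply: measurable_mx_sub; first exact: smallest_sigma_algebra.
    move=> i j a; rewrite (ord1 i).
    (* A coordinate half-space is a countable union of orthants whose other bounds tend to
       infinity. *)
    rewrite (_ : mkset _ = \bigcup_k orthant (\row_l if l == j then a else k%:R)).
      by apply: sigma_algebra_bigcup => k; apply: sub_sigma_algebra; exists (\row_l if l == j then a else k%:R).
    apply/seteqP; split => [y /= ya|y [k _ /(_ j)]]; last by rewrite mxE eqxx.
    exists (Num.bound (\sum_l `|y 0 l|)) => // l; rewrite mxE; case: eqP => [->//|_].
    apply: ltW; apply: le_lt_trans (archi_boundP _); last exact: sumr_ge0.
    by rewrite (bigD1 l)//= (le_trans (ler_norm _))// lerDl sumr_ge0.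
  apply: smallest_sub; first by apply: sigma_algebra_measurable.
  by move=> _ [x _ <-]; exact: measurable_orthant.
- move=> _ _ [x _ <-] [y _ <-]; exists (\row_j Num.min (x 0 j) (y 0 j)) => //.
  apply/seteqP; split => z h; last by case: h => h1 h2 j; rewrite mxE le_min h1 h2.
  by split => j; have := h j; rewrite mxE le_min => /andP[].
- by move=> k; exists (const_mx k%:R).
- apply/seteqP; split => // y _; exists (Num.bound (\sum_l `|y 0 l|)) => // l; rewrite mxE.
  apply: ltW; apply: le_lt_trans (archi_boundP _); last exact: sumr_ge0.
  by rewrite (bigD1 l)//= (le_trans (ler_norm _))// lerDl sumr_ge0.
- by move=> _ [x _ <-]; exact: G12.
- by move=> k; rewrite (le_lt_trans (probability_le1 G1 _)) ?ltry//; exact: measurable_orthant.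
Qed.

Section DistributionFunctions.
Variables (mu : nat -> probability 'rV[R]_r R) (H : 'rV[R]_r -> R).
Hypothesis muH : forall x, (fun n => fine (mu n (orthant x))) @ \oo --> H x.
Hypothesis H_cont : forall x : 'rV[R]_r, (fun k => H (x + const_mx k.+1%:R^-1)) @ \oo --> H x.
Hypothesis tight : forall e : R, 0 < e -> exists M : R, \forall n \near \oo,
  1 - e <= fine (mu n [set y : 'rV[R]_r | forall j, `|y 0 j| <= M]).

(** An orthant is closed, so [GO] on its complement gives one inequality. The other passes through
    the open orthant whose corner is shifted by [k.+1%:R^-1]; there the right continuity [H_cont]
    enters. *)
Lemma ultra_limit_df U (FU : UltraFilter U) : \oo `<=` U ->
  exists2 G : probability 'rV[R]_r R, (forall x, G (orthant x) = (H x)%:E) &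
    forall f K, continuous f -> (forall x, `|f x| <= K) ->
    (fun n => \int[mu n]_x f x) @ U --> \int[G]_x f x.
Proof.
move=> Uoo; have [G GO] := ultra_limit_law FU Uoo tight.
exists G; last by move=> f K cf fK; exact: (portmanteau_ultra FU GO cf fK).
have uH x : ulim U (fun n => fine (mu n (orthant x))) = H x.
  apply: (ulim_eq FU) => A HA; have HA' := @muH x A HA; exact: (Uoo _ HA').
move=> x; rewrite -[LHS]fineK ?fin_num_measure//; last exact: measurable_orthant.
congr EFin; apply/eqP; rewrite eq_le; apply/andP; split.
  apply: (cvgr_to_ge (@H_cont x)); near=> k; rewrite -uH.
  pose O := [set y : 'rV[R]_r | forall j, y 0 j < x 0 j + k.+1%:R^-1].
  have oO : open O.
    rewrite openE => y yO; suff : \forall z \near y, forall j, (z : 'rV[R]_r) 0 j < x 0 j + k.+1%:R^-1 by [].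
    apply: (@filter_forall _ _ (fun j (z : 'rV[R]_r) => z 0 j < x 0 j + k.+1%:R^-1) (nbhs y)) => j.
    have : nbhs (y 0 j) [set z | z < x 0 j + k.+1%:R^-1].
      by apply: open_nbhs_nbhs; split; [exact: open_lt|exact: yO].
    exact: coord_continuous.
  have mO := open_measurable_mx oO.
  apply: (@le_trans _ _ (fine (G O))).
    rewrite fine_le ?fin_num_measure//; first exact: measurable_orthant.
    apply: le_measure; rewrite ?inE//; first exact: measurable_orthant.
    by move=> y yx j; rewrite (le_lt_trans (yx j))// ltrDl.
  apply: le_trans (GO _ oO) _.
  have mor : measurable (orthant (x + const_mx k.+1%:R^-1)) by exact: measurable_orthant.
  apply: ler_lim.
  - by apply: cvgP; apply: ulim_probability.
  - by apply: cvgP; apply: ulim_probability.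
  - apply: filterE => n; rewrite fine_le ?fin_num_measure//.
    by apply: le_measure; rewrite ?inE// => y yx j; rewrite !mxE ltW.
have oC : open (~` orthant x).
  rewrite (_ : ~` _ = \bigcup_(j in [set: 'I_r]) (fun y : 'rV[R]_r => y 0 j) @^-1` [set z | x 0 j < z]).
    apply: bigcup_open => j _; apply: open_comp; last exact: open_gt.
    by move=> y _; exact: coord_continuous.
  apply/seteqP; split => [y /existsNP[j /negP]|y [j _ /= xy] /(_ j)]; last by rewrite leNgt xy.
  by rewrite -ltNge => h; exists j.
have := GO _ oC; have mx := measurable_orthant x.
rewrite probability_setC// fineB ?fin_num_measure//= -uH.
rewrite (_ : (fun n => _) = (fun n => 1 - fine (mu n (orthant x)))); last first.
  by apply/funext => n; rewrite probability_setC// fineB ?fin_num_measure.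
rewrite (@ulim_eq R U FU _ (1 - ulim U (fun n => fine (mu n (orthant x))))).
  by rewrite lerD2l lerN2.
by apply: cvgB; [exact: cvg_cst|apply: ulim_probability].
Unshelve. all: by end_near. Qed.

(** If the integrals of some [f] were infinitely often [e] away from the limit, an ultrafilter
    containing these indices would produce a second law with distribution function [H], hence the
    same law and the same integral, a contradiction. *)
Lemma cvg_df_weak : exists G : probability 'rV[R]_r R,
  (forall x, G (orthant x) = (H x)%:E) /\
  forall f K, continuous f -> (forall x, `|f x| <= K) ->
    (fun n => \int[mu n]_x f x) @ \oo --> \int[G]_x f x.
Proof.
have [U0 [FU0 U0oo]] := ultraFilterLemma (eventually_filter).
have [G GH Gf] := ultra_limit_df FU0 U0oo.
exists G; split => // f K cf fK; apply: contrapT => nc.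
have [e e0 ne] : exists2 e : R, 0 < e &
    ~ \forall n \near \oo, `|\int[G]_x f x - \int[mu n]_x f x| < e.
  apply: contrapT => h; apply: nc; apply/cvgrPdist_lt => e e0; apply: contrapT => h'.
  by apply: h; exists e.
pose S := [set n | ~ `|\int[G]_x f x - \int[mu n]_x f x| < e].
have FS : ProperFilter (within S \oo).
  apply: Build_ProperFilter => h; apply: ne; move: h; rewrite /within/=; apply: filterS => n h.
  by apply: contrapT => nh; exact: h.
have [U [FU UW]] := ultraFilterLemma FS.
have Uoo : \oo `<=` U.
  by move=> A Aoo; apply: UW; apply: filterS Aoo => n An _.
have US : U S by apply: UW; exists 0%N => // n _.
have [G' GH' Gf'] := ultra_limit_df FU Uoo.
have GG : \int[G']_x f x = \int[G]_x f x.
  rewrite /Rintegral; congr fine; apply: eq_measure_integral => A mA _.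
  by apply: eq_probability_orthant => // x; rewrite GH GH'.
have := Gf' f K cf fK; rewrite GG => /cvgrPdist_lt /(_ e e0) h.
by have [n [/= Sn hn]] := filter_ex (filterI US h).
Qed.

End DistributionFunctions.
End WeakLimit.

(** * Standard Gaussian vectors and their rotation invariance *)

Section AffineLebesgue.
Variable R : realType.
Local Notation leb := (@lebesgue_measure R).
Local Notation T' := (measurableTypeR R).

Definition affine (a b : R) : T' -> T' := fun x => a * x + b.

Lemma measurable_affine (a b : R) : measurable_fun setT (affine a b).
Proof. by apply: measurable_funD => //; exact: measurable_funM. Qed.

(** Lebesgue measure is determined by half-open intervals, and affine preimages divide their lengths
    by [|a|]. *)
Lemma lebesgue_measure_affine (a b : R) (A : set T') : a != 0 -> measurable A ->
  leb A = (`|a|%:E * leb (affine a b @^-1` A))%E.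
Proof.
move=> a0.
have @m : {measure set T' -> \bar R}.
  unshelve refine (mscale (NngNum (normr_ge0 a))
    (pushforward leb (affine a b))); exact: measurable_affine.
suff : forall X, ocitv X -> leb X = m X.
  by move=> h mA; rewrite (lebesgue_measure_unique h mA).
move=> _ [[u v] _ <-] /=; have [uv|vu] := ltP u v; last first.
  by rewrite set_itv_ge ?measure0// bnd_simp -leNgt.
rewrite /m /mscale/= /pushforward lebesgue_measure_itv/= lte_fin uv.
have [a_gt0|a_lt0|/eqP] := ltgtP 0 a; last by rewrite eq_sym (negbTE a0).
  rewrite (_ : affine a b @^-1` _ = `](u - b) / a, (v - b) / a]%classic); last first.
    apply/seteqP; split => x /=; rewrite /affine !in_itv/= ltr_pdivrMr// ler_pdivlMr//;
    by rewrite ltrBlDr lerBrDr mulrC.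
  rewrite lebesgue_measure_itv/= lte_fin ltr_pM2r ?invr_gt0// ltrD2r uv.
  rewrite gtr0_norm// -!EFinD -EFinM; congr EFin; field; exact: a0.
(* A negative slope exchanges the open and the closed end. *)
rewrite (_ : affine a b @^-1` _ = `[(v - b) / a, (u - b) / a[%classic); last first.
  apply/seteqP; split => x /=; rewrite /affine !in_itv/= ler_ndivrMr// ltr_ndivlMr//;
  by rewrite ltrBlDr lerBrDr mulrC andbC.
rewrite lebesgue_measure_itv/= lte_fin ltr_nM2r ?invr_lt0// ltrD2r uv.
rewrite ltr0_norm// -!EFinD -EFinM; congr EFin; field; exact: a0.
Qed.

Lemma ge0_integral_affine (a b : R) (f : T' -> \bar R) : a != 0 ->
  measurable_fun setT f -> (forall x, 0 <= f x)%E ->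
  (\int[leb]_x f x = `|a|%:E * \int[leb]_x f (affine a b x))%E.
Proof.
move=> a0 mf f0.
have @m : {measure set T' -> \bar R}.
  unshelve refine (mscale (NngNum (normr_ge0 a))
    (pushforward leb (affine a b))); exact: measurable_affine.
rewrite (eq_measure_integral m) => [|A mA _]; last exact: lebesgue_measure_affine.
rewrite ge0_integral_mscale//= ge0_integral_pushforward//.
exact: measurable_affine.
Qed.

(** [normal_pdf] is a version of the Radon-Nikodym derivative, since both have the same integral
    over every measurable set. *)
Lemma integral_normal_prob (m s : R) (f : T' -> \bar R) : s != 0 ->
  (normal_prob m s).-integrable setT f ->
  (\int[normal_prob m s]_x f x = \int[leb]_x (f x * (normal_pdf m s x)%:E))%E.
Proof.
move=> s0 fi; have mf := measurable_int _ fi.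
rewrite -(Radon_Nikodym_change_of_variables (normal_prob_dominates m s))//=.
have RNi : leb.-integrable setT
    (Radon_Nikodym (charge_of_finite_measure (normal_prob m s)) leb).
  by apply: Radon_Nikodym_integrable; exact: normal_prob_dominates.
have mp : measurable_fun setT (fun x : T' => (normal_pdf m s x)%:E).
  by apply/measurable_EFinP; exact: measurable_normal_pdf.
apply: ae_eq_integral => //.
- by apply: emeasurable_funM => //; exact: measurable_int RNi.
- exact: emeasurable_funM.
- apply: ae_eqe_mul2l; apply: integral_ae_eq => // E _ mE.
  by rewrite -Radon_Nikodym_integral//; exact: normal_prob_dominates.
Qed.

End AffineLebesgue.

Lemma mule_finI (R : realType) (c : R) (x y : \bar R) : c != 0 ->
  (c%:E * x = c%:E * y)%E -> x = y.
Proof.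
move=> c0 /(congr1 (fun t => c^-1%:E * t)%E).
by rewrite !muleA -EFinM mulVf// !mul1e.
Qed.

Section PlaneRotation.
Variable R : realType.
Local Notation leb := (@lebesgue_measure R).
Local Notation T' := (measurableTypeR R).
Local Notation N01 := (@normal_prob R 0 1).
Local Notation phi := (@normal_pdf R 0 1).

Definition gauss2 : probability (T' * T')%type R := (N01 \x N01)%E.

Lemma normal_pdf01E (x : R) : phi x = (Num.sqrt (pi *+ 2))^-1 * expR (- x ^+ 2 / 2).
Proof.
by rewrite normal_pdfE ?oner_neq0// /normal_peak /normal_fun subr0 expr1n mul1r.
Qed.

(** Both exponents equal [- (x^2 + y^2 - 2 b x y) / (2 a^2)], which is symmetric in [x] and [y]. *)
Lemma normal_pdf_rot (a b x y : R) : a != 0 -> a ^+ 2 + b ^+ 2 = 1 ->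
  phi (a^-1 * x + - (b / a) * y) * phi y = phi x * phi (a^-1 * y + - (b / a) * x).
Proof.
move=> a0 ab; rewrite !normal_pdf01E mulrACA -expRD [RHS]mulrACA -expRD.
congr (_ * expR _); apply/eqP; rewrite -subr_eq0; apply/eqP.
transitivity ((x ^+ 2 - y ^+ 2) * (a ^+ 2 + b ^+ 2 - 1) / (2 * a ^+ 2)); first by field.
by rewrite ab subrr mulr0 mul0r.
Qed.

Lemma gauss2E (B : set (T' * T')) : measurable B ->
  gauss2 B = (\int[leb]_x \int[leb]_y (\1_B (x, y) * phi x * phi y)%:E)%E.
Proof.
move=> mB; transitivity (\int[N01]_x N01 (xsection B x))%E => //.
rewrite integral_normal_prob ?oner_neq0//; last first.
  apply/integrableP; split; first exact: measurable_fun_xsection.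
  apply: (@le_lt_trans _ _ (\int[N01]_x cst 1%E x)%E); last first.
    by rewrite integral_cst// mul1e (le_lt_trans (probability_le1 N01 _))// ltry.
  apply: ge0_le_integral => //.
    by apply: measurableT_comp => //; exact: measurable_fun_xsection.
  by move=> x _; rewrite gee0_abs//= probability_le1//; exact: measurable_xsection.
apply: eq_integral => x _ /=; rewrite /normal_prob muleC -ge0_integralZl//=; last 4 first.
- exact: measurable_xsection.
- apply/measurable_EFinP; apply: measurable_funTS; exact: measurable_normal_pdf.
- by move=> y _; rewrite lee_fin normal_pdf_ge0.
- by rewrite lee_fin normal_pdf_ge0.
rewrite [LHS]integral_mkcond; apply: eq_integral => y _.
rewrite patchE mem_xsection indicE; case: ifPn => _; first by rewrite mul1r.
by rewrite !mul0r.
Qed.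

Definition rot2 (a b : R) (p : T' * T') : T' * T' :=
  (a * p.1 + b * p.2, - b * p.1 + a * p.2).

Lemma measurable_rot2 a b : measurable_fun setT (rot2 a b).
Proof.
by apply: measurable_fun_pair; apply: measurable_funD; apply: measurable_funM.
Qed.

(* Two substitutions, [u = a x + b y] for fixed [y] and then [v = (y - b u) / a]
   for fixed [u]; their Jacobians cancel. *)
Lemma gauss2_rot a b (B : set (T' * T')) : a != 0 -> a ^+ 2 + b ^+ 2 = 1 ->
  measurable B -> gauss2 (rot2 a b @^-1` B) = gauss2 B.
Proof.
move=> a0 ab mB.
have Ka t : (`|a|%:E * (`|a^-1|%:E * t) = t)%E.
  by rewrite muleA -EFinM normrV ?unitfE// mulfV ?normr_eq0// mul1e.
have mrB : measurable (rot2 a b @^-1` B).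
  by rewrite -[X in measurable X]setTI; exact: measurable_rot2.
have mphi2 (f g : T' * T' -> T') : measurable_fun setT f -> measurable_fun setT g ->
    measurable_fun setT (fun p => phi (f p) * phi (g p)).
  by move=> mf mg; apply: measurable_funM; apply: measurableT_comp => //;
    exact: measurable_normal_pdf.
have mind (f : T' * T' -> T' * T') : measurable_fun setT f ->
    measurable_fun setT (fun p => \1_B (f p) : R).
  by move=> mf; apply: measurableT_comp => //; exact: measurable_indic.
pose W (p : T' * T') := (\1_B (rot2 a b p) * phi p.1 * phi p.2)%:E.
pose G (p : T' * T') := (\1_B (p.1, a^-1 * p.2 + - (b / a) * p.1) *
  phi (a^-1 * p.1 + - (b / a) * p.2) * phi p.2)%:E.
pose V (p : T' * T') := (\1_B p * phi p.1 * phi p.2)%:E.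
have m1 : measurable_fun setT (fst : T' * T' -> T') by exact: measurable_fst.
have m2 : measurable_fun setT (snd : T' * T' -> T') by exact: measurable_snd.
have mlin (c e : R) (f g : T' * T' -> T') : measurable_fun setT f ->
    measurable_fun setT g -> measurable_fun setT (fun p => c * f p + e * g p).
  by move=> mf mg; apply: measurable_funD; apply: measurable_funM.
have mW : measurable_fun setT W.
  apply/measurable_EFinP; rewrite /W; under eq_fun do rewrite -mulrA.
  by apply: measurable_funM; [apply: mind; exact: measurable_rot2|exact: mphi2].
have mG : measurable_fun setT G.
  apply/measurable_EFinP; rewrite /G; under eq_fun do rewrite -mulrA.
  by apply: measurable_funM; [apply: mind; apply: measurable_fun_pair => //; exact: mlin|apply: mphi2 => //; exact: mlin].
have mV : measurable_fun setT V.
  apply/measurable_EFinP; rewrite /V; under eq_fun do rewrite -mulrA.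
  by apply: measurable_funM; [exact: mind|exact: mphi2].
have W0 p : (0 <= W p)%E by rewrite lee_fin !mulr_ge0// normal_pdf_ge0.
have G0 p : (0 <= G p)%E by rewrite lee_fin !mulr_ge0// normal_pdf_ge0.
have V0 p : (0 <= V p)%E by rewrite lee_fin !mulr_ge0// normal_pdf_ge0.
have E1 x y : - b * x + a * y = a^-1 * y + - (b / a) * (a * x + b * y).
  transitivity ((- (a * b * x) + a ^+ 2 * y) / a); first by field.
  rewrite (_ : a ^+ 2 = 1 - b ^+ 2); last by rewrite -ab; ring.
  by field.
have E2 x y : x = a^-1 * (a * x + b * y) + - (b / a) * y by field.
rewrite (gauss2E mrB) (gauss2E mB).
(* On the left, [|a|] is absorbed by the first substitution; on the right it cancels the Jacobian of
   the second. Both sides become iterated integrals of [G]. *)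
apply: (@mule_finI _ `|a|); first by rewrite normr_eq0.
have FW := @fubini_tonelli _ _ T' T' R leb leb W mW W0.
have FG := @fubini_tonelli _ _ T' T' R leb leb G mG G0.
have mW2 := @measurable_fun_fubini_tonelli_G _ _ T' T' R leb W mW W0.
have mV1 := @measurable_fun_fubini_tonelli_F _ _ T' T' R leb V mV V0.
have I1 : (\int[leb]_y (`|a|%:E * \int[leb]_x W (x, y)) =
    `|a|%:E * \int[leb]_x \int[leb]_y W (x, y))%E.
  rewrite FW; apply: ge0_integralZl.
  - exact: measurableT.
  - exact: mW2.
  - by move=> y _; apply: integral_ge0 => x _; exact: W0.
  - by rewrite lee_fin.
have I2 : (\int[leb]_x (`|a|%:E * \int[leb]_y V (x, y)) =
    `|a|%:E * \int[leb]_x \int[leb]_y V (x, y))%E.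
  apply: ge0_integralZl.
  - exact: measurableT.
  - exact: mV1.
  - by move=> y _; apply: integral_ge0 => x _; exact: V0.
  - by rewrite lee_fin.
transitivity (\int[leb]_y (`|a|%:E * \int[leb]_x W (x, y)))%E; first exact: (esym I1).
transitivity (\int[leb]_x (`|a|%:E * \int[leb]_y V (x, y)))%E; last exact: I2.
have A1 y : (\int[leb]_u G (u, y) = `|a|%:E * \int[leb]_x G (affine a (b * y) x, y))%E.
  apply: (@ge0_integral_affine R a (b * y) (fun x => G (x, y))); first exact: a0.
    exact: (measurableT_comp mG (pair2_measurable y)).
  by move=> x; exact: G0.
have A2 x : (\int[leb]_v V (x, v) = `|a^-1|%:E * \int[leb]_y V (x, affine a^-1 (- (b / a) * x) y))%E.
  apply: (@ge0_integral_affine R a^-1 _ (fun y => V (x, y))); first by rewrite invr_eq0.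
    exact: (measurableT_comp mV (pair1_measurable x)).
  by move=> y; exact: V0.
transitivity (\int[leb]_y \int[leb]_x G (x, y))%E.
  apply: eq_integral => y _; rewrite A1.
  congr (_ * _)%E; apply: eq_integral => x _; rewrite /W /G /affine/= /rot2/=.
  rewrite -E1 -E2; reflexivity.
rewrite -FG; apply: eq_integral => x _; rewrite A2 Ka.
apply: eq_integral => y _; rewrite /V /G /affine/=.
congr (_%:E); rewrite -!mulrA; congr (_ * _); exact: normal_pdf_rot.
Qed.

End PlaneRotation.

Section StandardGaussian.
Variable R : realType.
Local Notation T' := (measurableTypeR R).
Local Notation N01 := (@normal_prob R 0 1).

Definition consr k (p : T' * 'rV[R]_k) : 'rV[R]_k.+1 :=
  row_mx (p.1%:M : 'M[R]_1) p.2.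

Lemma consrE0 k (p : T' * 'rV[R]_k) : consr p 0 ord0 = p.1.
Proof.
have := row_mxEl (p.1%:M : 'M[R]_1) p.2 0 ord0; rewrite [X in _ = X]mxE eqxx mulr1n => <-.
by congr (row_mx _ _ _ _); exact: val_inj.
Qed.

Lemma consrES k (p : T' * 'rV[R]_k) j : consr p 0 (lift ord0 j) = p.2 0 j.
Proof.
rewrite -(row_mxEr (p.1%:M : 'M[R]_1) p.2); congr (row_mx _ _ _ _); exact: val_inj.
Qed.

Lemma measurable_consr k : measurable_fun setT (@consr k).
Proof.
apply: measurable_fun_mx => i j; rewrite (ord1 i); case: (unliftP ord0 j) => [j' ->|->].
  under eq_fun do rewrite consrES.
  exact: (measurableT_comp (measurable_coord 0 j') (@measurable_snd _ _ _ _)).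
by under eq_fun do rewrite consrE0; exact: measurable_fst.
Qed.

(** A concrete standard Gaussian law, built one coordinate at a time so that integrating out the
    first coordinate is the definition of the product measure. By uniqueness every law satisfying
    [std_normal_law] coincides with it. *)
Fixpoint std (k : nat) : probability 'rV[R]_k R :=
  match k with
  | 0 => \d_(0 : 'rV[R]_0)
  | k'.+1 => law ((N01 \x std k')%E : probability (T' * 'rV[R]_k')%type R)
               (measurable_consr (k := k'))
  end.

Lemma stdSE k (B : set 'rV[R]_k.+1) : measurable B ->
  std k.+1 B = (\int[N01]_x std k [set z | B (consr (x, z))])%E.
Proof.
move=> mB; transitivity (\int[N01]_x (std k \o xsection (@consr k @^-1` B)) x)%E => //.
apply: eq_integral => x _; congr (std k _).
by apply/seteqP; split => z; rewrite /xsection/= inE.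
Qed.

Definition rect k (B : 'I_k -> set T') : set 'rV[R]_k := [set z | forall i, B i (z 0 i)].

Lemma measurable_rect k (B : 'I_k -> set T') : (forall i, measurable (B i)) ->
  measurable (rect B).
Proof.
move=> mB; rewrite (_ : rect B = \bigcap_(i in [set: 'I_k]) ((fun z : 'rV[R]_k => z 0 i) @^-1` B i)).
  apply: fin_bigcap_measurable => // i _; rewrite -[X in measurable X]setTI.
  exact: (@measurable_coord R 1 k 0 i measurableT (B i) (mB i)).
by apply/seteqP; split => y h; [move=> j _; exact: h|move=> j; exact: (h j)].
Qed.

Lemma std_rect k (B : 'I_k -> set T') : (forall i, measurable (B i)) ->
  std k (rect B) = (\prod_(i < k) N01 (B i))%E.
Proof.
elim: k B => [|k IH] B mB.
  by rewrite big_ord0 /= diracE mem_set// => -[].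
rewrite stdSE; last exact: measurable_rect.
rewrite big_ord_recl/= -IH//.
transitivity (\int[N01]_x ((\1_(B ord0) x)%:E * std k (rect (fun i => B (lift ord0 i)))))%E.
  apply: eq_integral => x _; rewrite indicE; have [/set_mem Bx|Bx] := boolP (x \in B ord0).
    rewrite mul1e; congr (std k _); apply/seteqP; split => z /= h i.
      by have := h (lift ord0 i); rewrite consrES.
    by case: (unliftP ord0 i) => [j ->|->]; rewrite ?consrES ?consrE0.
  rewrite mul0e (_ : mkset _ = set0) ?measure0//; apply/seteqP; split => // z /(_ ord0).
  by rewrite consrE0 => /mem_set; rewrite (negbTE Bx).
rewrite ge0_integralZr//; first by rewrite integral_indic ?setIT.
by apply/measurable_EFinP; exact: measurable_indic.
Qed.

Lemma std_normal_law_std k : std_normal_law (std k).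
Proof.
move=> B mB; rewrite (_ : mkset _ = rect B)// std_rect//.
elim: k B mB => [|k IH] B mB; first by rewrite !big_ord0.
have mB0 := mB ord0; rewrite !big_ord_recl fineM ?IH// ?fin_num_measure//.
have mB' (i : 'I_k) : measurable (B (lift ord0 i) : set T') by exact: mB.
have : std k (rect (fun i => B (lift ord0 i))) \is a fin_num.
  by apply: fin_num_measure; exact: measurable_rect.
by rewrite (std_rect mB').
Qed.

(** Measurable rectangles are stable under intersection and generate the Borel sets. *)
Lemma std_normal_law_unique k (g : probability 'rV[R]_k R) : std_normal_law g ->
  forall A, measurable A -> g A = std k A.
Proof.
move=> hg; apply: (@measure_unique _ _ _
  [set rect B | B in [set B : 'I_k -> set T' | forall i, measurable (B i)]] (fun=> setT)).
- apply/seteqP; split.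
    apply: measurable_mx_sub; first exact: smallest_sigma_algebra.
    move=> i j a; rewrite (ord1 i); apply: sub_sigma_algebra.
    exists (fun l => if l == j then `]-oo, a]%classic else setT).
      by move=> l /=; case: ifP.
    apply/seteqP; split => [y /(_ j)|y /= ya l]; first by rewrite eqxx/= in_itv.
    by case: eqP => // ->; rewrite /= in_itv.
  apply: smallest_sub; first exact: sigma_algebra_measurable.
  by move=> _ [B mB <-]; exact: measurable_rect.
- move=> _ _ [B mB <-] [C mC <-]; exists (fun i => B i `&` C i).
    by move=> i; exact: measurableI.
  apply/seteqP; split => z; first by move=> h; split => i; have [] := h i.
  by move=> [h1 h2] i; split.
- by move=> _; exists (fun=> setT) => //; apply/seteqP; split.
- by rewrite bigcup_const.
- move=> _ [B mB <-]; have mr := measurable_rect mB.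
  rewrite -[LHS]fineK ?fin_num_measure// -[RHS]fineK ?fin_num_measure//; congr EFin.
  by rewrite hg// (std_normal_law_std mB).
- by move=> _; rewrite (le_lt_trans (probability_le1 g _)) ?ltry.
Qed.

Lemma measurable_mulmxr k r (A : 'M[R]_(k, r)) : measurable_fun setT (fun z : 'rV[R]_k => z *m A).
Proof.
apply: measurable_fun_mx => i j; under eq_fun do rewrite mxE.
by apply: measurable_sum => l; apply: measurable_funM => //; exact: measurable_coord.
Qed.

Definition gaussian_law k r (A : 'M[R]_(k, r)) : probability 'rV[R]_r R :=
  law (std k) (measurable_mulmxr A).

Lemma normal_lawP r (Psi : 'M[R]_r) (mu : probability 'rV[R]_r R) : normal_law 0 Psi mu ->
  exists k (A : 'M[R]_(k, r)), A^T *m A = Psi /\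
    forall B, measurable B -> mu B = gaussian_law A B.
Proof.
move=> [k [g [A [hg AP muE]]]]; exists k, A; split=> // B mB.
rewrite muE// (std_normal_law_unique hg); last first.
  under eq_set do rewrite add0r.
  by rewrite -[X in measurable X]setTI; exact: measurable_mulmxr.
transitivity (std k [set z | B (z *m A)]); last by [].
by congr (std k _); apply/seteqP; split => z /=; rewrite add0r.
Qed.

Lemma normal_law_gaussian_law k r (A : 'M[R]_(k, r)) :
  normal_law 0 (A^T *m A) (gaussian_law A).
Proof.
exists k, (std k), A; split => //; first exact: std_normal_law_std.
move=> B mB; transitivity (std k [set z | B (z *m A)]); first by [].
by congr (std k _); apply/seteqP; split => z /=; rewrite add0r.
Qed.

End StandardGaussian.

Section RotationInvariance.
Variable R : realType.
Local Notation T' := (measurableTypeR R).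
Local Notation N01 := (@normal_prob R 0 1).

Lemma normal_probN (A : set T') : measurable A -> N01 (affine (-1) 0 @^-1` A) = N01 A.
Proof.
have N1 : (-1 : R) != 0 by rewrite oppr_eq0 oner_neq0.
move=> mA; rewrite /normal_prob [LHS]integral_mkcond [RHS]integral_mkcond.
have mp : measurable_fun setT (fun x : T' => (normal_pdf 0 1 x)%:E).
  by apply/measurable_EFinP; exact: measurable_normal_pdf.
rewrite [RHS](@ge0_integral_affine R (-1) 0)//; last 2 first.
- by apply/(measurable_restrictT _ _).1 => //; exact: measurable_funTS.
- by move=> x; rewrite patchE; case: ifP => // _; rewrite lee_fin normal_pdf_ge0.
rewrite normrN1 mul1e; apply: eq_integral => x _; rewrite !patchE.
rewrite (_ : (x \in affine (-1) 0 @^-1` A) = (affine (-1) 0 x \in A)); last first.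
  by apply/idP/idP; rewrite !inE.
by rewrite /affine addr0 mulN1r !normal_pdf01E sqrrN.
Qed.

(** The Gram matrix is carried along with the law because covariances are later read off the
    transformed factor. *)
Definition same_gaussian k k' r (A : 'M[R]_(k, r)) (A' : 'M[R]_(k', r)) : Prop :=
  A^T *m A = A'^T *m A' /\
  forall B, measurable B -> gaussian_law A B = gaussian_law A' B.

Lemma same_gaussian_trans k k' k'' r (A : 'M[R]_(k, r)) (A' : 'M[R]_(k', r))
    (A'' : 'M[R]_(k'', r)) :
  same_gaussian A A' -> same_gaussian A' A'' -> same_gaussian A A''.
Proof.
by move=> [h1 h2] [h3 h4]; split; [rewrite h1|move=> B mB; rewrite h2// h4].
Qed.

Lemma measurable_translate r (p : 'rV[R]_r) : measurable_fun setT (fun y : 'rV[R]_r => p + y).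
Proof.
apply: measurable_fun_mx => i j; under eq_fun do rewrite mxE.
by apply: measurable_funD => //; exact: measurable_coord.
Qed.

Definition shift_set r (v : 'rV[R]_r) (B : set 'rV[R]_r) : set 'rV[R]_r :=
  [set y | B (v + y)].

Lemma gaussian_law_col k r (p : 'rV[R]_r) (A : 'M[R]_(k, r)) B : measurable B ->
  gaussian_law (col_mx p A : 'M[R]_(1 + k, r)) B =
  (\int[N01]_x gaussian_law A (shift_set (x *: p)%R B))%E.
Proof.
move=> mB; have mB' : measurable [set z : 'rV[R]_k.+1 | B (z *m (col_mx p A : 'M[R]_(1 + k, r)))].
  by rewrite -[X in measurable X]setTI; exact: (@measurable_mulmxr R k.+1 r).
transitivity (std R k.+1 [set z | B (z *m (col_mx p A : 'M[R]_(1 + k, r)))]); first by [].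
rewrite stdSE//; apply: eq_integral => x _.
transitivity (std R k [set z | B (x *: p + z *m A)]); last by [].
by congr (std R k _); apply/seteqP; split => z /=; rewrite /consr mul_row_col mul_scalar_mx.
Qed.

Lemma gaussian_law_col2 k r (p q : 'rV[R]_r) (A : 'M[R]_(k, r)) B : measurable B ->
  gaussian_law (col_mx p (col_mx q A) : 'M[R]_(1 + (1 + k), r)) B =
  (\int[gauss2 R]_w gaussian_law A (shift_set (w.1 *: p + w.2 *: q)%R B))%E /\
  measurable_fun setT (fun w : T' * T' => gaussian_law A (shift_set (w.1 *: p + w.2 *: q)%R B)).
Proof.
move=> mB; pose f (u : (T' * T') * 'rV[R]_r) := u.1.1 *: p + u.1.2 *: q + u.2.
have mf : measurable_fun setT f.
  apply: measurable_fun_mx => i j; rewrite /f; under eq_fun do rewrite !mxE.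
  apply: measurable_funD; last first.
    exact: (measurableT_comp (measurable_coord i j) (@measurable_snd _ _ _ _)).
  apply: measurable_funD; apply: measurable_funM => //.
    exact: (measurableT_comp (@measurable_fst _ _ _ _) (@measurable_fst _ _ _ _)).
  exact: (measurableT_comp (@measurable_snd _ _ _ _) (@measurable_fst _ _ _ _)).
have mB2 : measurable (f @^-1` B) by rewrite -[X in measurable X]setTI; exact: mf.
have E w : gaussian_law A (shift_set (w.1 *: p + w.2 *: q)%R B) =
    gaussian_law A (xsection (f @^-1` B) w).
  by congr (gaussian_law A _); apply/seteqP; split => y; rewrite /xsection/shift_set/= inE.
have mF : measurable_fun setT (fun w : T' * T' => gaussian_law A (shift_set (w.1 *: p + w.2 *: q)%R B)).
  by under eq_fun do rewrite E; exact: (measurable_fun_xsection (gaussian_law A) mB2).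
split => //; rewrite gaussian_law_col//.
transitivity (\int[N01]_x \int[N01]_y gaussian_law A (shift_set (x *: p + y *: q)%R B))%E.
  apply: eq_integral => x _; rewrite gaussian_law_col; last first.
    by rewrite -[X in measurable X]setTI; exact: measurable_translate.
  by apply: eq_integral => y _; congr (gaussian_law A _); apply/seteqP; split => v; rewrite /shift_set/= addrA.
by rewrite [RHS](@fubini_tonelli1 _ _ T' T' R N01 N01 _ mF).
Qed.

Lemma same_gaussian_col k k' r (p : 'rV[R]_r) (A : 'M[R]_(k, r)) (A' : 'M[R]_(k', r)) :
  same_gaussian A A' ->
  same_gaussian (col_mx p A : 'M[R]_(1 + k, r)) (col_mx p A' : 'M[R]_(1 + k', r)).
Proof.
move=> [h1 h2]; split; first by rewrite !tr_col_mx !mul_row_col h1.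
move=> B mB; rewrite !gaussian_law_col//; apply: eq_integral => x _; apply: h2.
by rewrite -[X in measurable X]setTI; exact: measurable_translate.
Qed.

(** Symmetry of N(0, 1); it serves to make the pivot of a triangular factor positive in
    [gaussian_conditioning]. *)
Lemma same_gaussian_flip k r (p : 'rV[R]_r) (A : 'M[R]_(k, r)) :
  same_gaussian (col_mx p A : 'M[R]_(1 + k, r)) (col_mx (- p) A : 'M[R]_(1 + k, r)).
Proof.
split.
  rewrite !tr_col_mx !mul_row_col; congr (_ + _).
  by apply/matrixP => i j; rewrite !mxE !big_ord1 !mxE mulrNN.
move=> B mB; rewrite !gaussian_law_col//.
pose F (x : T') := gaussian_law A (shift_set (x *: p)%R B).
have mF : measurable_fun setT F.
  pose f (u : T' * 'rV[R]_r) := u.1 *: p + u.2.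
  have mf : measurable_fun setT f.
    apply: measurable_fun_mx => i j; rewrite /f; under eq_fun do rewrite !mxE.
    apply: measurable_funD; first by apply: measurable_funM => //; exact: measurable_fst.
    exact: (measurableT_comp (measurable_coord i j) (@measurable_snd _ _ _ _)).
  have mB2 : measurable (f @^-1` B) by rewrite -[X in measurable X]setTI; exact: mf.
  rewrite (_ : F = gaussian_law A \o xsection (f @^-1` B)); last first.
    apply/funext => w; congr (gaussian_law A _).
    by apply/seteqP; split => y; rewrite /xsection/shift_set/= inE.
  exact: measurable_fun_xsection.
have mN := @measurable_affine R (-1) 0.
transitivity (\int[N01]_x F (affine (-1) 0 x))%E; last first.
  apply: eq_integral => x _; rewrite /F /affine addr0 mulN1r.
  by congr (gaussian_law A _); apply/seteqP; split => y; rewrite /shift_set/= scaleNr scalerN.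
have := @ge0_integral_pushforward _ _ T' T' R _ mN N01 setT F measurableT mF.
rewrite preimage_setT => <-; last by move=> x _; rewrite /F measure_ge0.
by apply: eq_measure_integral => D mD _; exact/esym/normal_probN.
Qed.

(** Rotating two rows amounts to rotating the two Gaussian coordinates that multiply them, and
    [gauss2] is rotation invariant. The condition [a != 0] comes from the substitution behind
    [gauss2_rot], which divides by [a]. *)
Lemma same_gaussian_rot k r (p q : 'rV[R]_r) (A : 'M[R]_(k, r)) (a b : R) :
  a != 0 -> a ^+ 2 + b ^+ 2 = 1 ->
  same_gaussian (col_mx p (col_mx q A) : 'M[R]_(1 + (1 + k), r))
    (col_mx (a *: p - b *: q) (col_mx (b *: p + a *: q) A) : 'M[R]_(1 + (1 + k), r)).
Proof.
move=> a0 ab; split.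
  rewrite !tr_col_mx !mul_row_col !addrA; congr (_ + _).
  apply/matrixP => i j; rewrite !mxE !big_ord1 !mxE.
  rewrite -[LHS]mul1r -ab; ring.
move=> B mB; have [-> mF] := gaussian_law_col2 p q A mB.
have [-> _] := gaussian_law_col2 (a *: p - b *: q) (b *: p + a *: q) A mB.
have mr := @measurable_rot2 R a b.
set F := (fun w : T' * T' => _) in mF *.
transitivity (\int[gauss2 R]_w F (rot2 a b w))%E; last first.
  apply: eq_integral => -[x y] _; rewrite /F /rot2/=; congr (gaussian_law A _).
  congr (shift_set _ B); apply/rowP => i; rewrite !mxE; ring.
have := @ge0_integral_pushforward _ _ _ _ R _ mr (gauss2 R) setT F measurableT mF.
rewrite preimage_setT => <-; last by move=> x _; rewrite /F measure_ge0.
by apply: eq_measure_integral => D mD _; exact/esym/gauss2_rot.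
Qed.

(* QR decomposition: plane rotations of the rows preserve the law. *)
Lemma same_gaussian_triangular k r (A : 'M[R]_(1 + k, r)) (c : 'I_r) :
  exists (p : 'rV[R]_r) (A0 : 'M[R]_(k, r)),
    same_gaussian A (col_mx p A0) /\ forall i, A0 i c = 0.
Proof.
elim: k A => [|k IH] A.
  exists (usubmx A), (dsubmx A); split; first by rewrite vsubmxK; split.
  by case.
have [q [A1 [AqA1 A1c]]] := IH (dsubmx A).
have [p H1] : exists p, same_gaussian A (col_mx p (col_mx q A1) : 'M[R]_(1 + (1 + k), r)).
  by exists (usubmx A); rewrite -{1}(vsubmxK A); exact: same_gaussian_col.
suff [p' [q' [H2 q'c]]] : exists p' q' : 'rV[R]_r, same_gaussian
    (col_mx p (col_mx q A1) : 'M[R]_(1 + (1 + k), r))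
    (col_mx p' (col_mx q' A1) : 'M[R]_(1 + (1 + k), r)) /\ q' 0 c = 0.
  exists p', (col_mx q' A1); split; first exact: same_gaussian_trans H1 H2.
  have H (i : 'I_(1 + k)) : col_mx q' A1 i c = 0.
    by rewrite mxE; case: (fintype.split i) => l; rewrite ?(ord1 l).
  exact: H.
have [pc0|pc0] := eqVneq (p 0 c) 0.
  (* The two rows have to be exchanged, up to sign. A quarter turn has [a = 0], so it is composed of
     two rotations by 45 degrees. *)
  pose h : R := (Num.sqrt 2)^-1.
  have h2 : h ^+ 2 = 2^-1 by rewrite exprVn sqr_sqrtr.
  have h0 : h != 0 by rewrite invr_eq0 gt_eqF// sqrtr_gt0.
  have hh : h ^+ 2 + h ^+ 2 = 1 by rewrite h2; lra.
  pose p1 := h *: p - h *: q; pose q1 := h *: p + h *: q.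
  exists (h *: p1 - h *: q1), (h *: p1 + h *: q1); split.
    by apply: same_gaussian_trans (same_gaussian_rot _ _ _ h0 hh);
      exact: same_gaussian_rot.
  by rewrite !mxE pc0; ring.
(* Givens rotation: with the [a] and [b] below, [b * p 0 c + a * q 0 c] vanishes. *)
pose s := Num.sqrt (p 0 c ^+ 2 + q 0 c ^+ 2).
have s2 : s ^+ 2 = p 0 c ^+ 2 + q 0 c ^+ 2 by rewrite sqr_sqrtr// addr_ge0// sqr_ge0.
have s0 : s != 0 by rewrite gt_eqF// sqrtr_gt0 ltr_wpDr ?sqr_ge0// exprn_even_gt0.
pose a := p 0 c / s; pose b := - (q 0 c / s).
exists (a *: p - b *: q), (b *: p + a *: q); split.
  apply: same_gaussian_rot; first by rewrite mulf_neq0// invr_eq0.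
  rewrite /a /b sqrrN !exprMn -mulrDl -s2 -exprMn divff// expr1n//.
by rewrite !mxE /a /b; ring.
Qed.

End RotationInvariance.

(** * Gaussian survivor functions *)

Section RealDominatedConvergence.
Variables (R : realType) (d : measure_display) (T : measurableType d).
Variables (mu : {measure set T -> \bar R}) (D : set T).
Hypothesis mD : measurable D.

Lemma Rintegral_dominated_cvg (f_ : nat -> T -> R) (f g : T -> R) :
  (forall n, measurable_fun D (f_ n)) -> measurable_fun D f ->
  mu.-integrable D (EFin \o g) ->
  {ae mu, forall x, D x -> (fun n => f_ n x) @ \oo --> f x} ->
  (forall n x, D x -> `|f_ n x| <= g x) ->
  \int[mu]_(x in D) f_ n x @[n --> \oo] --> \int[mu]_(x in D) f x.
Proof.
move=> mf_ mf ig cf fg.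
have h1 : {ae mu, forall x, D x -> (fun n => (f_ n x)%:E) @ \oo --> (f x)%:E}.
  by apply: filterS cf => x h Dx; apply: cvg_EFin; [exact: nearW|exact: h].
have h2 : {ae mu, forall x n, D x -> (`|(f_ n x)%:E| <= (g x)%:E)%E}.
  by apply: aeW => x n Dx; rewrite lee_fin; exact: fg.
have h3 n : measurable_fun D (fun x => (f_ n x)%:E) by exact/measurable_EFinP.
have h4 : measurable_fun D (fun x => (f x)%:E) by exact/measurable_EFinP.
have [fi _ c] := dominated_convergence mD h3 h4 h1 ig h2.
apply: (@fine_cvg _ _ _ _ (fun n => \int[mu]_(x in D) (f_ n x)%:E)%E).
rewrite fineK; first exact: c.
exact: integrable_fin_num.
Qed.

End RealDominatedConvergence.

Section SurvivorRecursion.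
Variable R : realType.
Local Notation T' := (measurableTypeR R).
Local Notation N01 := (@normal_prob R 0 1).

Definition upset r (x : 'rV[R]_r) : set 'rV[R]_r := [set y | forall i, x 0 i < y 0 i].

Lemma measurable_lt_fun d (T : measurableType d) (f g : T -> R) :
  measurable_fun setT f -> measurable_fun setT g -> measurable [set t | f t < g t].
Proof.
move=> mf mg; rewrite (_ : mkset _ = (fun t => g t - f t) @^-1` `]0, +oo[).
  by rewrite -[X in measurable X]setTI; exact: (measurable_funB mg mf).
by apply/seteqP; split => t; rewrite /= in_itv/= andbT subr_gt0.
Qed.

Lemma measurable_indic_lt d (T : measurableType d) (f g : T -> R) :
  measurable_fun setT f -> measurable_fun setT g ->
  measurable_fun setT (fun t => (f t < g t)%R%:R : R).
Proof.
move=> mf mg; rewrite (_ : (fun t => _) = \1_[set t | f t < g t]).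
  exact/measurable_indic/measurable_lt_fun.
apply/funext => t; rewrite indicE; congr (_%:R : R); congr nat_of_bool.
by apply/idP/idP; rewrite inE.
Qed.

Lemma measurable_upset r (x : 'rV[R]_r) : measurable (upset x).
Proof.
rewrite (_ : upset x = \bigcap_(i in [set: 'I_r]) [set y : 'rV[R]_r | x 0 i < y 0 i]).
  by apply: fin_bigcap_measurable => // i _; apply: measurable_lt_fun => //; exact: measurable_coord.
by apply/seteqP; split => y h; [move=> j _; exact: h|move=> j; exact: (h j)].
Qed.

(** Covariance of the other coordinates given the last one. *)
Definition schur r (Psi : 'M[R]_r.+1) : 'M[R]_r :=
  \matrix_(i, j) (Psi (ini i) (ini j) -
    Psi (ini i) ord_max * Psi (ini j) ord_max / Psi ord_max ord_max).

(* The remaining thresholds once the last coordinate, of variance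
   [Psi ord_max ord_max], is [s] standard deviations above its mean. *)
Definition residual r (x : 'rV[R]_r.+1) (Psi : 'M[R]_r.+1) (s : R) : 'rV[R]_r :=
  \row_i (x 0 (ini i) - Psi (ini i) ord_max / Num.sqrt (Psi ord_max ord_max) * s).

(** Gaussian survivor function obtained by conditioning on the last coordinate repeatedly. It is an
    expression in the covariance alone, whatever factor represents the law. *)
Fixpoint surv r : 'rV[R]_r -> 'M[R]_r -> R :=
  match r with
  | 0 => fun _ _ => 1
  | r'.+1 => fun x Psi => \int[N01]_s
      ((x 0 ord_max < Num.sqrt (Psi ord_max ord_max) * s)%R%:R *
       surv (residual x Psi s) (schur Psi))
  end.

(** Positivity of all pivots in the elimination that starts from the last coordinate: these are the
    quantities that the recursion of [surv] divides by. *)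
Fixpoint posdef r : 'M[R]_r -> Prop :=
  match r with
  | 0 => fun=> True
  | r'.+1 => fun Psi => 0 < Psi ord_max ord_max /\ posdef (schur Psi)
  end.

Lemma ini_lift r (i : 'I_r) : ini i = lift ord_max i.
Proof. by apply: val_inj; rewrite /= /bump leqNgt ltn_ord. Qed.

Lemma iniP r (i : 'I_r.+1) : i = ord_max \/ exists j : 'I_r, i = ini j.
Proof.
by case: (unliftP ord_max i) => [j ->|->]; [right; exists j; rewrite ini_lift|left].
Qed.

Lemma measurable_gaussian_upset k r (A : 'M[R]_(k, r)) (u v : 'rV[R]_r) :
  measurable_fun setT (fun s : T' => gaussian_law A (upset (\row_i (u 0 i - v 0 i * s)))).
Proof.
pose B := \bigcap_(i in [set: 'I_r])
  [set p : T' * 'rV[R]_r | u 0 i - v 0 i * p.1 < p.2 0 i].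
have mB : measurable B.
  apply: fin_bigcap_measurable => // i _; apply: measurable_lt_fun.
    apply: measurable_funB => //; apply: measurable_funM => //; exact: measurable_fst.
  exact: (measurableT_comp (measurable_coord 0 i) (@measurable_snd _ _ _ _)).
rewrite (_ : (fun s => _) = gaussian_law A \o xsection B).
  exact: measurable_fun_xsection.
apply/funext => s /=; congr (gaussian_law A _); apply/seteqP; split => y h.
  by rewrite /xsection/= inE => i _ /=; have := h i; rewrite mxE.
by move=> i; move: h; rewrite /xsection/= inE => /(_ i I)/=; rewrite mxE.
Qed.

(** In a triangular factor a single standard normal variable [s] carries the last component, which
    is [sg * s]. Given [s], the other components are a translate of the Gaussian vector with factor
    [A'], whose Gram matrix is the Schur complement. *)
Lemma gaussian_conditioning k r (A : 'M[R]_(k, r.+1)) (Psi : 'M[R]_r.+1) :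
  A^T *m A = Psi -> 0 < Psi ord_max ord_max ->
  exists k' (A' : 'M[R]_(k', r)), A'^T *m A' = schur Psi /\
    forall x, fine (gaussian_law A (upset x)) = \int[N01]_s
      ((x 0 ord_max < Num.sqrt (Psi ord_max ord_max) * s)%R%:R *
       fine (gaussian_law A' (upset (residual x Psi s)))).
Proof.
move=> AP Pm; set sg := Num.sqrt _.
have sg0 : 0 < sg by rewrite sqrtr_gt0.
have sg2 : sg ^+ 2 = Psi ord_max ord_max by rewrite sqr_sqrtr// ltW.
case: k A AP => [|k] A AP.
  by move: Pm; rewrite -AP mxE big_ord0 ltxx.
have [p [A0 [[AA0 lA] A0max]]] := same_gaussian_triangular (A : 'M[R]_(1 + k, _)) ord_max.
have AA : (col_mx p A0 : 'M[R]_(1 + k, _))^T *m (col_mx p A0) = Psi by rewrite -AA0.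
have PsiE i j : Psi i j = p 0 i * p 0 j + \sum_l A0 l i * A0 l j.
  rewrite -AA tr_col_mx mul_row_col mxE; congr (_ + _); rewrite mxE.
    by rewrite big_ord1 mxE.
  by apply: eq_bigr => l _; rewrite mxE.
have Psim i : Psi i ord_max = p 0 i * p 0 ord_max.
  by rewrite PsiE big1 ?addr0// => l _; rewrite A0max mulr0.
(* The pivot is known up to sign; flipping the first row makes it [sg], as the direction of the
   inequality requires. *)
have [p' [p'max H]] : exists p' : 'rV[R]_r.+1, [/\ p' 0 ord_max = sg,
    (forall i j, p' 0 i * p' 0 j = p 0 i * p 0 j) &
    forall B, measurable B -> gaussian_law A B = gaussian_law (col_mx p' A0 : 'M[R]_(1 + k, _)) B].
  have pm2 : p 0 ord_max ^+ 2 = sg ^+ 2 by rewrite sg2 Psim.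
  move/eqP : pm2; rewrite eqf_sqr => /orP[/eqP pE|/eqP pE]; first by exists p; split.
  exists (- p); split; first by rewrite mxE pE opprK.
    by move=> i j; rewrite !mxE mulrNN.
  by move=> B mB; rewrite lA//; have [_ ->] := same_gaussian_flip p A0.
move=> lA'.
have p'E i : p' 0 i = Psi i ord_max / sg.
  by rewrite Psim -H p'max mulfK// gt_eqF.
pose A' : 'M[R]_(k, r) := \matrix_(l, i) A0 l (ini i).
exists k, A'; split.
  apply/matrixP => i j; rewrite !mxE PsiE -!H !p'E -sg2.
  under eq_bigr do rewrite !mxE.
  set S := \sum_(l < k) _.
  have E : Psi (ini i) ord_max / sg * (Psi (ini j) ord_max / sg) =
      Psi (ini i) ord_max * Psi (ini j) ord_max / sg ^+ 2 by field; rewrite gt_eqF.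
  by rewrite E addrAC subrr add0r.
move=> x; rewrite lA'; last exact: measurable_upset.
rewrite gaussian_law_col; last exact: measurable_upset.
rewrite /Rintegral; congr fine; apply: eq_integral => s _.
transitivity (std R k [set z | forall i, x 0 i < s * p' 0 i + (z *m A0) 0 i]).
  transitivity (std R k [set z | upset x (s *: p' + z *m A0)]); first by [].
  by congr (std R k _); apply/seteqP; split => z h i; have := h i; rewrite !mxE.
have zmax z : (z *m A0) 0 ord_max = 0.
  by rewrite mxE big1// => l _; rewrite A0max mulr0.
have zini z i : (z *m A0) 0 (ini i) = (z *m A') 0 i.
  by rewrite !mxE; apply: eq_bigr => l _; rewrite !mxE.
have [xs|xs] := boolP (x 0 ord_max < sg * s); last first.
  rewrite mul0r (_ : mkset _ = set0) ?measure0//; apply/seteqP; split => // z /(_ ord_max).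
  by rewrite zmax addr0 p'max mulrC; apply/negP.
rewrite mul1r fineK ?fin_num_measure//; last exact: measurable_upset.
transitivity (std R k [set z | upset (residual x Psi s) (z *m A')]); last by [].
congr (std R k _); apply/seteqP; split => z h i.
  by rewrite mxE -zini ltrBlDl mulrC -p'E; exact: h.
have [->|[j ->]] := iniP i; first by rewrite zmax addr0 p'max mulrC.
by have := h j; rewrite [X in X < _]mxE -zini ltrBlDl -p'E mulrC.
Qed.

Lemma normal_prob_set1 (a : R) : N01 [set a] = 0%E.
Proof.
apply: (null_content_dominatesP _ _).1 (normal_prob_dominates 0 1) _ _ _ => //.
exact: lebesgue_measure_set1.
Qed.

Lemma indic_lt_cvg (a_ b_ : nat -> R) (a b : R) : a_ @ \oo --> a -> b_ @ \oo --> b ->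
  a != b -> (fun n => (a_ n < b_ n)%R%:R : R) @ \oo --> ((a < b)%R%:R : R).
Proof.
move=> ca cb ab; have cd : (fun n => b_ n - a_ n) @ \oo --> b - a by exact: cvgB.
apply: cvg_near_cst; have [lt|ge] := ltP a b.
  have d0 : 0 < b - a by rewrite subr_gt0.
  by move/cvgr_gt : cd => /(_ _ d0); apply: filterS => n; rewrite subr_gt0 => ->.
have d0 : b - a < 0 by rewrite subr_lt0 lt_neqAle eq_sym ab.
move/cvgr_lt : cd => /(_ _ d0); apply: filterS => n; rewrite subr_lt0 => h.
by rewrite ltNge (ltW h).
Qed.

(** Induction on the dimension: conditioning reduces the claim to dominated convergence over the
    last coordinate. Nondegeneracy is asked of the limit [Psi] alone; the factors may be singular
    and have varying numbers of rows. *)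
Lemma gaussian_surv_cvg r (Psi : 'M[R]_r) (x : 'rV[R]_r) (k : nat -> nat)
    (A : forall n, 'M[R]_(k n, r)) (x_ : nat -> 'rV[R]_r) : posdef Psi ->
  (forall i j, (fun n => ((A n)^T *m A n) i j) @ \oo --> Psi i j) ->
  (forall i, (fun n => x_ n 0 i) @ \oo --> x 0 i) ->
  (fun n => fine (gaussian_law (A n) (upset (x_ n)))) @ \oo --> surv x Psi.
Proof.
elim: r Psi x k A x_ => [|r IH] Psi x k A x_.
  move=> _ _ _; rewrite (_ : (fun n => _) = cst 1); first exact: cvg_cst.
  apply/funext => n; rewrite (_ : upset _ = setT) ?probability_setT//.
  by apply/seteqP; split => // y _ [].
move=> [Pm pdS] cA cx.
pose Psi_ n := (A n)^T *m A n.
pose good n := 0 < Psi_ n ord_max ord_max.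
have near_good : \forall n \near \oo, good n by move/cvgr_gt : (cA ord_max ord_max); apply.
have A'_ n : exists (q : {k' : nat & 'M[R]_(k', r)}), good n ->
    (projT2 q)^T *m projT2 q = schur (Psi_ n) /\
    forall x, fine (gaussian_law (A n) (upset x)) = \int[N01]_s
      ((x 0 ord_max < Num.sqrt (Psi_ n ord_max ord_max) * s)%R%:R *
       fine (gaussian_law (projT2 q) (upset (residual x (Psi_ n) s)))).
  (* Indices with vanishing last variance, finitely many by [near_good], receive an empty factor,
     which the limit ignores. *)
  have [gn|ngn] := pselect (good n); last by exists (@existT nat (fun k' => 'M[R]_(k', r)) 0%N 0).
  have [k' [A' h]] := gaussian_conditioning (erefl (Psi_ n)) gn.
  by exists (@existT nat (fun k' => 'M[R]_(k', r)) k' A').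
pose q n := projT1 (cid (A'_ n)).
have qP n : good n -> _ := projT2 (cid (A'_ n)).
have cS i j : (fun n => ((projT2 (q n))^T *m projT2 (q n)) i j) @ \oo --> schur Psi i j.
  apply: cvg_trans (_ : (fun n => schur (Psi_ n) i j) @ \oo --> _).
    by apply: near_eq_cvg; apply: filterS near_good => n /qP[-> _].
  rewrite mxE; under eq_fun do rewrite mxE.
  apply: cvgB; first exact: cA.
  by apply: cvgM; [apply: cvgM; exact: cA|apply: cvgV; [rewrite gt_eqF|exact: cA]].
have csq : (fun n => Num.sqrt (Psi_ n ord_max ord_max)) @ \oo --> Num.sqrt (Psi ord_max ord_max).
  by apply: continuous_cvg; [exact: sqrt_continuous|exact: cA].
have cR s i : (fun n => residual (x_ n) (Psi_ n) s 0 i) @ \oo --> residual x Psi s 0 i.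
  rewrite mxE; under eq_fun do rewrite mxE.
  apply: cvgB; first exact: cx.
  apply: cvgM; last exact: cvg_cst.
  apply: cvgM; first exact: cA.
  by apply: cvgV; [rewrite gt_eqF// sqrtr_gt0|exact: csq].
pose g n s := fine (gaussian_law (projT2 (q n)) (upset (residual (x_ n) (Psi_ n) s))).
have cg s : (fun n => g n s) @ \oo --> surv (residual x Psi s) (schur Psi).
  by apply: IH => //; exact: cR.
have mg n : measurable_fun setT (g n).
  apply: measurableT_comp => //.
  have := measurable_gaussian_upset (projT2 (q n)) (\row_i x_ n 0 (ini i))
    (\row_i (Psi_ n (ini i) ord_max / Num.sqrt (Psi_ n ord_max ord_max))).
  congr (measurable_fun _ _); apply/funext => s; congr (gaussian_law _ (upset _)).
  by apply/rowP => i; rewrite !mxE.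
have mi (a c : R) : measurable_fun setT (fun s : T' => (a < c * s)%R%:R : R).
  by apply: measurable_indic_lt => //; exact: measurable_funM.
apply: cvg_trans (_ : (fun n => \int[N01]_s ((x_ n 0 ord_max <
    Num.sqrt (Psi_ n ord_max ord_max) * s)%R%:R * g n s)) @ \oo --> _).
  by apply: near_eq_cvg; apply: filterS near_good => n /qP[_ ->].
apply: (@Rintegral_dominated_cvg R _ _ _ setT measurableT _ _ (cst 1)).
- by move=> n; apply: measurable_funM; [exact: mi|exact: mg].
- apply: measurable_funM; first exact: mi.
  by apply: (measurable_fun_cvg mg) => s _; exact: cg.
- exact: finite_measure_integrable_cst.
(* The limiting indicator jumps at a single [s], the one that meets the threshold with equality. *)
- exists [set x 0 ord_max / Num.sqrt (Psi ord_max ord_max)]; split => //.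
    exact: normal_prob_set1.
  move=> s /= ns; apply: contrapT => sx; apply: ns => _.
  apply: cvgM; last exact: cg.
  apply: indic_lt_cvg; [exact: cx|by apply: cvgM; [exact: csq|exact: cvg_cst]|].
  apply/eqP => E; apply: sx; rewrite E mulrC mulKf// gt_eqF// sqrtr_gt0//.
- move=> n s _; rewrite ger0_norm; last by rewrite mulr_ge0// fine_ge0.
  have /andP[g0 g1] : 0 <= g n s <= 1.
    exact: probability_fine01 (measurable_upset _).
  by case: (_ < _); rewrite ?mul1r ?mul0r.
Qed.

(** Cholesky factorization from the last coordinate: [p] is the last column divided by the square
    root of the pivot, and [B] is a factor of the Schur complement padded with a zero column. *)
Lemma posdef_gram r (Psi : 'M[R]_r) : Psi^T = Psi -> posdef Psi ->
  exists A : 'M[R]_r, A^T *m A = Psi.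
Proof.
elim: r Psi => [|r IH] Psi sP; first by move=> _; exists 0; apply/matrixP => -[].
have sPE i j : Psi i j = Psi j i by rewrite -{1}sP mxE.
move=> [Pm pS]; have [|A' A'E] := IH (schur Psi) _ pS.
  by apply/matrixP => i j; rewrite !mxE sPE; congr (_ - _ / _); rewrite mulrC.
pose sg := Num.sqrt (Psi ord_max ord_max).
have sg0 : sg != 0 by rewrite gt_eqF// sqrtr_gt0.
have sg2 : sg * sg = Psi ord_max ord_max by rewrite -expr2 sqr_sqrtr// ltW.
pose p : 'rV[R]_r.+1 := \row_i (Psi i ord_max / sg).
pose B : 'M[R]_(r, r.+1) := \matrix_(l, i) oapp (A' l) 0 (unlift ord_max i).
have Bini l i : B l (ini i) = A' l i by rewrite mxE ini_lift liftK.
have Bmax l : B l ord_max = 0 by rewrite mxE unlift_none.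
have pE i j : p 0 i * p 0 j = Psi i ord_max * Psi j ord_max / Psi ord_max ord_max.
  by rewrite !mxE -sg2; field.
have Pm0 : Psi ord_max ord_max != 0 by rewrite gt_eqF.
pose C : 'M[R]_(1 + r, r.+1) := col_mx p B.
have CC : C^T *m C = p^T *m p + B^T *m B by rewrite tr_col_mx mul_row_col.
suff E i j : p 0 i * p 0 j + \sum_l B l i * B l j = Psi i j.
  exists C; apply/matrixP => i j; rewrite -E.
  transitivity ((p^T *m p + B^T *m B) i j); first by rewrite -CC.
  rewrite [LHS]mxE; congr (_ + _); rewrite mxE.
    by rewrite big_ord1 [p^T _ _]mxE.
  by apply: eq_bigr => l _; rewrite [B^T _ _]mxE.
rewrite pE; have [->|[i' ->]] := iniP i.
  by rewrite big1 ?addr0 => [|l _]; [rewrite (sPE ord_max j); field|rewrite Bmax mul0r].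
have [->|[j' ->]] := iniP j.
  by rewrite big1 ?addr0 => [|l _]; [field|rewrite Bmax mulr0].
have -> : \sum_l B l (ini i') * B l (ini j') = schur Psi i' j'.
  by rewrite -A'E mxE; apply: eq_bigr => l _; rewrite !Bini mxE.
by rewrite mxE addrC subrK.
Qed.

(** The convergence lemma for constant sequences; uniqueness of limits turns it into an equality. *)
Lemma gaussian_survE k r (A : 'M[R]_(k, r)) (x : 'rV[R]_r) : posdef (A^T *m A) ->
  fine (gaussian_law A (upset x)) = surv x (A^T *m A).
Proof.
move=> pP.
have h : (fun n : nat => fine (gaussian_law A (upset x))) @ \oo --> surv x (A^T *m A).
  by apply: (@gaussian_surv_cvg r _ x (fun=> k) (fun=> A) (fun=> x)) => // *; exact: cvg_cst.
exact: (cvg_unique _ (@cvg_cst _ _ _ _ _) h).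
Qed.

(** Whichever law the choice in [survivor] picks, it comes from some factor of [Psi], and
    [gaussian_survE] gives a value that depends on [Psi] alone. *)
Lemma survivorE r (x : 'rV[R]_r) (Psi : 'M[R]_r) : Psi^T = Psi -> posdef Psi ->
  survivor x Psi = surv x Psi.
Proof.
move=> sP pP; rewrite /survivor; case: pselect => [e|]; last first.
  by case; have [A <-] := posdef_gram sP pP; exists (gaussian_law A); exact: normal_law_gaussian_law.
case: cid => mu /= /normal_lawP[k [A [AP muE]]].
rewrite -/(upset x) muE; last exact: measurable_upset.
by rewrite -AP gaussian_survE// AP.
Qed.

End SurvivorRecursion.

Lemma increasing_idx_lt d k (m : {ffun 'I_k.+1 -> 'I_d}) (i j : 'I_k.+1) :
  increasing_idx m -> (i < j)%N -> (m i < m j)%N.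
Proof. by move=> /forallP/(_ i)/forallP/(_ j)/implyP. Qed.

Lemma increasing_idx_inj d k (m : {ffun 'I_k.+1 -> 'I_d}) : increasing_idx m -> injective m.
Proof.
move=> mI i j; case: (ltngtP i j) => [ij|ij|/val_inj//] E.
  by have := increasing_idx_lt mI ij; rewrite E ltnn.
by have := increasing_idx_lt mI ij; rewrite E ltnn.
Qed.

(** * Positive definiteness of the limiting covariances *)

Section PositiveDefiniteness.
Variable R : realType.

Definition pos_definite r (Psi : 'M[R]_r) := Psi^T = Psi /\
  forall x : 'rV[R]_r, x != 0 -> 0 < (x *m Psi *m x^T) 0 0.

Lemma quad_formE r (Psi : 'M[R]_r) (x : 'rV[R]_r) :
  (x *m Psi *m x^T) 0 0 = \sum_i \sum_j x 0 i * x 0 j * Psi i j.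
Proof.
rewrite mxE; under eq_bigr do rewrite mxE mulr_suml [x^T _ _]mxE.
rewrite exchange_big /=; apply: eq_bigr => i _; apply: eq_bigr => j _.
by rewrite mulrAC.
Qed.

Lemma big_iniE r (F : 'I_r.+1 -> R) : \sum_i F i = \sum_(i < r) F (ini i) + F ord_max.
Proof. by rewrite big_ord_recr. Qed.

Lemma ini_neq_max r (i : 'I_r) : (ini i == ord_max) = false.
Proof. by rewrite ini_lift eq_sym (negbTE (neq_lift _ _)). Qed.

Lemma pos_definite_posdef r (Psi : 'M[R]_r) : pos_definite Psi -> posdef Psi.
Proof.
elim: r Psi => [//|r IH] Psi [sP pP].
have sPE i j : Psi i j = Psi j i by rewrite -{1}sP mxE.
have Pm : 0 < Psi ord_max ord_max.
  have := pP (delta_mx 0 ord_max); rewrite quad_formE big_iniE big1 ?add0r.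
    rewrite big_iniE big1 ?add0r => [|i _]; last first.
      by rewrite !mxE ini_neq_max andbF mulr0 mul0r.
    rewrite !mxE !eqxx !mul1r; apply; apply/eqP => /matrixP/(_ 0 ord_max).
    by rewrite !mxE !eqxx => /eqP; rewrite oner_eq0.
  move=> i _; rewrite big1// => j _.
  by rewrite !mxE ini_neq_max andbF !mul0r.
split => //; apply: IH; split.
  by apply/matrixP => i j; rewrite !mxE sPE; congr (_ - _ / _); rewrite mulrC.
move=> y y0; set m := Psi ord_max ord_max in Pm *.
pose s := \sum_i y 0 i * Psi (ini i) ord_max.
(* [t] minimizes the form in its last coordinate, so the form of [Psi] at the extension [x] is that
   of the Schur complement at [y]. *)
pose t := - s / m.
pose x : 'rV[R]_r.+1 := \row_i oapp (y 0) t (unlift ord_max i).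
have xini i : x 0 (ini i) = y 0 i by rewrite mxE ini_lift liftK.
have xmax : x 0 ord_max = t by rewrite mxE unlift_none.
have x0 : x != 0.
  apply: contraNneq y0 => x0; apply/eqP/rowP => i; rewrite -xini x0 !mxE//.
have := pP x x0; rewrite !quad_formE big_iniE.
under eq_bigr do rewrite big_iniE xini xmax.
rewrite big_split/= (big_iniE (fun j => _ * x 0 j * _)) xmax.
have -> : \sum_(i < r) y 0 i * t * Psi (ini i) ord_max = t * s.
  by rewrite {1}/s mulr_sumr; apply: eq_bigr => i _; ring.
have -> : \sum_(i < r) t * x 0 (ini i) * Psi ord_max (ini i) = t * s.
  by rewrite {1}/s mulr_sumr; apply: eq_bigr => i _; rewrite xini sPE; ring.
have -> : \sum_(i < r) \sum_(j < r) y 0 i * y 0 j * schur Psi i j =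
    \sum_(i < r) \sum_(j < r) y 0 i * x 0 (ini j) * Psi (ini i) (ini j) - s * s / m.
  have -> : s * s / m = \sum_(i < r) \sum_(j < r)
      y 0 i * Psi (ini i) ord_max * (y 0 j * Psi (ini j) ord_max) / m.
    rewrite /s mulr_suml mulr_suml; apply: eq_bigr => i _.
    by rewrite mulr_sumr mulr_suml.
  rewrite -sumrB; apply: eq_bigr => i _; rewrite -sumrB; apply: eq_bigr => j _.
  by rewrite xini mxE -/m; ring.
have E : t * s + (t * s + t * t * m) = - (s * s / m).
  by rewrite /t; field; rewrite gt_eqF.
by rewrite -addrA E.
Qed.

(** Extending [x] by the entry [- \sum_i x 0 i] at position [m ord_max] gives a nonzero vector of
    sum zero, and the form of [Gam m L] at [x] is -2 times that of [sq_mx L] at this vector. *)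
Lemma Gam_pos_definite d k (m : {ffun 'I_k.+1 -> 'I_d}) (L : 'M[R]_d) :
  increasing_idx m -> D0 (sq_mx L) -> pos_definite (Gam m L).
Proof.
move=> mI [_ sL L0 neg].
have m_inj := increasing_idx_inj mI.
have LE i j : sq_mx L i j = L i j ^+ 2 by rewrite mxE.
have sLE i j : L i j ^+ 2 = L j i ^+ 2 by rewrite -!LE -{1}sL mxE.
split; first by apply/matrixP => i j; rewrite !mxE (sLE (m (ini i)) (m (ini j))); ring.
move=> x x0.
pose s := \sum_i x 0 i.
pose z (i : 'I_k.+1) : R := oapp (x 0) (- s) (unlift ord_max i).
have zini i : z (ini i) = x 0 i by rewrite /z ini_lift liftK.
have zmax : z ord_max = - s by rewrite /z unlift_none.
pose y : 'rV[R]_d := \row_j \sum_(i | m i == j) z i.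
have ym i : y 0 (m i) = z i.
  by rewrite mxE (big_pred1 i)// => j /=; rewrite (inj_eq m_inj).
have sumy F : \sum_j y 0 j * F j = \sum_i z i * F (m i) :> R.
  rewrite [RHS](partition_big m xpredT)//=; apply: eq_bigr => j _.
  by rewrite mxE mulr_suml; apply: eq_bigr => i /eqP <-.
have y0 : y != 0.
  apply: contraNneq x0 => y0; apply/eqP/rowP => i; rewrite -zini -ym y0 !mxE//.
have ys : \sum_i y 0 i = 0.
  under eq_bigr do rewrite -[y _ _]mulr1.
  rewrite (sumy (fun=> 1)); under eq_bigr do rewrite mulr1.
  by rewrite big_iniE zmax; under eq_bigr do rewrite zini; rewrite -/s subrr.
have := neg y y0 ys; rewrite !quad_formE.
have -> : \sum_i \sum_j y 0 i * y 0 j * sq_mx L i j =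
    \sum_i \sum_j z i * z j * L (m i) (m j) ^+ 2.
  under eq_bigr => i _ do (under eq_bigr do rewrite -mulrA; rewrite -mulr_sumr sumy).
  rewrite sumy; apply: eq_bigr => i _; rewrite mulr_sumr; apply: eq_bigr => j _.
  by rewrite LE mulrA.
set Q := \sum_i _; suff -> : \sum_i \sum_j x 0 i * x 0 j * Gam m L i j = - 2 * Q.
  by rewrite mulNr oppr_gt0 pmulr_rlt0.
have Lm : L (m ord_max) (m ord_max) ^+ 2 = 0 by rewrite -LE L0.
pose l i := L (m (ini i)) (m ord_max) ^+ 2.
pose q i j := L (m (ini i)) (m (ini j)) ^+ 2.
have -> : Q = \sum_i \sum_j x 0 i * x 0 j * q i j - 2 * s * \sum_i x 0 i * l i.
  rewrite /Q big_iniE; under eq_bigr do rewrite big_iniE zini zmax.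
  rewrite big_split/= (big_iniE (fun j => _ * z j * _)) zmax Lm mulr0 addr0.
  have -> : \sum_(i < k) x 0 i * - s * L (m (ini i)) (m ord_max) ^+ 2 =
      - s * \sum_i x 0 i * l i.
    by rewrite mulr_sumr; apply: eq_bigr => i _; rewrite /l; ring.
  have -> : \sum_(i < k) - s * z (ini i) * L (m ord_max) (m (ini i)) ^+ 2 =
      - s * \sum_i x 0 i * l i.
    by rewrite mulr_sumr; apply: eq_bigr => i _; rewrite /l zini sLE; ring.
  rewrite -addrA; congr (_ + _); last by ring.
  by apply: eq_bigr => i _; apply: eq_bigr => j _; rewrite zini.
have -> : 2 * s * \sum_i x 0 i * l i =
    \sum_i \sum_j x 0 i * x 0 j * l i + \sum_i \sum_j x 0 i * x 0 j * l j.
  rewrite [X in _ = _ + X]exchange_big /= -big_split/= mulr_sumr; apply: eq_bigr => i _.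
  rewrite -big_split/=; transitivity (s * (2 * (x 0 i * l i))); first ring.
  by rewrite /s mulr_suml; apply: eq_bigr => j _; ring.
rewrite -big_split/= -sumrB mulr_sumr; apply: eq_bigr => i _.
rewrite -big_split/= -sumrB mulr_sumr; apply: eq_bigr => j _.
by rewrite mxE -/(l i) -/(l j) -/(q i j); ring.
Qed.

End PositiveDefiniteness.

(** * Joint tails of Gaussian vectors *)

Section GaussianTail.
Variable R : realType.
Local Notation T' := (measurableTypeR R).
Local Notation N01 := (@normal_prob R 0 1).
Local Notation phi := (@normal_pdf R 0 1).
Local Notation leb := (@lebesgue_measure R).

Lemma integral_expRN (a : R) :
  (\int[leb]_(z in `[a, +oo[) (expR (- z))%:E = (expR (- a))%:E)%E.
Proof.
have dF (x : R) : is_derive x 1 (fun z => - expR (- z)) (expR (- x)).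
  apply: is_derive_eq; last by rewrite mulrN1 opprK.
rewrite (@ge0_continuous_FTC2y _ _ (fun z => - expR (- z)) a 0).
- by rewrite EFinN oppeK add0e.
- by move=> x _; exact: expR_ge0.
- apply: continuous_subspaceT => x; apply: continuous_comp; first exact: opp_continuous.
  exact: continuous_expR.
- rewrite -oppr0; apply: cvgN.
  have /= := @cvgr_expR R.
  exact.
- by move=> x _; exact: @ex_derive _ _ _ _ _ _ _ (dF x).
- have cF : continuous (fun z : R => - expR (- z)).
    move=> x; apply: differentiable_continuous; apply/derivable1_diffP.
    exact: @ex_derive _ _ _ _ _ _ _ (dF x).
  exact: cvg_at_right_filter (cF a).
- by move=> x _; rewrite derive1E; exact: @derive_val _ _ _ _ _ _ _ (dF x).
Qed.

Lemma integrable_expRN (a : R) : leb.-integrable `[a, +oo[ (fun z => (expR (- z))%:E).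
Proof.
apply/integrableP; split.
  apply/measurable_EFinP; apply: measurableT_comp; first exact: measurable_expR.
  exact: oppr_measurable.
under eq_integral do rewrite gee0_abs ?lee_fin ?expR_ge0//.
by rewrite integral_expRN ltry.
Qed.

(** True for infinite [x] too: [fine] sends both infinities to 0, and the product is then infinite
    or 0. *)
Lemma fineZl (c : R) (x : \bar R) : fine (c%:E * x)%E = c * fine x.
Proof.
case: x => [r| |]; first by [].
  by rewrite mulry mulr0; case: sgrP => _; rewrite ?mul0e ?mul1e ?mulN1e.
by rewrite mulrNy mulr0; case: sgrP => _; rewrite ?mul0e ?mul1e ?mulN1e.
Qed.

Lemma gaussian_law_scale k r (A : 'M[R]_(k, r)) (c : R) (v : 'rV[R]_r) : 0 < c ->
  gaussian_law (c *: A) (upset (c *: v)) = gaussian_law A (upset v).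
Proof.
move=> c0; transitivity (std R k [set z | upset (c *: v) (z *m (c *: A))]); first by [].
transitivity (std R k [set z | upset v (z *m A)]); last by [].
have E (w : 'rV[R]_r) i : (c *: w) 0 i = c * w 0 i by rewrite mxE.
by congr (std R k _); apply/seteqP; split => z h i; have := h i;
  rewrite -scalemxAr !E ltr_pM2l.
Qed.

(** The factor [phi b] is later cancelled by [b = N * phi b]; the rest tends to [expR (- z)], the
    origin of the exponential weight in [h_fun]. *)
Lemma normal_pdf_shift (b z : R) : b != 0 ->
  phi (b + z / b) = phi b * expR (- z - z ^+ 2 / (2 * b ^+ 2)).
Proof.
move=> b0; rewrite !normal_pdf01E -mulrA -expRD; congr (_ * expR _); by field.
Qed.

Lemma normal_pdf01_gt0 (x : R) : 0 < phi x.
Proof. by rewrite normal_pdf01E mulr_gt0 ?expR_gt0// invr_gt0 sqrtr_gt0 pmulrn_lgt0// pi_gt0. Qed.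

Lemma Rintegral_normal_affine (G : T' -> R) (b : R) : measurable_fun setT G ->
  (forall s, 0 <= G s <= 1) -> 0 < b ->
  \int[N01]_s G s = b^-1 * fine (\int[leb]_z (G (b + z / b)%R * phi (b + z / b)%R)%:E)%E.
Proof.
move=> mG G01 b0.
have G0 s : 0 <= G s by have /andP[] := G01 s.
have Gi : N01.-integrable setT (EFin \o G).
  apply: (@bounded_integrable _ _ _ _ _ 1) => // s.
  by have /andP[g0 g1] := G01 s; rewrite ger0_norm.
rewrite /Rintegral integral_normal_prob ?oner_neq0//.
have -> : (\int[leb]_s ((EFin \o G) s * (phi s)%:E) = \int[leb]_s (G s * phi s)%:E)%E.
  by apply: eq_integral => s _; rewrite EFinM.
rewrite (@ge0_integral_affine R b^-1 b); last 3 first.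
- by rewrite invr_eq0 gt_eqF.
- by apply/measurable_EFinP; apply: measurable_funM => //; exact: measurable_normal_pdf.
- by move=> s; rewrite lee_fin mulr_ge0// normal_pdf_ge0.
have -> : `|b^-1| = b^-1 by rewrite ger0_norm// invr_ge0 ltW.
rewrite (fineZl b^-1); congr (_ * fine _); apply: eq_integral => z _.
by have -> : affine b^-1 b z = b + z / b by rewrite /affine addrC mulrC.
Qed.

(** Exact for each [b]: the last coordinate is written [b + z / b], and the conditional law is
    magnified by [b], hence the covariance [b ^+ 2 *: schur Psi]. The weight is
    [N * phi (b + z / b) / b], simplified by [b = N * phi b]. *)
Lemma gaussian_tail_formula k r (A : 'M[R]_(k, r.+1)) (Psi : 'M[R]_r.+1) (b N : R) :
  A^T *m A = Psi -> Psi ord_max ord_max = 1 -> 0 < b -> b = N * phi b ->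
  exists k' (A' : 'M[R]_(k', r)), A'^T *m A' = b ^+ 2 *: schur Psi /\
    forall x : 'rV[R]_r.+1,
    N * fine (gaussian_law A (upset (\row_i (b + x 0 i / b)))) =
    \int[leb]_(z in `[x 0 ord_max, +oo[) ((x 0 ord_max < z)%R%:R *
      fine (gaussian_law A' (upset (\row_i (x 0 (ini i) + b ^+ 2 * (1 - Psi (ini i) ord_max)
        - Psi (ini i) ord_max * z)))) *
      expR (- z - z ^+ 2 / (2 * b ^+ 2))).
Proof.
move=> AP Pm b0 bN; have bn0 : b != 0 by rewrite gt_eqF.
have N0 : 0 <= N / b.
  have -> : N = b / phi b by rewrite {1}bN mulfK// gt_eqF// normal_pdf01_gt0.
  by rewrite divr_ge0 ?divr_ge0// ltW// normal_pdf01_gt0.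
have [|k' [A' [AA' H]]] := gaussian_conditioning AP; first by rewrite Pm.
exists k', (b *: A'); split.
  apply/matrixP => i j; rewrite -AA' !mxE mulr_sumr; apply: eq_bigr => l _.
  by rewrite !mxE; ring.
move=> x; rewrite H; set x0 := x 0 ord_max.
set u := \row_i (b + _).
pose g s := fine (gaussian_law A' (upset (residual u Psi s))).
pose G s := (u 0 ord_max < Num.sqrt (Psi ord_max ord_max) * s)%R%:R * g s.
have mg : measurable_fun setT (g : T' -> R).
  apply: measurableT_comp => //.
  have := measurable_gaussian_upset A' (\row_i u 0 (ini i))
    (\row_i (Psi (ini i) ord_max / Num.sqrt (Psi ord_max ord_max))).
  congr (measurable_fun _ _); apply/funext => s; congr (gaussian_law _ (upset _)).
  by apply/rowP => i; rewrite !mxE.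
have g01 s : 0 <= g s <= 1.
  exact: probability_fine01 (measurable_upset _).
have mG : measurable_fun setT (G : T' -> R).
  apply: measurable_funM => //.
  by apply: measurable_indic_lt => //; exact: measurable_funM.
have G01 s : 0 <= G s <= 1.
  by rewrite /G; case: (_ < _); rewrite ?mul1r ?mul0r ?lexx ?ler01.
have Gint := Rintegral_normal_affine mG G01 b0.
transitivity (N / b * fine (\int[leb]_z (G (b + z / b) * phi (b + z / b))%:E)%E).
  by rewrite -mulrA -Gint.
rewrite -(fineZl (N / b)) -(@ge0_integralZl_EFin _ _ _ leb)//; last 2 first.
- move=> z _; rewrite lee_fin mulr_ge0// ?normal_pdf_ge0//.
  by have /andP[] := G01 (b + z / b).
- apply/measurable_EFinP.
  have := measurableT_comp (measurable_funM mG (@measurable_normal_pdf R 0 1)) (measurable_affine b^-1 b).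
  congr (measurable_fun _ _); apply/funext => z /=.
  by have -> : affine b^-1 b z = b + z / b by rewrite /affine addrC mulrC.
rewrite Rintegral_mkcond; congr fine; apply: eq_integral => z _; rewrite -EFinM; congr EFin.
rewrite normal_pdf_shift// patchE.
have uz : (u 0 ord_max < Num.sqrt (Psi ord_max ord_max) * (b + z / b)) = (x0 < z).
  by rewrite mxE Pm sqrtr1 mul1r ltrD2l ltr_pM2r// invr_gt0.
have gz : g (b + z / b) = fine (gaussian_law (b *: A') (upset
    (\row_i (x 0 (ini i) + b ^+ 2 * (1 - Psi (ini i) ord_max) - Psi (ini i) ord_max * z)))).
  rewrite /g -(gaussian_law_scale A' (residual u Psi (b + z / b)) b0).
  congr (fine (gaussian_law _ (upset _))); apply/rowP => i.
  by rewrite !mxE Pm sqrtr1 divr1; field.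
rewrite /G uz gz -/x0; case: ifPn => [_|].
  set F := fine _; transitivity ((x0 < z)%R%:R * F * expR (- z - z ^+ 2 / (2 * b ^+ 2)) *
    (N * phi b / b)); first by ring.
  by rewrite -bN divff// mulr1.
by rewrite notin_setE/= in_itv/= andbT => /negP; rewrite -ltNge => zx; rewrite ltNge ltW// !mul0r mulr0.
Qed.

(** Limit of [b ^+ 2 *: schur Psi] when the diagonal of [Psi] is 1, [b] tends to infinity and
    [b ^+ 2 * (1 - Psi i j)] tends to [2 * l i j]; when [l] consists of squared entries it is
    [Gam]. *)
Definition tail_cov r (l : 'I_r.+1 -> 'I_r.+1 -> R) : 'M[R]_r :=
  \matrix_(i, j) (2 * (l (ini i) ord_max + l (ini j) ord_max - l (ini i) (ini j))).

(** Dominated convergence in the exact formula, with [expR (- z)] as dominating function. [N] and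
    [b] are free sequences, not tied to a row index, because the lemma is applied along extracted
    sequences of rows. *)
Lemma gaussian_tail_cvg r (k : nat -> nat) (A : forall n, 'M[R]_(k n, r.+1))
    (N b : nat -> R) (l : 'I_r.+1 -> 'I_r.+1 -> R) (x : 'rV[R]_r.+1) :
  posdef (tail_cov l) ->
  (forall n, ((A n)^T *m A n) ord_max ord_max = 1) ->
  (forall n, 0 < b n) -> (forall n, b n = N n * phi (b n)) ->
  b @ \oo --> +oo ->
  (forall i j, (fun n => b n ^+ 2 * (1 - ((A n)^T *m A n) i j)) @ \oo --> 2 * l i j) ->
  (fun n => N n * fine (gaussian_law (A n) (upset (\row_i (b n + x 0 i / b n))))) @ \oo -->
  \int[leb]_(z in `[x 0 ord_max, +oo[)
    (surv (\row_i (x 0 (ini i) - z + 2 * l (ini i) ord_max)) (tail_cov l) * expR (- z)).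
Proof.
move=> pG A1 b0 bN boo cA.
set x0 := x 0 ord_max.
have cvg_to_eq (u : nat -> R) (a a' : R) : u @ \oo --> a -> a = a' -> u @ \oo --> a'.
  by move=> h <-.
pose Psi n := (A n)^T *m A n.
have q_ n : exists q : {k' & 'M[R]_(k', r)}, 
    (projT2 q)^T *m projT2 q = b n ^+ 2 *: schur (Psi n) /\
    forall x : 'rV[R]_r.+1,
    N n * fine (gaussian_law (A n) (upset (\row_i (b n + x 0 i / b n)))) =
    \int[leb]_(z in `[x 0 ord_max, +oo[) ((x 0 ord_max < z)%R%:R *
      fine (gaussian_law (projT2 q) (upset (\row_i (x 0 (ini i) +
        b n ^+ 2 * (1 - Psi n (ini i) ord_max) - Psi n (ini i) ord_max * z)))) *
      expR (- z - z ^+ 2 / (2 * b n ^+ 2))).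
  have [k' [A' h]] := gaussian_tail_formula (erefl (Psi n)) (A1 n) (b0 n) (bN n).
  by exists (@existT nat (fun k' => 'M[R]_(k', r)) k' A').
pose q n := projT1 (cid (q_ n)).
have qc n : (projT2 (q n))^T *m projT2 (q n) = b n ^+ 2 *: schur (Psi n) := (projT2 (cid (q_ n))).1.
have qf n := (projT2 (cid (q_ n))).2 x.
under eq_fun do rewrite qf -/(q _) -/x0.
have binv : (fun n => (b n)^-1) @ \oo --> (0 : R).
  by apply/gtr0_cvgV0 => //; exact: nearW.
pose c n i j := b n ^+ 2 * (1 - Psi n i j).
have cc i j : (fun n => c n i j) @ \oo --> 2 * l i j by exact: cA.
have PsiE n i j : Psi n i j = 1 - c n i j * ((b n)^-1 * (b n)^-1).
  by rewrite /c; field; rewrite gt_eqF.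
have cPsi i j : (fun n => Psi n i j) @ \oo --> (1 : R).
  under eq_fun do rewrite PsiE.
  have h : (fun n => 1 - c n i j * ((b n)^-1 * (b n)^-1)) @ \oo --> 1 - 2 * l i j * (0 * 0).
    by apply: cvgB; [exact: cvg_cst|apply: cvgM => //; exact: cvgM].
  by apply: cvg_to_eq h _; rewrite mul0r mulr0 subr0.
pose y n z : 'rV[R]_r := \row_i (x 0 (ini i) + b n ^+ 2 * (1 - Psi n (ini i) ord_max)
  - Psi n (ini i) ord_max * z).
pose g n z := fine (gaussian_law (projT2 (q n)) (upset (y n z))).
pose S z := surv (\row_i (x 0 (ini i) - z + 2 * l (ini i) ord_max)) (tail_cov l).
have cg z : (fun n => g n z) @ \oo --> S z.
  apply: gaussian_surv_cvg => // [i j|i].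
    under eq_fun do rewrite qc.
    (* Inserting [Psi = 1 - c / b^2] in the Schur complement leaves a linear combination of the [c]
       and a remainder of order [1 / b^2]. *)
    have -> : (fun n => (b n ^+ 2 *: schur (Psi n)) i j) = (fun n => c n (ini i) ord_max +
        c n (ini j) ord_max - c n (ini i) (ini j) -
        c n (ini i) ord_max * c n (ini j) ord_max * ((b n)^-1 * (b n)^-1)).
      apply/funext => n; have PsiM : Psi n ord_max ord_max = 1 by exact: A1.
      rewrite 2!mxE PsiM /c.
      by field; rewrite gt_eqF.
    rewrite mxE.
    have -> : 2 * (l (ini i) ord_max + l (ini j) ord_max - l (ini i) (ini j)) =
      2 * l (ini i) ord_max + 2 * l (ini j) ord_max - 2 * l (ini i) (ini j) -
      2 * l (ini i) ord_max * (2 * l (ini j) ord_max) * (0 * 0) by ring.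
    by apply: cvgB; [apply: cvgB => //; exact: cvgD|apply: cvgM; exact: cvgM].
  under eq_fun do rewrite mxE.
  rewrite mxE.
  have -> : x 0 (ini i) - z + 2 * l (ini i) ord_max = x 0 (ini i) + 2 * l (ini i) ord_max - 1 * z.
    by ring.
  apply: cvgB; first by apply: cvgD; [exact: cvg_cst|exact: cc].
  by apply: cvgM; [exact: cPsi|exact: cvg_cst].
have mg n : measurable_fun setT (g n : T' -> R).
  apply: measurableT_comp => //.
  have := measurable_gaussian_upset (projT2 (q n))
    (\row_i (x 0 (ini i) + b n ^+ 2 * (1 - Psi n (ini i) ord_max)))
    (\row_i Psi n (ini i) ord_max).
  congr (measurable_fun _ _); apply/funext => s; congr (gaussian_law _ (upset _)).
  by apply/rowP => i; rewrite !mxE.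
have mS : measurable_fun setT (S : T' -> R).
  by apply: (measurable_fun_cvg mg) => z _; exact: cg.
have mE : measurable_fun setT (fun z : T' => expR (- z)).
  by apply: measurableT_comp; [exact: measurable_expR|exact: oppr_measurable].
pose f_ n z := (x0 < z)%R%:R * g n z * expR (- z - z ^+ 2 / (2 * b n ^+ 2)).
pose f z := S z * expR (- z).
have mI : measurable (`[x0, +oo[%classic : set T') by exact: measurable_itv.
suff : \int[leb]_(z in `[x0, +oo[) f_ n z @[n --> \oo] --> \int[leb]_(z in `[x0, +oo[) f z.
  by apply.
apply: (@Rintegral_dominated_cvg R _ _ leb _ mI f_ f (fun z => expR (- z))).
- move=> n; apply: measurable_funTS; apply: measurable_funM.
    apply: measurable_funM; last exact: mg.
    exact: measurable_indic_lt.
  apply: measurableT_comp; first exact: measurable_expR.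
  apply: measurable_funB; first exact: oppr_measurable.
  by apply: measurable_funM => //; exact: measurable_funX.
- by apply: measurable_funTS; exact: measurable_funM.
- exact: integrable_expRN.
(* The strict indicator and the closed half-line disagree at the endpoint only. *)
- exists [set x0]; split; [exact: measurable_set1|exact: lebesgue_measure_set1|].
  move=> z /= nz; apply: contrapT => zx; apply: nz => /=; rewrite in_itv/= andbT => xz.
  have zx0 : x0 < z by rewrite lt_neqAle xz andbT eq_sym; apply/eqP.
  rewrite /f_ /f; under eq_fun do rewrite zx0 mul1r.
  apply: cvgM; first exact: cg.
  apply: continuous_cvg; first exact: continuous_expR.
  have -> : - z = - z - z ^+ 2 / 2 * (0 * 0) by rewrite mul0r mulr0 subr0.
  apply: cvgB; first by rewrite mul0r mulr0 subr0; exact: cvg_cst.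
  have -> : (fun n => z ^+ 2 / (2 * b n ^+ 2)) = (fun n => z ^+ 2 / 2 * ((b n)^-1 * (b n)^-1)).
    by apply/funext => n; field; rewrite gt_eqF.
  by apply: cvgM; [exact: cvg_cst|exact: cvgM].
- move=> n z _; rewrite /f_ normrM (ger0_norm (expR_ge0 _)).
  have gn : `|(x0 < z)%R%:R * g n z| <= 1.
    have /andP[g0 g1] : 0 <= g n z <= 1.
      exact: probability_fine01 (measurable_upset _).
    by case: (x0 < z); rewrite ?mul0r ?mul1r ?normr0// ger0_norm.
  apply: le_trans (ler_wpM2r (expR_ge0 _) gn) _; rewrite mul1r ler_expR gerDl oppr_le0.
  by rewrite divr_ge0 ?sqr_ge0// mulr_ge0 ?sqr_ge0.
Qed.

End GaussianTail.

Section NormalizingSequence.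
Variable R : realType.
Local Notation phi := (@normal_pdf R 0 1).
Local Notation leb := (@lebesgue_measure R).

(** The separate clause of [h_fun] for [k = 0] agrees with the integral because [surv] is 1 in
    dimension 0. *)
Lemma h_funE d k (m : {ffun 'I_k.+1 -> 'I_d}) (L : 'M[R]_d) (y : 'I_k.+1 -> R) :
  pos_definite (Gam m L) ->
  h_fun m L y = \int[leb]_(z in `[y ord_max, +oo[)
    (surv (\row_i (y (ini i) - z + 2 * L (m (ini i)) (m ord_max) ^+ 2)) (Gam m L) * expR (- z)).
Proof.
move=> pG; rewrite /h_fun; case: eqP => k0.
  move: m pG y; rewrite k0 => m _ y /=.
  under eq_Rintegral do rewrite mul1r.
  by rewrite /Rintegral integral_expRN.
by apply: eq_Rintegral => z _; rewrite survivorE//; [exact: pG.1|exact: pos_definite_posdef].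
Qed.

Lemma normal_pdf_le (x y : R) : 0 <= x <= y -> phi y <= phi x.
Proof.
move=> /andP[x0 xy]; rewrite !normal_pdf01E ler_wpM2l ?invr_ge0 ?sqrtr_ge0//.
by rewrite ler_expR ler_wpM2r ?invr_ge0// lerN2 lerXn2r ?nnegrE// (le_trans x0).
Qed.

Variable b : nat -> R.
Hypothesis hb : forall n, b n = n.+1%:R * phi (b n).

Lemma normalizing_gt0 n : 0 < b n.
Proof. by rewrite hb mulr_gt0// normal_pdf01_gt0. Qed.

(** If [b n] were below [M'], monotonicity of the density would give [b n >= n.+1%:R * phi M'],
    which exceeds [M'] for large [n]. *)
Lemma cvg_normalizing : b @ \oo --> +oo.
Proof.
apply/cvgryPge => M.
pose M' := Num.max M 1.
have M'0 : 0 < M' by rewrite lt_max ltr01 orbT.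
near=> n; apply: (@le_trans _ _ M'); first by rewrite le_max lexx.
rewrite leNgt; apply/negP => bM.
have : n.+1%:R * phi M' <= b n.
  rewrite [leRHS]hb ler_wpM2l//; apply: normal_pdf_le.
  by rewrite ltW ?normalizing_gt0//= ltW.
apply/negP; rewrite -ltNge (lt_le_trans bM)// -ler_pdivrMr ?normal_pdf01_gt0//.
apply: (@le_trans _ _ n%:R); last by rewrite ler_nat.
by near: n; exact: nbhs_infty_ger.
Unshelve. all: by end_near. Qed.

End NormalizingSequence.

(** * Covariances of Gaussian vectors *)

Section NormalMoments.
Variable R : realType.
Local Notation T' := (measurableTypeR R).
Local Notation N01 := (@normal_prob R 0 1).
Local Notation phi := (@normal_pdf R 0 1).
Local Notation leb := (@lebesgue_measure R).

(** As [x^2 / 4 <= exp (x^2 / 4)], the function [x^2 * phi x] is at most a constant times the normal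
    density of variance 2, whence [s = Num.sqrt 2]. The square is first truncated at [n], since
    passing to Lebesgue measure asks for integrability. *)
Lemma normal_second_moment_lty : (\int[N01]_x (x ^+ 2)%:E < +oo)%E.
Proof.
pose s : R := Num.sqrt 2.
have s0 : s != 0 by rewrite gt_eqF// sqrtr_gt0.
have s2 : s ^+ 2 = 2 by rewrite sqr_sqrtr.
pose c : R := (Num.sqrt (pi *+ 2))^-1.
have c0 : 0 <= c by rewrite invr_ge0 sqrtr_ge0.
pose p := normal_peak s.
have p0 : 0 < p by exact: normal_peak_gt0.
have bd (x : R) : x ^+ 2 * phi x <= 4 * c / p * normal_pdf 0 s x.
  rewrite normal_pdf01E normal_pdfE// -/p -/c /normal_fun s2 subr0.
  have -> : - x ^+ 2 / (2 *+ 2) = - (x ^+ 2 / 4) :> R by field.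
  have -> : - x ^+ 2 / 2 = - (x ^+ 2 / 4) - (x ^+ 2 / 4) :> R by field.
  rewrite expRD; set e := expR _; have e0 : 0 < e by exact: expR_gt0.
  have -> : 4 * c / p * (p * e) = c * e * 4 by field; rewrite gt_eqF.
  have -> : x ^+ 2 * (c * (e * e)) = c * e * (x ^+ 2 * e) by ring.
  apply: ler_wpM2l; first by rewrite mulr_ge0// ltW.
  rewrite /e expRN ler_pdivrMr ?expR_gt0// -ler_pdivrMl// mulrC.
  by apply: le_trans (expR_ge1Dx _); rewrite lerDr.
have f_i n : N01.-integrable setT (fun x : T' => (Num.min (x ^+ 2) n%:R)%:E).
  apply: (@bounded_integrable _ _ _ _ _ n%:R) => [|x].
    by apply: measurable_minr => //; exact: measurable_funX.
  by rewrite ger0_norm ?ge_min ?lexx ?orbT// le_min sqr_ge0/=.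
have fb n : (\int[N01]_x (Num.min (x ^+ 2) n%:R)%:E <= (4 * c / p)%:E)%E.
  rewrite integral_normal_prob ?oner_neq0//.
  apply: (@le_trans _ _ (\int[leb]_x ((4 * c / p)%:E * (normal_pdf 0 s x)%:E)))%E.
    apply: ge0_le_integral => //.
    - by move=> x _; rewrite -EFinM lee_fin mulr_ge0 ?normal_pdf_ge0// le_min sqr_ge0/=.
    - apply/measurable_EFinP; apply: measurable_funM; last exact: measurable_normal_pdf.
      by apply: measurable_minr => //; exact: measurable_funX.
    - apply/measurable_EFinP; apply: measurable_funM; last exact: measurable_normal_pdf.
      exact: measurable_cst.
    - move=> x _; rewrite -!EFinM lee_fin; apply: le_trans (bd x).
      by apply: ler_wpM2r; [exact: normal_pdf_ge0|rewrite ge_min lexx].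
  rewrite ge0_integralZl_EFin//.
  - by rewrite integral_normal_pdf// mule1.
  - by move=> x _; rewrite lee_fin normal_pdf_ge0.
  - by apply/measurable_EFinP; exact: measurable_normal_pdf.
  - by rewrite divr_ge0 ?mulr_ge0// ltW.
have cv := @cvg_monotone_convergence _ _ _ N01 setT measurableT
  (fun n (x : T') => (Num.min (x ^+ 2) n%:R)%:E).
have limE (x : R) : limn (fun n => (Num.min (x ^+ 2) n%:R)%:E) = (x ^+ 2)%:E.
  apply: cvg_lim => //; apply: cvg_EFin; first exact: nearW.
  apply: cvg_near_cst; near=> n; apply/min_idPl.
  by near: n; exact: nbhs_infty_ger.
have := cv (fun n => measurable_int _ (f_i n)).
move=> /(_ _ _)/wrap[].
- by move=> n x _; rewrite lee_fin le_min sqr_ge0/=.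
- move=> x _ m n mn; rewrite lee_fin le_min !ge_min lexx/=.
  by rewrite ler_nat mn orbT.
under [X in _ --> X -> _]eq_integral do rewrite limE.
move=> h; apply: (@le_lt_trans _ _ (4 * c / p)%:E); last exact: ltry.
rewrite -(cvg_lim _ h)//; apply: lime_le; first by apply: cvgP h.
by apply: nearW => n; exact: fb.
Unshelve. all: by end_near. Qed.

End NormalMoments.

Section SameLaw.
Variables (R : realType) (d d' : measure_display) (T : measurableType d) (T1 : measurableType d').
Variables (P : probability T R) (Q : probability T1 R).
Local Notation T' := (measurableTypeR R).
Variables (Y : {mfun T >-> T'}) (W : {mfun T1 >-> T'}).
Hypothesis YW : forall B : set T', measurable B -> P (Y @^-1` B) = Q (W @^-1` B).

Lemma ge0_integral_same_law (f : T' -> \bar R) : measurable_fun setT f ->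
  (forall y, 0 <= f y)%E -> (\int[P]_w f (Y w) = \int[Q]_w f (W w))%E.
Proof.
move=> mf f0; transitivity (\int[distribution P Y]_y f y)%E.
  by rewrite ge0_integral_distribution.
transitivity (\int[distribution Q W]_y f y)%E; last by rewrite ge0_integral_distribution.
by apply: eq_measure_integral => A mA _; exact: YW.
Qed.

Lemma integral_same_law (f : T' -> \bar R) : measurable_fun setT f ->
  (\int[P]_w f (Y w) = \int[Q]_w f (W w))%E.
Proof.
move=> mf; rewrite [LHS]integralE [RHS]integralE; congr (_ - _)%E.
  rewrite [(fun x => f (Y x))^\+%E](funepos_comp f Y) [(fun x => f (W x))^\+%E](funepos_comp f W).
  by have := ge0_integral_same_law (measurable_funepos mf) (fun y => funepos_ge0 f y).
rewrite [(fun x => f (Y x))^\-%E](funeneg_comp f Y) [(fun x => f (W x))^\-%E](funeneg_comp f W).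
by have := ge0_integral_same_law (measurable_funeneg mf) (fun y => funeneg_ge0 f y).
Qed.

Lemma expectation_same_law : ('E_P[Y] = 'E_Q[W])%E.
Proof. by rewrite unlock; apply: (integral_same_law (f := EFin)); exact/measurable_EFinP. Qed.

Lemma variance_same_law : ('V_P[Y] = 'V_Q[W])%E.
Proof.
rewrite /variance covariance.unlock expectation_same_law; set m := fine _.
rewrite expectation.unlock.
apply: (integral_same_law (f := fun y => ((y - m) * (y - m))%:E)).
by apply/measurable_EFinP; apply: measurable_funM; apply: measurable_funB.
Qed.

Lemma Lfun2_same_law : (W : T1 -> R) \in Lfun Q 2%:E -> (Y : T -> R) \in Lfun P 2%:E.
Proof.
rewrite inE => /andP[_]; rewrite inE/= => Wf.
rewrite inE; apply/andP; split.
  by rewrite inE; exact: (@measurable_funP _ _ T T' setT Y).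
rewrite inE/= /finite_norm; apply: le_lt_trans Wf; rewrite unlock/=.
rewrite (integral_same_law (f := fun y => (`|y%:E| `^ 2)%E))//.
have h : measurable_fun setT (fun y : T' => (`|y| `^ 2)%R).
  apply: (@measurableT_comp _ _ _ _ _ _ (fun x : R => x `^ 2)%R) => //.
exact/measurable_EFinP.
Qed.

End SameLaw.

Section NormalVariance.
Variable R : realType.
Local Notation T' := (measurableTypeR R).
Local Notation N01 := (@normal_prob R 0 1).

Definition idR : T' -> T' := fun x => x.

HB.instance Definition _ := @isMeasurableFun.Build _ _ T' T' idR (@measurable_id _ _ setT).

Lemma idR_Lfun2 : (idR : T' -> R) \in Lfun N01 2%:E.
Proof.
rewrite inE; apply/andP; split.
  by rewrite inE; exact: (@measurable_funP _ _ T' T' setT idR).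
rewrite inE/= /finite_norm unlock/= poweR_lty//.
apply: le_lt_trans (normal_second_moment_lty R).
rewrite le_eqVlt; apply/orP; left; apply/eqP.
apply: eq_integral => x _.
by rewrite /= powR_mulrn// -normrX ger0_norm ?sqr_ge0.
Qed.

(* Its value, 1, is never needed: it cancels in correlations. *)
Definition std_variance : R := fine ('V_N01[idR])%E.

HB.instance Definition _ (a c : R) :=
  @isMeasurableFun.Build _ _ T' T' (affine a c) (measurable_affine a c).

Lemma variance_affine a c :
  ('V_N01[(affine a c : T' -> R)] = (a ^+ 2 * std_variance)%:E)%E.
Proof.
rewrite (_ : (affine a c : T' -> R) = (a \o* (idR : T' -> R)) \+ cst c).
  rewrite varianceD_cst_r ?varianceZ ?idR_Lfun2//.
    by rewrite [in RHS]EFinM /std_variance fineK// variance_fin_num// idR_Lfun2.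
  by rewrite Lfun_scale ?idR_Lfun2 ?ler1n.
by apply/funext => x; rewrite /= mulrC.
Qed.

(** The law is symmetric, so its mean equals the opposite of its mean. *)
Lemma expectation_std : ('E_N01[idR] = 0)%E.
Proof.
have h : ('E_N01[(affine (-1) 0 : T' -> R)] = 'E_N01[idR])%E.
  by apply: expectation_same_law => B mB; exact: normal_probN.
have idL1 : (idR : T' -> R) \in Lfun N01 1.
  by apply: Lfun_subset12; [exact: fin_num_measure|exact: idR_Lfun2].
have fE : ('E_N01[idR])%E \is a fin_num by exact: expectation_fin_num.
move: h; rewrite (_ : (affine (-1) 0 : T' -> R) = (-1) \o* (idR : T' -> R)); last first.
  by apply/funext => x; rewrite /= /affine addr0 mulrC.
rewrite expectationZl// -(fineK fE) -EFinM => -[] h.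
by congr EFin; lra.
Qed.

Lemma expectation_affine a c : ('E_N01[(affine a c : T' -> R)] = c%:E)%E.
Proof.
have idL1 : (idR : T' -> R) \in Lfun N01 1.
  by apply: Lfun_subset12; [exact: fin_num_measure|exact: idR_Lfun2].
rewrite (_ : (affine a c : T' -> R) = (a \o* (idR : T' -> R)) \+ cst c).
  rewrite expectationD ?Lfun_cst// ?Lfun_scale//.
  by rewrite expectationZl// expectation_std mule0 add0e expectation_cst.
by apply/funext => x; rewrite /= mulrC.
Qed.

(** Zero variance would concentrate the law at 0, a point of measure zero. *)
Lemma std_variance_gt0 : 0 < std_variance.
Proof.
rewrite lt_neqAle fine_ge0 ?variance_ge0// andbT eq_sym; apply/eqP => v0.
have /eqP : ('V_N01[idR] = 0)%E.
  by rewrite -(fineK (variance_fin_num idR_Lfun2)) -/std_variance v0.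
rewrite /variance covariance.unlock expectation_std expectation.unlock => /eqP h.
have mf : measurable_fun setT (fun x : T' => (x ^+ 2)%:E).
  by apply/measurable_EFinP; exact: measurable_funX.
have : (\int[N01]_x `|(x ^+ 2)%:E| = 0)%E.
  rewrite -[RHS]h; apply: eq_integral => x _.
  rewrite gee0_abs ?lee_fin ?sqr_ge0//; congr EFin.
  by transitivity ((x - 0) * (x - 0)); [rewrite subr0 expr2|].
move/(ae_eq_integral_abs N01 measurableT mf) => h0.
have : N01 (~` [set 0]) = 0%E.
  case: h0 => N [mN N0 sN]; apply: (subset_measure0 _ _ _ N0) => //.
  - exact: measurableC.
  - move=> x /= x0; apply: sN => /= /(_ I) [] /eqP; rewrite sqrf_eq0 => /eqP; exact: x0.
have E1 := probability_setC N01 (measurable_set1 (0 : T')).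
have E2 := etrans E1 (congr1 (fun t => 1 - t)%E (normal_prob_set1 0)).
by move/(etrans (esym E2))/eqP; rewrite sube0 onee_eq0.
Qed.

End NormalVariance.

Section StandardGaussianVector.
Variable R : realType.
Local Notation T' := (measurableTypeR R).
Local Notation N01 := (@normal_prob R 0 1).

Lemma measurable_entry (B : set T') : measurable B ->
  measurable [set y : 'rV[R]_1 | B (y 0 0)].
Proof.
move=> mB; rewrite -[X in measurable X]setTI.
exact: (@measurable_coord R 1 1 0 0 measurableT B mB).
Qed.

(** With a single column, a triangular factor vanishes outside its first row, so the law is that of
    [c] times a standard normal variable; the sign of [c] is left open. *)
Lemma gaussian_law_univariate k (w : 'M[R]_(k, 1)) : exists c : R,
  c ^+ 2 = (w^T *m w) 0 0 /\
  forall B : set T', measurable B ->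
    gaussian_law w [set y | B (y 0 0)] = N01 (affine c 0 @^-1` B).
Proof.
have dirac0 k' (A : 'M[R]_(k', 1)) (p : 'rV[R]_1) (B : set T') : A = 0 ->
    std R k' [set z | B ((p + z *m A) 0 0)] = (\1_B (p 0 0))%:E.
  move=> ->; rewrite indicE; have [pB|pB] := pselect (B (p 0 0)).
    rewrite mem_set// (_ : mkset _ = setT) ?probability_setT//.
    by apply/seteqP; split => // z _ /=; rewrite mulmx0 addr0.
  rewrite memNset// (_ : mkset _ = set0) ?measure0//.
  by apply/seteqP; split => // z /=; rewrite mulmx0 addr0.
have indE (c : R) (B : set T') : measurable B ->
    (\int[N01]_x (\1_B (c * x))%:E = N01 (affine c 0 @^-1` B))%E.
  move=> mB; rewrite (_ : (fun x => _) = (fun x : T' => (\1_(affine c 0 @^-1` B) x)%:E)).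
    rewrite integral_indic// ?setIT//; rewrite -[X in measurable X]setTI; exact: measurable_affine.
  by apply/funext => x; rewrite !indicE /affine; congr (_%:R%:E); congr nat_of_bool;
    apply/idP/idP; rewrite !inE/= addr0.
case: k w => [|k] w.
  exists 0; split; first by rewrite mxE big_ord0 expr0n.
  move=> B mB; rewrite -indE//; under eq_integral do rewrite mul0r.
  rewrite integral_cst//= probability_setT mule1.
  have := dirac0 0%N w 0 B (flatmx0 _); rewrite mxE => <-.
  transitivity (std R 0 [set z | B ((z *m w) 0 0)]); first by [].
  by congr (std R _ _); apply/seteqP; split => z /=; rewrite add0r.
have [p [A0 [[wE wl] A0z]]] := same_gaussian_triangular (w : 'M[R]_(1 + k, 1)) 0.
have A00 : A0 = 0 by apply/matrixP => i j; rewrite (ord1 j) A0z mxE.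
exists (p 0 0); split.
  rewrite wE tr_col_mx mul_row_col A00 mulmx0 addr0 mxE big_ord1 mxE expr2//.
move=> B mB; rewrite wl; last exact: measurable_entry.
rewrite gaussian_law_col; last exact: measurable_entry.
rewrite -indE//; apply: eq_integral => x _.
transitivity (std R k [set z | B ((x *: p + z *m A0) 0 0)]); first by [].
by rewrite dirac0// mxE mulrC.
Qed.

Variables (d : measure_display) (T : measurableType d) (P : probability T R) (r : nat).
Variable X : {mfun T >-> 'rV[R]_r}.

Lemma gaussian_linear_form (a : 'rV[R]_r) k (A : 'M[R]_(k, r)) :
  (forall B, measurable B -> P (X @^-1` B) = gaussian_law A (shift_set a B)) ->
  forall q : 'cV[R]_r, exists c : R, c ^+ 2 = ((A *m q)^T *m (A *m q)) 0 0 /\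
    forall B : set T', measurable B -> P [set w | B ((X w *m q) 0 0)] =
      N01 (affine c ((a *m q) 0 0) @^-1` B).
Proof.
move=> XA q; have [c [cE H]] := gaussian_law_univariate (A *m q).
exists c; split => // B mB.
have mq : measurable [set y : 'rV[R]_r | B ((y *m q) 0 0)].
  have := @measurable_mulmxr R r 1 q measurableT _ (measurable_entry mB).
  by rewrite setTI.
transitivity (P (X @^-1` [set y | B ((y *m q) 0 0)])); first by [].
rewrite XA//; set e := (a *m q) 0 0.
have mB' : measurable (affine 1 e @^-1` B).
  by rewrite -[X in measurable X]setTI; exact: measurable_affine.
transitivity (gaussian_law (A *m q) [set y | (affine 1 e @^-1` B) (y 0 0)]).
  transitivity (std R k [set z | B (((a + z *m A) *m q) 0 0)]); first by [].
  transitivity (std R k [set z | B (affine 1 e ((z *m (A *m q)) 0 0))]); last by [].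
  have E z : ((a + z *m A) *m q) 0 0 = affine 1 e ((z *m (A *m q)) 0 0).
    by rewrite mulmxDl mulmxA /affine mul1r [LHS]mxE addrC.
  by congr (std R k _); apply/seteqP; split => z /=; rewrite E.
rewrite H//; congr (N01 _); apply/seteqP; split => z /=;
by rewrite /affine mul1r addr0.
Qed.

Hypothesis gX : gaussian_vector P X.
Hypothesis sX : std_normal_coords P X.

(** Linear forms of the vector are affine images of a standard normal variable in law. Comparing
    means forces [a = 0], comparing variances gives the unit diagonal, and the form [e_ j + e_ l]
    gives the covariances by polarization; the factor [std_variance R] cancels throughout. *)
Lemma gaussian_vector_std : exists k (A : 'M[R]_(k, r)),
  [/\ A^T *m A = correlation_mx P X, forall j, correlation_mx P X j j = 1 &
    forall B, measurable B -> P (X @^-1` B) = gaussian_law A B].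
Proof.
have [a [Psi [k [g [A [hg AP XE]]]]]] := gX.
have XA B : measurable B -> P (X @^-1` B) = gaussian_law A (shift_set a B).
  move=> mB; transitivity (distribution P X B); first by [].
  rewrite XE// (std_normal_law_unique hg)//.
  have m1 : measurable [set y : 'rV[R]_r | B (a + y)].
    by rewrite -[X in measurable X]setTI; exact: measurable_translate.
  by have := @measurable_mulmxr R k r A measurableT _ m1; rewrite setTI.
have mc j : measurable_fun setT (coord X j : T -> T').
  by apply: (measurableT_comp (measurable_coord 0 j)); exact: measurable_funP.
pose Xj j : {mfun T >-> T'} := HB.pack (coord X j : T -> T')
  (@isMeasurableFun.Build _ _ T T' (coord X j) (mc j)).
have Xid j (B : set T') : measurable B -> P (Xj j @^-1` B) = N01 (@idR R @^-1` B).
  by move=> mB; exact: sX.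
have XL2 j : (coord X j) \in Lfun P 2%:E.
  exact: (Lfun2_same_law (Xid j) (idR_Lfun2 R)).
have EX j : 'E_P[coord X j]%E = 0%E.
  by rewrite -(expectation_std R); exact: (expectation_same_law (Xid j)).
have VX j : 'V_P[coord X j]%E = (std_variance R)%:E.
  rewrite (variance_same_law (Xid j)) fineK//; exact: (variance_fin_num (idR_Lfun2 R)).
pose e_ (j : 'I_r) : 'cV[R]_r := delta_mx j 0.
have eE (y : 'rV[R]_r) j : (y *m e_ j) 0 0 = y 0 j by rewrite -colE mxE.
have AeE j l : ((A *m e_ j)^T *m (A *m e_ l)) 0 0 = Psi j l.
  rewrite -!colE -AP !mxE; apply: eq_bigr => i _; by rewrite !mxE.
have v0 : std_variance R != 0 by rewrite gt_eqF// std_variance_gt0.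
have XlinE := gaussian_linear_form XA.
have Xaff j : exists c : R, c ^+ 2 = Psi j j /\ forall B, measurable B ->
    P (Xj j @^-1` B) = N01 (affine c (a 0 j) @^-1` B).
  have [c [cE H]] := XlinE (e_ j); exists c; rewrite -AeE; split => // B mB.
  rewrite -(eE a) -H//; congr (P _); apply/seteqP; split => w /=; by rewrite eE.
have a0 : a = 0.
  apply/rowP => j; have [c [_ H]] := Xaff j.
  have := expectation_same_law H; rewrite expectation_affine => E.
  by have := EX j; rewrite [LHS]E => -[->]; rewrite mxE.
have Psi1 j : Psi j j = 1.
  have [c [<- H]] := Xaff j.
  have := variance_same_law H; rewrite variance_affine => E.
  have := VX j; rewrite [LHS]E => -[] h.
  by apply: (mulIf v0); rewrite mul1r.
have corrE : Psi = correlation_mx P X.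
  apply/matrixP => j l; rewrite mxE !VX /= -expr2 sqr_sqrtr ?ltW ?std_variance_gt0//.
  pose S := fun w => X w 0 j + X w 0 l : T'.
  have mS : measurable_fun setT S by apply: measurable_funD; exact: mc.
  pose S' : {mfun T >-> T'} := HB.pack S (@isMeasurableFun.Build _ _ T T' S mS).
  have [c [cE H]] := XlinE (e_ j + e_ l).
  have SH (B : set T') : measurable B -> P (S' @^-1` B) =
      N01 (affine c ((a *m (e_ j + e_ l)) 0 0) @^-1` B).
    move=> mB; rewrite -H//; congr (P _); apply/seteqP.
    by split => w /=; rewrite mulmxDr [((_ + _ : 'M[R]_(1,1)) _ _)]mxE !eE.
  have c2 : c ^+ 2 = 2 + 2 * Psi j l.
    have trD (M N : 'cV[R]_k) : (M + N)^T = M^T + N^T by apply/matrixP => ? ?; rewrite !mxE.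
    rewrite cE mulmxDr trD mulmxDl !mulmxDr.
    have mxD (M N : 'M[R]_1) : (M + N) 0 0 = M 0 0 + N 0 0 by rewrite mxE.
    rewrite !mxD !AeE !Psi1.
    have -> : Psi l j = Psi j l.
      by rewrite -AP !mxE; apply: eq_bigr => i _; rewrite !mxE mulrC.
    ring.
  have := variance_same_law SH; rewrite variance_affine c2 => V1.
  have := varianceD (XL2 j) (XL2 l).
  rewrite (_ : (coord X j \+ coord X l)%R = S')// V1 !VX.
  have cf : covariance P (coord X j) (coord X l) \is a fin_num.
    apply: covariance_fin_num; last exact: Lfun2_mul_Lfun1.
      by apply: Lfun_subset12; [exact: fin_num_measure|exact: XL2].
    by apply: Lfun_subset12; [exact: fin_num_measure|exact: XL2].
  rewrite -(fineK cf) -EFinM -!EFinD => -[] h.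
  apply: (mulIf v0); rewrite mulfVK//; lra.
exists k, A; split; first by rewrite AP.
  by move=> j; rewrite -corrE.
move=> B mB; rewrite XA// a0; congr (gaussian_law A _).
by apply/seteqP; split => z; rewrite /shift_set/= add0r.
Qed.

End StandardGaussianVector.

(** * Inclusion-exclusion over increasing index vectors *)

Section InclusionExclusion.
Variable R : realType.

Lemma sorted_enum_ord d (J : {set 'I_d}) : sorted (fun i j : 'I_d => (i < j)%N) (enum J).
Proof.
rewrite {1}/enum_mem -enumT; apply: sorted_filter; first by move=> a b c; exact: ltn_trans.
have := iota_ltn_sorted 0 d; by rewrite -val_enum_ord sorted_map.
Qed.

(** Increasing vectors correspond to subsets of size [k.+1] by image and sorted enumeration. The
    dimension is a successor so that [ord0] can be the default of [nth]. *)
Lemma sum_increasing_idx d k (F : {set 'I_d.+1} -> R) :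
  \sum_(m : {ffun 'I_k.+1 -> 'I_d.+1} | increasing_idx m) F [set m i | i in 'I_k.+1]%SET =
  \sum_(J : {set 'I_d.+1} | #|J| == k.+1) F J.
Proof.
pose h (m : {ffun 'I_k.+1 -> 'I_d.+1}) : {set 'I_d.+1} := [set m i | i in 'I_k.+1]%SET.
pose h' (J : {set 'I_d.+1}) : {ffun 'I_k.+1 -> 'I_d.+1} := [ffun i : 'I_k.+1 => nth ord0 (enum J) i].
rewrite [RHS](reindex_onto h h'); last first.
  move=> J /eqP cJ; apply/setP => j; apply/imsetP/idP => [[i _ ->]|jJ].
    by rewrite ffunE -mem_enum mem_nth// -cardE cJ.
  have ij : (index j (enum J) < k.+1)%N by rewrite -cJ cardE index_mem mem_enum.
  by exists (Ordinal ij) => //; rewrite ffunE nth_index// mem_enum.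
apply: eq_bigl => m; apply/idP/andP => [mI|[/eqP cJ /eqP hm]].
  have [mlt m_inj] := conj (fun i j => @increasing_idx_lt _ _ _ i j mI) (increasing_idx_inj mI).
  split; first by rewrite card_imset// card_ord.
  have enumE : enum (h m) = [seq m i | i <- enum 'I_k.+1].
    apply: (@irr_sorted_eq _ (fun i j : 'I_d.+1 => (i < j)%N)).
    - by move=> a b c; exact: ltn_trans.
    - by move=> a; exact: ltnn.
    - exact: sorted_enum_ord.
    - have si := iota_ltn_sorted 0 k.+1; rewrite -val_enum_ord sorted_map in si.
      by rewrite sorted_map; apply: sub_sorted si => i j /=; exact: mlt.
    - move=> x; rewrite mem_enum; apply/imsetP/mapP => -[i _ ->]; exists i => //.
      by rewrite mem_enum.
  by apply/eqP/ffunP => i; rewrite ffunE enumE (nth_map ord0) ?size_enum_ord// nth_ord_enum.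
apply/forallP => i; apply/forallP => j; apply/implyP => ij.
rewrite -hm !ffunE; have := sorted_enum_ord (h m).
move=> /(sorted_ltn_nth _ ord0)/(_ i j); apply => //.
- by move=> a b c; exact: ltn_trans.
- by rewrite inE -cardE cJ ltn_ord.
- by rewrite inE -cardE cJ ltn_ord.
Qed.

Variables (disp : measure_display) (T : measurableType disp) (P : probability T R).

Lemma Rintegral_sum_indic (I : Type) (s : seq I) (c : I -> R) (E : I -> set T) :
  (forall i, measurable (E i)) ->
  P.-integrable setT (EFin \o (fun w => \sum_(i <- s) c i * \1_(E i) w)) /\
  \int[P]_w (\sum_(i <- s) c i * \1_(E i) w) = \sum_(i <- s) c i * fine (P (E i)).
Proof.
move=> mE.
have Ii i : P.-integrable setT (EFin \o (\1_(E i) : T -> R)).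
  apply: (@bounded_integrable _ _ _ _ _ 1); first exact: measurable_indic.
  by move=> w; rewrite indicE normr_nat; case: (_ \in _).
have Ici i : P.-integrable setT (EFin \o (fun w => c i * \1_(E i) w)).
  by have := integrableZl measurableT (c i) (Ii i).
elim: s => [|i s [IH1 IH2]].
  rewrite big_nil; split.
    rewrite (_ : _ \o _ = cst 0%E) ?integrable0//.
    by apply/funext => w /=; rewrite big_nil.
  by under eq_Rintegral do rewrite big_nil; rewrite Rintegral_cst// mul0r.
have E1 : (fun w => \sum_(i0 <- i :: s) c i0 * \1_(E i0) w) =
    (fun w => c i * \1_(E i) w + \sum_(i <- s) c i * \1_(E i) w).
  by apply/funext => w; rewrite big_cons.
split.
  by rewrite E1; have := integrableD measurableT (Ici i) IH1.
rewrite big_cons -IH2.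
transitivity (\int[P]_w (c i * \1_(E i) w + \sum_(i <- s) c i * \1_(E i) w)).
  by rewrite -E1.
rewrite RintegralD//; congr (_ + _).
rewrite RintegralZl//; congr (_ * _).
by rewrite /Rintegral integral_indic// setIT.
Qed.

Lemma fine_probability_Rintegral (A : set T) : measurable A ->
  fine (P A) = \int[P]_w \1_A w.
Proof. by move=> mA; rewrite /Rintegral integral_indic// setIT. Qed.

(** Expectation of [1 - \prod_j (1 - \1_(A j))], expanded over subsets and grouped by cardinality.
    The sum is signed as in [H_df], hence the minus sign in front. *)
Lemma inclusion_exclusion d (A : 'I_d -> set T) : (forall j, measurable (A j)) ->
  fine (P (\bigcup_(j in [set: 'I_d]) A j)) =
  - \sum_(k < d) (-1) ^+ k.+1 *
      \sum_(m : {ffun 'I_k.+1 -> 'I_d} | increasing_idx m)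
        fine (P (\bigcap_(i in [set: 'I_k.+1]) A (m i))).
Proof.
case: d A => [|d] A mA.
  rewrite big_ord0 oppr0 (_ : \bigcup_(_ in _) _ = set0) ?measure0//.
  by apply/seteqP; split => // w [[]].
pose E (J : {set 'I_d.+1}) := \bigcap_(j in [set` J]) A j.
have mE J : measurable (E J) by apply: fin_bigcap_measurable => // j _; exact: mA.
have mU : measurable (\bigcup_(j in [set: 'I_d.+1]) A j).
  by apply: fin_bigcup_measurable => // j _; exact: mA.
have EE J w : \1_(E J) w = \prod_(j in J) \1_(A j) w :> R.
  rewrite indicE; have [wE|wE] := pselect (E J w).
    by rewrite mem_set// big1// => j jJ; rewrite indicE mem_set//; exact: wE.
  rewrite memNset//; apply/esym/eqP/prodf_eq0.
  have [j] : exists j, ~ (j \in J -> A j w).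
    by apply/existsNP => h; apply: wE => j jJ; exact: h.
  by move=> /not_implyP[jJ nA]; exists j; rewrite // indicE memNset.
have UE w : \1_(\bigcup_(j in [set: 'I_d.+1]) A j) w =
    - \sum_(J : {set 'I_d.+1} | J != finset.set0) (-1) ^+ #|J| * \1_(E J) w :> R.
  have -> : \1_(\bigcup_(j in [set: 'I_d.+1]) A j) w = 1 - \prod_j (- \1_(A j) w + 1) :> R.
    rewrite indicE; have [[j _ wA]|wE] := pselect ((\bigcup_(j in [set: 'I_d.+1]) A j) w).
      rewrite mem_set; last by exists j.
      by rewrite (bigD1 j)//= indicE mem_set// addNr mul0r subr0.
    rewrite memNset// big1 ?subrr// => j _.
    by rewrite indicE memNset ?oppr0 ?add0r// => wA; apply: wE; exists j.
  rewrite bigA_distr (bigD1 finset.set0)//= big1 => [|j _]; last by rewrite inE.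
  rewrite opprD addrA subrr add0r; congr (- _); apply: eq_bigr => J _.
  rewrite EE -prodrN -big_mkcond/=.
  by [].
rewrite fine_probability_Rintegral//.
under eq_Rintegral do rewrite UE.
have -> : (fun w => - \sum_(J : {set 'I_d.+1} | J != finset.set0) (-1) ^+ #|J| * \1_(E J) w : R) =
    (fun w => \sum_(J <- enum [pred J : {set 'I_d.+1} | J != finset.set0])
       - (-1) ^+ #|J| * \1_(E J) w).
  apply/funext => w; rewrite big_enum -sumrN; apply: eq_bigr => J _; by rewrite mulNr.
rewrite (Rintegral_sum_indic _ _ mE).2 big_enum/= -sumrN.
(* The index [k] stands for cardinality [k.+1]; the subsets are nonempty, so taking the predecessor
   loses nothing. *)
rewrite (partition_big (fun J : {set 'I_d.+1} => inord #|J|.-1 : 'I_d.+1) xpredT)//=.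
apply: eq_bigr => k _.
transitivity (\sum_(J : {set 'I_d.+1} | #|J| == k.+1) - (-1) ^+ #|J| * fine (P (E J))).
  apply: eq_bigl => J; rewrite inE -card_gt0.
  have := max_card (mem J); rewrite card_ord => cJ.
  apply/andP/eqP => [[J0 /eqP <-]|J1].
    by rewrite inordK ?prednK.
  by rewrite J1; split => //; apply/eqP/val_inj; rewrite /= inordK.
rewrite -(sum_increasing_idx k (fun J => - (-1) ^+ #|J| * fine (P (E J)))).
rewrite mulr_sumr -sumrN; apply: eq_bigr => m mI.
rewrite card_imset ?card_ord; last exact: increasing_idx_inj.
rewrite mulNr (_ : E _ = \bigcap_(i in [set: 'I_k.+1]) A (m i))//.
apply/seteqP; split => w wE; first by move=> i _; apply: wE; rewrite /= imset_f.
by move=> j /= /imsetP[i _ ->]; exact: wE.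
Qed.

End InclusionExclusion.

(** * Averages against a weakly convergent empirical measure *)

Section IntegralMonotonicity.
Variables (R : realType) (disp : measure_display) (T : measurableType disp).

(* No measurability is needed: the integral of a nonnegative function is a
   supremum over the simple functions below it. *)
Lemma le_integral_nonmeasurable (mu : {measure set T -> \bar R}) (E : set T) (f g : T -> \bar R) :
  (forall x, E x -> (f x <= g x)%E) -> (\int[mu]_(x in E) f x <= \int[mu]_(x in E) g x)%E.
Proof.
move=> fg.
have fgE x : ((f \_ E) x <= (g \_ E) x)%E.
  by rewrite /patch; case: ifPn => // /[!inE]; exact: fg.
rewrite /integral; apply: leeB; apply: le_ereal_sup => _ [s sf <-]; exists s => // x;
  apply: le_trans (sf x) _.
  by rewrite unlock ge_max le_max fgE/= le_max lexx orbT.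
by rewrite unlock ge_max le_max leeN2 fgE/= le_max lexx orbT.
Qed.

Variables (mu : probability T R) (E D : set T).
Hypotheses (mE : measurable E) (mD : measurable D) (ED : mu (E `\` D) = 0%E).

(** [F] is known only on [D] and may fail to be measurable. On the null part of [E] outside [D], the
    bounds [h] and [g] are replaced by -oo and +oo, which leaves their integrals unchanged and makes
    the comparison hold on all of [E]. *)
Lemma le_Rintegral_sandwich (h F g : T -> R) (K : R) :
  measurable_fun setT h -> measurable_fun setT g ->
  (forall x, `|h x| <= K) -> (forall x, `|g x| <= K) ->
  (forall x, D x -> h x <= F x <= g x) ->
  \int[mu]_(x in E) h x <= \int[mu]_(x in E) F x <= \int[mu]_(x in E) g x.
Proof.
move=> mh mg hK gK hFg.
have key (f : T -> R) (c : \bar R) : measurable_fun setT f ->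
    (\int[mu]_(x in E) (if x \in D then (f x)%:E else c) = \int[mu]_(x in E) (f x)%:E)%E.
  move=> mf; apply: ae_eq_integral => //.
  - apply: measurable_funTS; apply: measurable_fun_ifT => //.
      apply: (measurable_fun_bool true); rewrite setTI (_ : _ @^-1` _ = D)//.
      by apply/seteqP; split => x /=; [move/set_mem|move/mem_set].
    exact/measurable_EFinP.
  - by apply: measurable_funTS; exact/measurable_EFinP.
  - exists (E `\` D); split => //; first exact: measurableD.
    move=> x /= nx; split; first by apply: contrapT => nE; apply: nx => /nE.
    by move=> xD; apply: nx => _; rewrite mem_set.
have fin (f : T -> R) : measurable_fun setT f -> (forall x, `|f x| <= K) ->
    (\int[mu]_(x in E) (f x)%:E)%E \is a fin_num.
  move=> mf fK; apply: integrable_fin_num => //.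
  apply: (integrableS measurableT) => //.
  exact: (@bounded_integrable _ _ _ _ _ K).
have le1 : (\int[mu]_(x in E) (h x)%:E <= \int[mu]_(x in E) (F x)%:E)%E.
  rewrite -(key h -oo%E mh); apply: le_integral_nonmeasurable => x Ex.
  by case: ifPn => [/[!inE] xD|_]; rewrite ?leNye// lee_fin; case/andP: (hFg _ xD).
have le2 : (\int[mu]_(x in E) (F x)%:E <= \int[mu]_(x in E) (g x)%:E)%E.
  rewrite -(key g +oo%E mg); apply: le_integral_nonmeasurable => x Ex.
  by case: ifPn => [/[!inE] xD|_]; rewrite ?leey// lee_fin; case/andP: (hFg _ xD).
have fh := fin h mh hK; have fg := fin g mg gK.
have fF : (\int[mu]_(x in E) (F x)%:E)%E \is a fin_num.
  rewrite fin_numElt (lt_le_trans _ le1) ?ltNye ?(le_lt_trans le2) ?ltey//.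
    by move: fg; rewrite fin_numE => /andP[].
  by move: fh; rewrite fin_numE => /andP[].
by rewrite /Rintegral !fine_le.
Qed.

End IntegralMonotonicity.

Section Averages.
Variables (R : realType) (d : nat).

Lemma closed_nonneg_mx : closed (@nonneg_mx R d).
Proof.
rewrite (_ : @nonneg_mx R d = \bigcap_(i in [set: 'I_d]) \bigcap_(j in [set: 'I_d])
    ((fun L : 'M[R]_d => L i j) @^-1` [set x | 0 <= x])).
  apply: closed_bigI => i _; apply: closed_bigI => j _.
  apply: closed_comp; last exact: closed_ge.
  by move=> L _; exact: coord_continuous.
apply/seteqP; split => L h; first by move=> i _ j _; exact: h.
by move=> i j; exact: h.
Qed.

Lemma measurable_nonneg_mx : measurable (@nonneg_mx R d).
Proof. exact: closed_measurable_mx closed_nonneg_mx. Qed.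

Lemma Rintegral_empirical n (L : 'I_n.+1 -> 'M[R]_d) (E : set 'M[R]_d) (f : 'M[R]_d -> R) :
  measurable E -> (forall i, E (L i)) -> measurable_fun setT f -> (forall x, 0 <= f x) ->
  \int[empirical_measure L]_(x in E) f x = n.+1%:R^-1 * \sum_i f (L i).
Proof.
move=> mE EL mf f0.
have mfE : measurable_fun E (fun x => (f x)%:E) by apply: measurable_funTS; exact/measurable_EFinP.
rewrite /Rintegral /empirical_measure ge0_integral_mscale//; last by move=> x _; rewrite lee_fin.
rewrite fineZl; congr (_ * _).
rewrite ge0_integral_measure_sum//; last by move=> x _; rewrite lee_fin.
transitivity (fine (\sum_(i < n.+1) (f (L i))%:E)%E); last by rewrite sumEFin.
congr fine; apply: eq_bigr => i _.
by rewrite integral_dirac// diracE mem_set ?mul1e ?inord_val//; exact: EL.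
Qed.

Section LowerEnvelope.
Variables (L : forall n, 'I_n.+1 -> 'M[R]_d) (v : forall n, 'I_n.+1 -> R) (C : R).
Arguments L : clear implicits.
Arguments v : clear implicits.
Hypothesis vC : forall n i, 0 <= v n i <= C.

Let C0 : 0 <= C.
Proof. by have /andP[v0 v1] := @vC 0%N ord0; exact: le_trans v1. Qed.

(** The element [C] makes the infimum at most [C], so that the envelopes are bounded test
    functions. *)
Definition envelope_set (k : nat) (x : 'M[R]_d) : set R :=
  [set y | y = C \/ exists n (i : 'I_n.+1), (k <= n)%N /\ y = v n i + k%:R * `|x - L n i|].

(* The largest k-Lipschitz function below [C] and below [v n i] at [L n i] for
   all [n >= k]. *)
Definition envelope k x := inf (envelope_set k x).

Lemma envelope_ge k x c : c <= C ->
  (forall n (i : 'I_n.+1), (k <= n)%N -> c <= v n i + k%:R * `|x - L n i|) -> c <= envelope k x.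
Proof.
move=> cC h; apply: lb_le_inf; first by exists C; left.
by move=> y [->//|[n [i [kn ->]]]]; exact: h.
Qed.

Lemma envelope_le k x y : envelope_set k x y -> envelope k x <= y.
Proof.
apply: ge_inf; exists 0 => _ [->//|[n [i [kn ->]]]].
by rewrite addr_ge0// ?mulr_ge0//; have /andP[] := vC i.
Qed.

Lemma envelope_le_point k n (i : 'I_n.+1) : (k <= n)%N -> envelope k (L n i) <= v n i.
Proof.
move=> kn; apply: envelope_le; right; exists n, i; split => //.
by rewrite subrr normr0 mulr0 addr0.
Qed.

Lemma envelope_bounded k x : 0 <= envelope k x <= C.
Proof.
apply/andP; split; last by apply: envelope_le; left.
apply: envelope_ge => // n i _; rewrite addr_ge0 ?mulr_ge0//.
by have /andP[] := vC i.
Qed.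

Lemma envelope_lipschitz k x y : envelope k x <= envelope k y + k%:R * `|x - y|.
Proof.
rewrite -lerBlDr; apply: envelope_ge => [|n i kn].
  rewrite lerBlDr; apply: (@le_trans _ _ C); first by have /andP[] := envelope_bounded k x.
  by rewrite lerDl mulr_ge0.
rewrite lerBlDr; apply: (@le_trans _ _ (v n i + k%:R * `|x - L n i|)).
  by apply: envelope_le; right; exists n, i.
rewrite -addrA lerD2l -mulrDr ler_wpM2l// [leRHS]addrC.
by rewrite (_ : x - L n i = (x - y) + (y - L n i)) ?ler_normD// addrA subrK.
Qed.

Lemma continuous_envelope k : continuous (envelope k).
Proof.
move=> x; have Fx : Filter (nbhs x) by exact: nbhs_filter.
apply/(@cvgrPdist_le _ _ _ _ Fx) => e e0.
have d0 : 0 < e / k.+1%:R by rewrite divr_gt0.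
near=> y.
have xy : `|x - y| <= e / k.+1%:R.
  by near: y; exact: (cvgr_dist_le _ _ (@cvg_id _ _)).
have kxy : k%:R * `|x - y| <= e.
  apply: (@le_trans _ _ (k.+1%:R * (e / k.+1%:R))); last by rewrite mulrC divfK.
  by apply: ler_pM => //; rewrite ler_nat.
have h1 := envelope_lipschitz k x y; have h2 := envelope_lipschitz k y x.
rewrite distrC in h2; rewrite ler_norml; apply/andP; split; lra.
Unshelve. all: by end_near. Qed.

Lemma measurable_envelope k : measurable_fun setT (envelope k).
Proof. exact: continuous_measurable_mx (@continuous_envelope k). Qed.

Lemma nondecreasing_envelope x : nondecreasing_seq (fun k => envelope k x).
Proof.
move=> k k' kk'; apply: envelope_ge => [|n i kn]; first by have /andP[] := envelope_bounded k x.
apply: (@le_trans _ _ (v n i + k%:R * `|x - L n i|)).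
  by apply: envelope_le; right; exists n, i; rewrite (leq_trans kk').
by rewrite lerD2l ler_wpM2r// ler_nat.
Qed.

Definition envelope_lim x := sup (range (fun k => envelope k x)).

Lemma cvg_envelope x : (fun k => envelope k x) @ \oo --> envelope_lim x.
Proof.
apply: nondecreasing_cvgn; first exact: nondecreasing_envelope.
by exists C => _ [k _ <-]; have /andP[] := envelope_bounded k x.
Qed.

Lemma measurable_envelope_lim : measurable_fun setT envelope_lim.
Proof. by apply: (measurable_fun_cvg measurable_envelope) => x _; exact: cvg_envelope. Qed.

Lemma envelope_lim_bounded x : 0 <= envelope_lim x <= C.
Proof.
apply/andP; split.
  apply: (cvgr_to_ge (@cvg_envelope x)); apply: nearW => k.
  by have /andP[] := envelope_bounded k x.
apply: (cvgr_to_le (@cvg_envelope x)); apply: nearW => k.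
by have /andP[] := envelope_bounded k x.
Qed.

(** Points within [delta] of [x] have values at least [c - e]; at larger distances the penalty
    [k%:R * delta] is at least [C] once [k] is large. *)
Lemma envelope_lim_ge x c : c <= C ->
  (forall e, 0 < e -> exists delta N, 0 < delta /\ forall n i, (N <= n)%N ->
     `|x - L n i| < delta -> c - e <= v n i) -> c <= envelope_lim x.
Proof.
move=> cC h; apply/ler_addgt0Pl => e e0; have [delta [N [d0 hN]]] := h e e0.
rewrite -lerBlDl; apply: (cvgr_to_ge (@cvg_envelope x)).
near=> k; apply: envelope_ge => [|n i kn]; first by rewrite (le_trans _ cC)// gerBl ltW.
have /andP[v0 v1] := vC i.
have [xL|xL] := ltP `|x - L n i| delta.
  apply: (@le_trans _ _ (v n i)); last by rewrite lerDl mulr_ge0.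
  apply: hN => //; apply: leq_trans kn.
  by near: k; exact: nbhs_infty_ge.
apply: (@le_trans _ _ C); first by rewrite (le_trans _ cC)// gerBl ltW.
apply: (@le_trans _ _ (k%:R * delta)); last first.
  by apply: (@le_trans _ _ (k%:R * `|x - L n i|)); [rewrite ler_wpM2l|rewrite lerDr].
rewrite -ler_pdivrMr//.
by near: k; exact: nbhs_infty_ger.
Unshelve. all: by end_near. Qed.

Variable eta : probability 'M[R]_d R.
Local Notation E := (@nonneg_mx R d).
Hypothesis LE : forall n i, E (L n i).
Hypothesis hcvg : weak_cvg_on E (fun n => empirical_measure (fun i => L n i)) eta.

(** For fixed [k] the envelope is a continuous bounded function lying below the values in all rows
    from [k] on, so weak convergence bounds the averages from below by its integral. Dominated
    convergence in [k] chooses [k] first. *)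
Lemma envelope_lim_le_average (e : R) : 0 < e -> \forall n \near \oo,
  \int[eta]_(x in E) envelope_lim x <= n.+1%:R^-1 * (\sum_(i < n.+1) v n i) + e.
Proof.
move=> e0.
have mE := measurable_nonneg_mx.
have cI : \int[eta]_(x in E) envelope k x @[k --> \oo] --> \int[eta]_(x in E) envelope_lim x.
  apply: (@Rintegral_dominated_cvg R _ _ eta E mE envelope envelope_lim (cst C)).
  - by move=> k; apply: measurable_funTS; exact: measurable_envelope.
  - by apply: measurable_funTS; exact: measurable_envelope_lim.
  - apply: (integrableS measurableT) => //; exact: finite_measure_integrable_cst.
  - by apply: aeW => x _; exact: cvg_envelope.
  - by move=> k x _; have /andP[h0 h1] := envelope_bounded k x; rewrite ger0_norm.
have [k hk] : exists k, \int[eta]_(x in E) envelope_lim x - e / 2 <= \int[eta]_(x in E) envelope k x.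
  have e2 : \int[eta]_(x in E) envelope_lim x - e / 2 < \int[eta]_(x in E) envelope_lim x.
    by rewrite gtrBl divr_gt0.
  by have [k _ /(_ k (leqnn k))/ltW hk] := cvgr_gt _ cI _ e2; exists k.
have cE := hcvg (f := envelope k).
have {}cE : \int[empirical_measure (fun i => L n i)]_(x in E) envelope k x @[n --> \oo] -->
    \int[eta]_(x in E) envelope k x.
  apply: hcvg.
    by apply: continuous_subspaceT; exact: continuous_envelope.
  by exists C => x _; have /andP[h0 h1] := envelope_bounded k x; rewrite ger0_norm.
near=> n.
have h1 : \int[eta]_(x in E) envelope k x - e / 2 <=
    \int[empirical_measure (fun i => L n i)]_(x in E) envelope k x.
  apply: ltW; near: n; apply: (cvgr_gt _ cE); by rewrite gtrBl divr_gt0.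
rewrite Rintegral_empirical// in h1; last 2 first.
- exact: measurable_envelope.
- by move=> x; have /andP[] := envelope_bounded k x.
have h2 : n.+1%:R^-1 * \sum_(i < n.+1) envelope k (L n i) <= n.+1%:R^-1 * \sum_(i < n.+1) v n i.
  rewrite ler_wpM2l ?invr_ge0//; apply: ler_sum => i _; apply: envelope_le_point.
  by near: n; exact: nbhs_infty_ge.
have aux (p q r s : R) : p - e / 2 <= q -> q - e / 2 <= r -> r <= s -> p <= s + e by lra.
exact: aux hk h1 h2.
Unshelve. all: by end_near. Qed.

End LowerEnvelope.

Section AverageConvergence.
Variables (L : forall n, 'I_n.+1 -> 'M[R]_d) (v : forall n, 'I_n.+1 -> R) (C : R).
Arguments L : clear implicits.
Arguments v : clear implicits.
Variable eta : probability 'M[R]_d R.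
Local Notation E := (@nonneg_mx R d).

(** The lower bound is used for [C + v] and for [C - v], the shifts making the values nonnegative.
    The two envelope limits enclose [F] on [D], and their integrals are enclosed by the averages. *)
Lemma cvg_average_weak (D : set 'M[R]_d) (F : 'M[R]_d -> R) :
  (forall n i, `|v n i| <= C) -> (forall n i, E (L n i)) ->
  weak_cvg_on E (fun n => empirical_measure (fun i => L n i)) eta ->
  measurable D -> D `<=` E -> eta D = 1%E ->
  (forall x, D x -> `|F x| <= C) ->
  (forall x, D x -> forall e, 0 < e -> exists delta N, 0 < delta /\
     forall n i, (N <= n)%N -> `|x - L n i| < delta -> `|v n i - F x| <= e) ->
  (fun n => n.+1%:R^-1 * \sum_(i < n.+1) v n i) @ \oo --> \int[eta]_(x in E) F x.
Proof.
move=> vC LE hcvg mD DE D1 FC hF.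
have vCC n (i : 'I_n.+1) : - C <= v n i <= C by rewrite -ler_norml.
pose v1 n (i : 'I_n.+1) := C + v n i.
pose w n (i : 'I_n.+1) := C - v n i.
have v1C n (i : 'I_n.+1) : 0 <= v1 n i <= C + C.
  by have /andP[h0 h1] := vCC _ i; apply/andP; rewrite /v1; split; lra.
have wC n (i : 'I_n.+1) : 0 <= w n i <= C + C.
  by have /andP[h0 h1] := vCC _ i; apply/andP; rewrite /w; split; lra.
have mE := measurable_nonneg_mx.
have E1 : eta E = 1%E.
  by apply/eqP; rewrite eq_le probability_le1//= -D1; apply: le_measure; rewrite ?inE.
have ED : eta (E `\` D) = 0%E.
  have h : eta (E `\` D) = (eta E - eta (E `&` D))%E.
    by apply: measureD => //; exact: le_lt_trans (probability_le1 eta mE) (ltry 1).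
  by rewrite h (setIidr DE) E1 D1 subee.
pose gl := envelope_lim L v1 (C + C).
pose hl := envelope_lim L w (C + C).
pose g x := gl x - C.
pose h x := C - hl x.
have glC x : 0 <= gl x <= C + C by exact: envelope_lim_bounded.
have hlC x : 0 <= hl x <= C + C by exact: envelope_lim_bounded.
have mgl : measurable_fun setT gl by exact: measurable_envelope_lim.
have mhl : measurable_fun setT hl by exact: measurable_envelope_lim.
have mg : measurable_fun setT g by apply: measurable_funB.
have mh : measurable_fun setT h by apply: measurable_funB.
have gK x : `|g x| <= C.
  by have /andP[h0 h1] := glC x; rewrite ler_norml /g; apply/andP; split; lra.
have hK x : `|h x| <= C.
  by have /andP[h0 h1] := hlC x; rewrite ler_norml /h; apply/andP; split; lra.
have hFg x : D x -> h x <= F x <= g x.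
  move=> Dx; have := FC x Dx; rewrite ler_norml => /andP[F0 FCx].
  have c1 : C - F x <= C + C by lra.
  have c2 : C + F x <= C + C by lra.
  have l1 : C - F x <= hl x.
    apply: envelope_lim_ge => // e e0; have [delta [N [d0 H]]] := hF x Dx e e0.
    exists delta, N; split=> // n i Nn xL; have := H n i Nn xL.
    by rewrite ler_norml => /andP[a1 a2]; rewrite /w; lra.
  have l2 : C + F x <= gl x.
    apply: envelope_lim_ge => // e e0; have [delta [N [d0 H]]] := hF x Dx e e0.
    exists delta, N; split=> // n i Nn xL; have := H n i Nn xL.
    by rewrite ler_norml => /andP[a1 a2]; rewrite /v1; lra.
  by apply/andP; rewrite /h /g; split; lra.
have /andP[hF1 hF2] := le_Rintegral_sandwich mE mD ED mh mg hK gK hFg.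
apply/cvgrPdist_le => /= e e0; near=> n.
have n0 : n.+1%:R != 0 :> R by [].
have A1 : \int[eta]_(x in E) gl x <= n.+1%:R^-1 * (\sum_(i < n.+1) v1 n i) + e.
  by near: n; exact: envelope_lim_le_average.
have A2 : \int[eta]_(x in E) hl x <= n.+1%:R^-1 * (\sum_(i < n.+1) w n i) + e.
  by near: n; exact: envelope_lim_le_average.
have CE : \int[eta]_(x in E) C = C.
  by transitivity (C * fine (eta E)); [exact: Rintegral_cst|rewrite E1 mulr1].
have Ci : eta.-integrable E (EFin \o (fun=> C)).
  by apply: (integrableS measurableT) => //; exact: finite_measure_integrable_cst.
have bi (f : 'M[R]_d -> R) : measurable_fun setT f -> (forall x, 0 <= f x <= C + C) ->
    eta.-integrable E (EFin \o f).
  move=> mf fC; apply: (integrableS measurableT) => //.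
  apply: (@bounded_integrable _ _ _ _ _ (C + C)) => // x.
  by have /andP[h0 h1] := fC x; rewrite ger0_norm.
have hE : \int[eta]_(x in E) h x = C - \int[eta]_(x in E) hl x.
  transitivity (\int[eta]_(x in E) C - \int[eta]_(x in E) hl x); last by rewrite CE.
  by apply: RintegralB => //; exact: bi.
have gE : \int[eta]_(x in E) g x = \int[eta]_(x in E) gl x - C.
  transitivity (\int[eta]_(x in E) gl x - \int[eta]_(x in E) C); last by rewrite CE.
  by apply: RintegralB => //; exact: bi.
have wE : n.+1%:R^-1 * (\sum_(i < n.+1) w n i) = C - n.+1%:R^-1 * (\sum_(i < n.+1) v n i).
  by rewrite /w sumrB mulrBr sumr_const card_ord -(mulr_natl C) mulrA mulVf// mul1r.
have v1E : n.+1%:R^-1 * (\sum_(i < n.+1) v1 n i) = C + n.+1%:R^-1 * (\sum_(i < n.+1) v n i).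
  by rewrite /v1 big_split/= mulrDr sumr_const card_ord -(mulr_natl C) mulrA mulVf// mul1r.
rewrite v1E in A1; rewrite wE in A2; rewrite hE in hF1; rewrite gE in hF2.
have aux (p q r s : R) : C - p <= q -> q <= r - C -> r <= C + s + e ->
    p <= C - s + e -> `|q - s| <= e.
  by move=> *; rewrite ler_norml; apply/andP; split; lra.
exact: aux hF1 hF2 A1 A2.
Unshelve. all: by end_near. Qed.

End AverageConvergence.

End Averages.

Lemma continuous_sumr (R : realType) (T : topologicalType) (I : Type) (s : seq I)
    (f : I -> T -> R) :
  (forall i, continuous (f i)) -> continuous (fun x => \sum_(i <- s) f i x).
Proof. by move=> cf x; apply: cvg_sumr => i _; exact: cf. Qed.

Lemma continuous_mulr (R : realType) (T : topologicalType) (f g : T -> R) :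
  continuous f -> continuous g -> continuous (fun x => f x * g x).
Proof. by move=> cf cg x; apply: cvgM; [exact: cf|exact: cg]. Qed.

(** * Strictly conditionally negative definite matrices form a Borel set *)

Section MeasurabilityD0.
Variables (R : realType) (d : nat).

Definition quad (A : 'M[R]_d) (x : 'rV[R]_d) : R := \sum_i \sum_j x 0 i * x 0 j * A i j.

Lemma quadE (A : 'M[R]_d) x : (x *m A *m x^T) 0 0 = quad A x.
Proof. exact: quad_formE. Qed.

Lemma continuous_quad_mx x : continuous (quad^~ x).
Proof.
apply: continuous_sumr => i; apply: continuous_sumr => j.
by apply: continuous_mulr; [exact: cst_continuous|exact: coord_continuous].
Qed.

Lemma continuous_quad_rV A : continuous (quad A).
Proof.
apply: continuous_sumr => i; apply: continuous_sumr => j.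
apply: continuous_mulr; last exact: cst_continuous.
by apply: continuous_mulr; exact: coord_continuous.
Qed.

(** Negativity with a margin [c] is a closed condition, unlike strict negativity; margins
    [n.+1%:R^-1] exhaust the strict case. *)
Definition neg_quad (c : R) : set 'M[R]_d :=
  [set A | forall x : 'rV[R]_d, \sum_i x 0 i = 0 -> quad A x <= - c * `|x| ^+ 2].

Lemma closed_neg_quad c : closed (neg_quad c).
Proof.
rewrite (_ : neg_quad c = \bigcap_(x in [set x : 'rV[R]_d | \sum_i x 0 i = 0])
    ((fun A : 'M[R]_d => quad A x) @^-1` [set y | y <= - c * `|x| ^+ 2])).
  apply: closed_bigI => x _; apply: closed_comp; last exact: closed_le.
  by move=> A _; exact: continuous_quad_mx.
by apply/seteqP; split.
Qed.

(** By homogeneity it suffices to look at the unit sphere of the zero-sum hyperplane, where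
    compactness turns strict negativity into a margin. *)
Lemma neg_quadP (A : 'M[R]_d) :
  (forall x : 'rV[R]_d, x != 0 -> \sum_i x 0 i = 0 -> quad A x < 0) <->
  exists n : nat, neg_quad n.+1%:R^-1 A.
Proof.
split=> [h|[n h] x x0 sx]; last first.
  apply: le_lt_trans (h x sx) _; rewrite mulNr oppr_lt0 mulr_gt0 ?invr_gt0//.
  by rewrite exprn_gt0// normr_gt0.
pose K := [set x : 'rV[R]_d | `|x| = 1 /\ \sum_i x 0 i = 0].
have normalize (x : 'rV[R]_d) : x != 0 -> \sum_i x 0 i = 0 ->
    K (`|x|^-1 *: x) /\ quad A x = `|x| ^+ 2 * quad A (`|x|^-1 *: x).
  move=> x0 sx; have nx : `|x| != 0 by rewrite normr_eq0.
  split; first split.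
  - by rewrite normrZ normfV normr_id mulVf.
  - under eq_bigr do rewrite mxE.
    by rewrite -mulr_sumr sx mulr0.
  rewrite /quad mulr_sumr; apply: eq_bigr => i _; rewrite mulr_sumr.
  by apply: eq_bigr => j _; rewrite !mxE; field.
have [K0|] := pselect (K !=set0); last first.
  (* [K] is empty when the hyperplane is reduced to 0, as in dimension 1. *)
  move=> K0; exists 0%N => x sx; have [->|x0] := eqVneq x 0.
    rewrite normr0 expr0n/= mulr0 /quad big1// => i _; rewrite big1// => j _.
    by rewrite mxE !mul0r.
  by case: K0; exists (`|x|^-1 *: x); exact: (normalize x x0 sx).1.
have cK : compact K.
  apply: bounded_closed_compact.
    exists 1; split => [|M M1 x [x1 _]]; first exact: num_real.
    by apply: (@le_trans _ _ 1); [rewrite x1|exact: ltW].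
  rewrite (_ : K = (fun x : 'rV[R]_d => `|x|) @^-1` [set 1] `&`
     (fun x : 'rV[R]_d => \sum_i x 0 i) @^-1` [set 0]); last by apply/seteqP; split.
  apply: closedI.
    by apply: closed_comp; [move=> x _; exact: norm_continuous|exact: closed_eq].
  apply: closed_comp; last exact: closed_eq.
  move=> x _; apply: continuous_sumr => i; exact: coord_continuous.
have [c cKin cmax] := EVT_max_rV K0 cK (continuous_subspaceT (@continuous_quad_rV A)).
rewrite inE in cKin; have [c1 cs] := cKin.
have c0 : c != 0 by rewrite -normr_eq0 c1 oner_neq0.
have m0 : quad A c < 0 by exact: h.
have [n hn] : exists n : nat, n.+1%:R^-1 <= - quad A c.
  have q0 : 0 < - quad A c by rewrite oppr_gt0.
  exists (Num.truncn (- quad A c)^-1).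
  rewrite invf_ple ?posrE//; apply: ltW; exact: truncnS_gt.
exists n => x sx; have [->|x0] := eqVneq x 0.
  rewrite normr0 expr0n/= mulr0 /quad big1// => i _; rewrite big1// => j _.
  by rewrite mxE !mul0r.
have [Kx ->] := normalize x x0 sx; rewrite mulrC ler_wpM2r ?sqr_ge0//.
apply: (@le_trans _ _ (quad A c)); first by apply: cmax; rewrite inE.
by rewrite lerNr.
Qed.

Lemma measurable_D0 : measurable (@D0 R d).
Proof.
rewrite (_ : @D0 R d = @nonneg_mx R d `&` ((\bigcap_(i in [set: 'I_d]) \bigcap_(j in [set: 'I_d])
    [set A : 'M[R]_d | A i j - A j i = 0]) `&` ((\bigcap_(j in [set: 'I_d]) [set A : 'M[R]_d | A j j = 0])
    `&` \bigcup_n neg_quad n.+1%:R^-1))).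
  apply: measurableI; first exact: measurable_nonneg_mx.
  have mz (f : 'M[R]_d -> R) : measurable_fun setT f -> measurable [set A | f A = 0].
    by move=> mf; rewrite -[X in measurable X]setTI; exact: (mf measurableT [set 0]).
  apply: measurableI.
    apply: fin_bigcap_measurable => // i _; apply: fin_bigcap_measurable => // j _.
    by apply: mz; apply: measurable_funB; exact: measurable_coord.
  apply: measurableI.
    by apply: fin_bigcap_measurable => // j _; apply: mz; exact: measurable_coord.
  by apply: bigcup_measurable => n _; apply: closed_measurable_mx; exact: closed_neg_quad.
apply/seteqP; split => [A [h1 h2 h3 h4]|A [h1 [h2 [h3 [n _ h4]]]]].
  split => //; split; first by move=> i _ j _ /=; rewrite -{1}h2 mxE subrr.
  split; first by move=> j _; exact: h3.
  have /neg_quadP[n hn] : forall x : 'rV[R]_d, x != 0 -> \sum_i x 0 i = 0 -> quad A x < 0.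
    by move=> x x0 sx; rewrite -quadE; exact: h4.
  by exists n.
split => //.
- apply/matrixP => i j; rewrite mxE; apply/eqP; rewrite -subr_eq0; apply/eqP.
  exact: (h2 j I i I).
- by move=> j; exact: (h3 j I).
- move=> x x0 sx; rewrite quadE; apply: (neg_quadP A).2 => //.
  by exists n.
Qed.

Lemma measurable_sq_mx : measurable_fun setT (@sq_mx R d).
Proof.
apply: measurable_fun_mx => i j; under eq_fun do rewrite mxE.
by apply: measurable_funX; exact: measurable_coord.
Qed.

End MeasurabilityD0.

(** * Maxima of the rows *)

Section ProductLimit.
Variable R : realType.

(** This is [1 / (1 - p) <= 1 + p / (1 - c) <= exp (p / (1 - c))], inverted. *)
Lemma expR_le_onem (p c : R) : 0 <= p <= c -> c < 1 -> expR (- (p / (1 - c))) <= 1 - p.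
Proof.
move=> /andP[p0 pc] c1; have c0 : 0 < 1 - c by rewrite subr_gt0.
have p1 : 0 < 1 - p by rewrite subr_gt0 (le_lt_trans pc).
rewrite expRN invf_ple ?posrE ?expR_gt0//.
apply: le_trans (expR_ge1Dx _); rewrite -(ler_pM2r p1) mulVf ?gt_eqF//.
have -> : (1 + p / (1 - c)) * (1 - p) = 1 + p * (c - p) / (1 - c) by field; rewrite gt_eqF.
by rewrite lerDl divr_ge0 ?mulr_ge0 ?subr_ge0// ltW.
Qed.

(** The product is squeezed between exponentials of minus the sum, the sum being divided by
    [1 - C / n.+1%:R] in the lower one; that divisor tends to 1. *)
Lemma cvg_prod_onem (p : forall n, 'I_n.+1 -> R) (C S : R) :
  (forall n i, 0 <= p n i <= C / n.+1%:R) ->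
  (fun n => \sum_(i < n.+1) p n i) @ \oo --> S ->
  (fun n => \prod_(i < n.+1) (1 - p n i)) @ \oo --> expR (- S).
Proof.
move=> pC cS.
have cC : (fun n => C / n.+1%:R : R) @ \oo --> (0 : R).
  rewrite -(mulr0 C); apply: cvgM; [exact: cvg_cst|exact: cvg_harmonic].
have half : \forall n \near \oo, C / n.+1%:R < 1 by apply: (cvgr_lt _ cC); exact: ltr01.
apply: (@squeeze_cvgr _ _ _ _ (fun n => expR (- ((\sum_(i < n.+1) p n i) / (1 - C / n.+1%:R))))
  (fun n => expR (- \sum_(i < n.+1) p n i))).
- near=> n; apply/andP; split.
    rewrite mulr_suml -sumrN expR_sum; apply: ler_prod => i _; rewrite expR_ge0/=.
    by apply: expR_le_onem; [exact: pC|near: n].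
  rewrite -sumrN expR_sum; apply: ler_prod => i _; apply/andP; split.
    have /andP[_ h] := pC n i; rewrite subr_ge0 (le_trans h)// ltW//; near: n; exact: half.
  by apply: le_trans (expR_ge1Dx _).
- apply: continuous_cvg; first exact: continuous_expR.
  apply: cvgN; rewrite -[X in _ --> X]mulr1.
  apply: cvgM => //; rewrite -[X in _ --> X]invr1; apply: cvgV; first exact: oner_neq0.
  by rewrite -[X in _ --> X]subr0; apply: cvgB => //; exact: cvg_cst.
- apply: continuous_cvg; first exact: continuous_expR.
  exact: cvgN.
Unshelve. all: by end_near. Qed.

End ProductLimit.

Section Exceedance.
Variable R : realType.
Local Notation phi := (@normal_pdf R 0 1).

Lemma gaussian_law_colsub k r s (A : 'M[R]_(k, r)) (f : 'I_s -> 'I_r) (B : set 'rV[R]_s) :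
  gaussian_law (colsub f A) B = gaussian_law A [set y : 'rV[R]_r | B (\row_i y 0 (f i))].
Proof.
transitivity (std R k [set z | B (z *m colsub f A)]); first by [].
transitivity (std R k [set z | B (\row_i (z *m A) 0 (f i))]); last by [].
have E z : z *m colsub f A = \row_i (z *m A) 0 (f i).
  by apply/rowP => i; rewrite !mxE; apply: eq_bigr => l _; rewrite !mxE.
by congr (std R k _); apply/seteqP; split => z /=; rewrite E.
Qed.

(** Expand the sum of the squared differences of columns [i] and [j]. The bound keeps the argument
    of the square root in [Lam] nonnegative, so that squaring undoes the root. *)
Lemma gram_le1 k r (A : 'M[R]_(k, r)) i j : (forall i, (A^T *m A) i i = 1) ->
  (A^T *m A) i j <= 1.
Proof.
move=> A1; have h : 0 <= \sum_l (A l i - A l j) ^+ 2 by apply: sumr_ge0 => l _; exact: sqr_ge0.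
have E a b : (A^T *m A) a b = \sum_l A l a * A l b.
  by rewrite mxE; apply: eq_bigr => l _; rewrite mxE.
have E2 : \sum_l (A l i - A l j) ^+ 2 = (A^T *m A) i i + (A^T *m A) j j - 2 * (A^T *m A) i j.
  by rewrite !E mulr_sumr -big_split -sumrB; apply: eq_bigr => l _ /=; ring.
by rewrite !A1 in E2; lra.
Qed.

Definition threshold d (b : R) (x : 'rV[R]_d) : 'rV[R]_d := \row_j (b + x 0 j / b).

Lemma gaussian_exceed d k (A : 'M[R]_(k, d)) (u : 'rV[R]_d) :
  fine (gaussian_law A (~` orthant u)) = - \sum_(k < d) (-1) ^+ k.+1 *
      \sum_(m : {ffun 'I_k.+1 -> 'I_d} | increasing_idx m)
        fine (gaussian_law (colsub m A) (upset (\row_i u 0 (m i)))).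
Proof.
have -> : ~` orthant u = \bigcup_(j in [set: 'I_d]) [set y : 'rV[R]_d | u 0 j < y 0 j].
  apply/seteqP; split => y; last by move=> [j _ /= uy] /(_ j); rewrite leNgt uy.
  by move=> /existsNP[j /negP]; rewrite -ltNge => uy; exists j.
rewrite inclusion_exclusion; last first.
  by move=> j; apply: measurable_lt_fun => //; exact: measurable_coord.
congr (- _); apply: eq_bigr => l _; congr (_ * _); apply: eq_bigr => m _.
rewrite gaussian_law_colsub; congr (fine (gaussian_law A _)); apply/seteqP; split => y h.
  by move=> i; rewrite !mxE; exact: h.
by move=> i _; have := h i; rewrite !mxE.
Qed.

Lemma LamE d (b : R) (S : 'M[R]_d) i j : Lam b S i j = Num.sqrt (b ^+ 2 / 2 * (1 - S i j)).
Proof. by rewrite !mxE. Qed.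

(** Squared entries of [Lam] give the limits [2 * La i j ^+ 2] that [gaussian_tail_cvg] asks for;
    inclusion-exclusion then matches the definition of [H_df] term by term. *)
Lemma gaussian_exceed_cvg d (k : nat -> nat) (A : forall q, 'M[R]_(k q, d)) (N b : nat -> R)
    (La : 'M[R]_d) (x : 'rV[R]_d) : D0 (sq_mx La) ->
  (forall q i, ((A q)^T *m A q) i i = 1) ->
  (forall q, 0 < b q) -> (forall q, b q = N q * phi (b q)) -> b @ \oo --> +oo ->
  (forall i j, (fun q => Lam (b q) ((A q)^T *m A q) i j) @ \oo --> La i j) ->
  (fun q => N q * fine (gaussian_law (A q) (~` orthant (threshold (b q) x)))) @ \oo -->
    - ln (H_df La x).
Proof.
move=> LD A1 b0 bN boo cL.
have cA i j : (fun q => b q ^+ 2 * (1 - ((A q)^T *m A q) i j)) @ \oo --> 2 * La i j ^+ 2.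
  have -> : (fun q => b q ^+ 2 * (1 - ((A q)^T *m A q) i j)) =
      (fun q => 2 * (Lam (b q) ((A q)^T *m A q) i j * Lam (b q) ((A q)^T *m A q) i j)).
    apply/funext => q; rewrite LamE -expr2 sqr_sqrtr; first by field.
    by rewrite mulr_ge0 ?divr_ge0 ?sqr_ge0// subr_ge0 gram_le1.
  by apply: cvgM; [exact: cvg_cst|rewrite expr2; apply: cvgM; exact: cL].
rewrite /H_df expRK.
under eq_fun do rewrite gaussian_exceed mulrN mulr_sumr.
apply: cvgN; apply: cvg_sumr => l _.
under eq_fun do rewrite mulrCA mulr_sumr.
apply: cvgM; first exact: cvg_cst.
apply: cvg_sumr => m mI.
have pG := Gam_pos_definite mI LD.
pose lm (i j : 'I_l.+1) := La (m i) (m j) ^+ 2.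
have GE : Gam m La = tail_cov lm by apply/matrixP => i j; rewrite !mxE.
rewrite h_funE//.
have AE q (i j : 'I_l.+1) : ((colsub m (A q))^T *m colsub m (A q)) i j =
    ((A q)^T *m A q) (m i) (m j).
  by rewrite !mxE; apply: eq_bigr => ? _; rewrite !mxE.
have := @gaussian_tail_cvg R l k (fun q => colsub m (A q)) N b lm (\row_i x 0 (m i)).
move=> /(_ _ _ _ _ _ _)/wrap[].
- by rewrite -GE; exact: pos_definite_posdef.
- by move=> q; rewrite AE A1.
- exact: b0.
- exact: bN.
- exact: boo.
- by move=> i j; under eq_fun do rewrite AE; exact: cA.
move=> c.
have rowE z : \row_(i < l) (x 0 (m (ini i)) - z + 2 * La (m (ini i)) (m ord_max) ^+ 2) =
    \row_i ((\row_i0 x 0 (m i0)) 0 (ini i) - z + 2 * lm (ini i) ord_max).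
  by apply/rowP => i; rewrite !mxE.
have E0 : x 0 (m ord_max) = (\row_i x 0 (m i)) 0 ord_max by rewrite mxE.
under eq_Rintegral do rewrite rowE.
have -> : (fun q => N q * fine (gaussian_law (colsub m (A q))
      (upset (\row_i threshold (b q) x 0 (m i))))) =
    (fun q => N q * fine (gaussian_law (colsub m (A q))
      (upset (\row_i (b q + (\row_i0 x 0 (m i0)) 0 i / b q))))).
  apply/funext => q; congr (_ * fine (gaussian_law _ (upset _))).
  by apply/rowP => i; rewrite !mxE.
by rewrite E0 GE; exact: c.
Qed.

Lemma surv01 r (x : 'rV[R]_r) (Psi : 'M[R]_r) : Psi^T = Psi -> posdef Psi ->
  0 <= surv x Psi <= 1.
Proof.
move=> sP pP; have [A AP] := posdef_gram sP pP; rewrite -AP -gaussian_survE ?AP//.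
exact: probability_fine01 (measurable_upset _).
Qed.

(** The survivor factor lies in [0, 1], which leaves the integral of the exponential weight. The
    bound is independent of [La], as the averaging lemma requires. *)
Lemma h_fun_bound d k (m : {ffun 'I_k.+1 -> 'I_d}) (La : 'M[R]_d) (y : 'I_k.+1 -> R) :
  increasing_idx m -> D0 (sq_mx La) -> `|h_fun m La y| <= expR (- y ord_max).
Proof.
move=> mI LD; have pG := Gam_pos_definite mI LD; have pG' := pos_definite_posdef pG.
rewrite h_funE//; set f := fun z => surv _ _ * _.
have f01 z : 0 <= f z <= expR (- z).
  have /andP[s0 s1] := surv01 (\row_(i < k) (y (ini i) - z + 2 * La (m (ini i)) (m ord_max) ^+ 2)) pG.1 pG'.
  by rewrite /f mulr_ge0 ?expR_ge0//= ler_piMl ?expR_ge0.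
rewrite ger0_norm; last by apply: Rintegral_ge0 => z _; have /andP[] := f01 z.
have le : (\int[lebesgue_measure]_(z in `[y ord_max, +oo[) (f z)%:E <= (expR (- y ord_max))%:E)%E.
  rewrite -integral_expRN; apply: le_integral_nonmeasurable => z _.
  by rewrite lee_fin; have /andP[] := f01 z.
have ge : (0 <= \int[lebesgue_measure]_(z in `[y ord_max, +oo[) (f z)%:E)%E.
  by apply: integral_ge0 => z _; rewrite lee_fin; have /andP[] := f01 z.
rewrite -lee_fin /Rintegral fineK// ge0_fin_numE//; apply: le_lt_trans le _; exact: ltry.
Qed.

Lemma ln_H_df_bound d (La : 'M[R]_d) (x : 'rV[R]_d) : D0 (sq_mx La) ->
  `|ln (H_df La x)| <= \sum_(k < d) \sum_(m : {ffun 'I_k.+1 -> 'I_d} | increasing_idx m)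
    expR (- x 0 (m ord_max)).
Proof.
move=> LD; rewrite /H_df expRK; apply: le_trans (ler_norm_sum _ _ _) _.
apply: ler_sum => k _; rewrite normrM normrX normrN1 expr1n mul1r.
apply: le_trans (ler_norm_sum _ _ _) _; apply: ler_sum => m mI.
exact: h_fun_bound mI LD.
Qed.

End Exceedance.

Section UnionBound.
Variables (R : realType) (disp : measure_display) (T : measurableType disp) (Q : probability T R).

Lemma fine_probabilityC (A : set T) : measurable A -> fine (Q (~` A)) = 1 - fine (Q A).
Proof.
move=> mA; rewrite probability_setC// -(fineK (fin_num_measure Q A mA)) -EFinB.
by rewrite !fineK// fin_num_measure.
Qed.

Lemma le_fine_probability (A B : set T) : measurable A -> measurable B -> A `<=` B ->
  fine (Q A) <= fine (Q B).
Proof.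
by move=> mA mB AB; rewrite fine_le ?fin_num_measure//; apply: le_measure; rewrite ?inE.
Qed.

Lemma fine_probabilityU (A B : set T) : measurable A -> measurable B ->
  fine (Q (A `|` B)) <= fine (Q A) + fine (Q B).
Proof.
move=> mA mB; rewrite -fineD ?fin_num_measure// fine_le ?fin_num_measure//.
- exact: measurableU.
- by rewrite fin_numD !fin_num_measure.
- exact: measureU2.
Qed.

Lemma fine_probabilityD (A B : set T) : measurable A -> measurable B -> A `<=` B ->
  fine (Q (B `\` A)) = fine (Q B) - fine (Q A).
Proof.
move=> mA mB AB.
have h : Q (B `\` A) = (Q B - Q (B `&` A))%E.
  by apply: measureD => //; exact: le_lt_trans (probability_le1 Q mB) (ltry 1).
by rewrite h (setIidr AB) fineB ?fin_num_measure.
Qed.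

Lemma fine_probability_union_le (I : eqType) (s : seq I) (A : I -> set T) (B : set T) :
  measurable B -> (forall j, measurable (A j)) ->
  (forall w, B w -> exists2 j, j \in s & A j w) ->
  fine (Q B) <= \sum_(j <- s) fine (Q (A j)).
Proof.
move=> + mA; elim: s B => [|j s IH] B mB BA.
  rewrite big_nil (_ : B = set0) ?measure0//.
  by apply/seteqP; split => // w /BA[].
rewrite big_cons; have mBA : measurable (B `\` A j) by exact: measurableD.
apply: (@le_trans _ _ (fine (Q (A j `|` (B `\` A j))))).
  apply: le_fine_probability => //; first exact: measurableU.
  by move=> w Bw; have [wA|wA] := pselect (A j w); [left|right].
apply: le_trans (fine_probabilityU _ _) _ => //; rewrite lerD2l; apply: IH => // w [Bw nA].
by have [i] := BA w Bw; rewrite inE => /orP[/eqP ->//|si Ai]; exists i.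
Qed.

End UnionBound.

Lemma measurable_bigmaxr (R : realType) (disp : measure_display) (T : measurableType disp)
    (I : Type) (s : seq I) (f0 : T -> R) (f : I -> T -> R) :
  measurable_fun setT f0 -> (forall i, measurable_fun setT (f i)) ->
  measurable_fun setT (fun w => \big[Num.max/f0 w]_(i <- s) f i w).
Proof.
move=> m0 mf; elim: s => [|i s IH]; first by under eq_fun do rewrite big_nil.
by under eq_fun do rewrite big_cons; exact: measurable_maxr.
Qed.

Section OrthantIncrements.
Variables (R : realType) (r : nat) (Q : probability 'rV[R]_r R).

Definition halfspace (j : 'I_r) (a : R) : set 'rV[R]_r := [set y | y 0 j <= a].

Lemma measurable_halfspace j a : measurable (halfspace j a).
Proof.
rewrite -[X in measurable X]setCK; apply: measurableC.
rewrite (_ : ~` _ = [set y : 'rV[R]_r | a < y 0 j]).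
  by apply: measurable_lt_fun => //; exact: measurable_coord.
by apply/seteqP; split => y /=; [move/negP; rewrite -ltNge|move=> h; apply/negP; rewrite -ltNge].
Qed.

Lemma halfspace_le j a a' : a <= a' -> halfspace j a `<=` halfspace j a'.
Proof. by move=> aa y /le_trans; exact. Qed.

(** A point of the larger orthant outside the smaller one has some coordinate [j] between [x 0 j]
    and [x' 0 j]. So the joint distribution function inherits right continuity from its margins. *)
Lemma orthant_increment (x x' : 'rV[R]_r) : (forall j, x 0 j <= x' 0 j) ->
  0 <= fine (Q (orthant x')) - fine (Q (orthant x)) <=
  \sum_j (fine (Q (halfspace j (x' 0 j))) - fine (Q (halfspace j (x 0 j)))).
Proof.
move=> xx'; have sub : orthant x `<=` orthant x' by move=> y h j; exact: le_trans (h j) (xx' j).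
have [mx mx'] := (@measurable_orthant R r x, @measurable_orthant R r x').
apply/andP; split; first by rewrite subr_ge0; exact: le_fine_probability.
rewrite -fine_probabilityD//.
under eq_bigr => j _ do rewrite -(fine_probabilityD Q (measurable_halfspace j (x 0 j))
  (measurable_halfspace j (x' 0 j)) (@halfspace_le j _ _ (xx' j))).
apply: fine_probability_union_le.
- exact: measurableD.
- by move=> j; apply: measurableD; exact: measurable_halfspace.
- move=> y [yx' /existsNP[j yx]]; exists j; first by rewrite mem_index_enum.
  by split; [exact: yx'|exact: yx].
Qed.

(** A union bound over coordinates, which reduces tightness of the vector to that of its margins. *)
Lemma box_complement (M : R) :
  1 - \sum_(j < r) (1 - fine (Q (halfspace j M)) + fine (Q (halfspace j (- M)))) <=
  fine (Q [set y : 'rV[R]_r | forall j, `|y 0 j| <= M]).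
Proof.
have mB := @measurable_box R r M.
rewrite lerBlDr -lerBlDl -fine_probabilityC//.
apply: (@le_trans _ _ (\sum_(j < r) fine (Q (~` halfspace j M `|` halfspace j (- M))))).
  apply: fine_probability_union_le.
  - exact: measurableC.
  - by move=> j; apply: measurableU; [apply: measurableC|]; exact: measurable_halfspace.
  - move=> y /existsNP[j yj]; exists j; first by rewrite mem_index_enum.
    have [h|h] := pselect (halfspace j M y); last by left.
    right; rewrite /halfspace/= leNgt; apply/negP => yM; apply: yj.
    by rewrite ler_norml h (ltW yM).
apply: ler_sum => j _; rewrite -fine_probabilityC; last exact: measurable_halfspace.
apply: fine_probabilityU; last exact: measurable_halfspace.
by apply: measurableC; exact: measurable_halfspace.
Qed.

End OrthantIncrements.

Section RowMaxima.
Variables (R : realType) (d : nat) (hd : (0 < d)%N).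
Variables (disp : nat -> measure_display) (T : forall n, measurableType (disp n)).
Variables (P : forall n, probability (T n) R) (X : forall n, 'I_n.+1 -> {mfun T n >-> 'rV[R]_d}).
Variables (Sigma : forall n, 'I_n.+1 -> 'M[R]_d) (b : nat -> R) (eta : probability 'M[R]_d R).
Arguments X : clear implicits.
Arguments Sigma : clear implicits.
Hypothesis hgauss : forall n i, gaussian_vector (P n) (X n i).
Hypothesis hstd : forall n i, std_normal_coords (P n) (X n i).
Hypothesis hcorr : forall n i, correlation_mx (P n) (X n i) = Sigma n i.
Hypothesis hindep : forall n, mutually_independent (P n) (fun i => X n i : T n -> 'rV[R]_d).
Hypothesis hb : forall n, b n = n.+1%:R * normal_pdf 0 1 (b n).
Hypothesis heta : eta (@nonneg_mx R d) = 1%E.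
Hypothesis hcvg : weak_cvg_on (@nonneg_mx R d)
  (fun n => empirical_measure (fun i => Lam (b n) (Sigma n i))) eta.
Hypothesis hD0 : sq_measure eta (@D0 R d) = 1%E.

Local Notation N01 := (@normal_prob R 0 1).

Lemma row_gaussian n (i : 'I_n.+1) : exists p : {k : nat & 'M[R]_(k, d)},
  [/\ (projT2 p)^T *m projT2 p = Sigma n i, forall j, Sigma n i j j = 1 &
    forall B, measurable B -> P n (X n i @^-1` B) = gaussian_law (projT2 p) B].
Proof.
have [k [A [h1 h2 h3]]] := gaussian_vector_std (hgauss i) (hstd i).
by exists (existT _ k A); split => //; rewrite -hcorr.
Qed.

Definition factor n (i : 'I_n.+1) : {k : nat & 'M[R]_(k, d)} := projT1 (cid (row_gaussian i)).

Lemma factorP n (i : 'I_n.+1) : [/\ (projT2 (factor i))^T *m projT2 (factor i) = Sigma n i,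
  forall j, Sigma n i j j = 1 &
  forall B, measurable B -> P n (X n i @^-1` B) = gaussian_law (projT2 (factor i)) B].
Proof. exact: projT2 (cid (row_gaussian i)). Qed.

Let b0 := normalizing_gt0 hb.
Let boo := cvg_normalizing hb.

Definition tail n (y : R) : R := fine (N01 `]b n + y / b n, +oo[%classic).

Lemma coord_tail n (i : 'I_n.+1) j y :
  fine (P n [set w | b n + y / b n < X n i w 0 j]) = tail n y.
Proof.
rewrite /tail -(hstd i j); last exact: measurable_itv.
congr (fine (P n _)); apply/seteqP; split => w /=; by rewrite in_itv/= andbT.
Qed.

(** The joint tail limit for a single column, where [surv] is 1. As all coordinates are standard
    normal, the first vector of each row serves to represent the common tail. *)
Lemma cvg_tail y : (fun n => n.+1%:R * tail n y) @ \oo --> expR (- y).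
Proof.
pose j0 := Ordinal hd.
pose A n := colsub (fun _ : 'I_1 => j0) (projT2 (@factor n ord0)).
have AE n i j : ((A n)^T *m A n) i j = 1.
  have [h1 h2 _] := factorP (@ord0 n); rewrite -(h2 j0) -h1 !mxE.
  by apply: eq_bigr => l _; rewrite !mxE.
have := @gaussian_tail_cvg R 0 (fun n => projT1 (@factor n ord0)) A (fun n => n.+1%:R) b
  (fun _ _ => 0) (const_mx y).
move=> /(_ _ _ _ _ _ _)/wrap[] => //.
- by move=> i j; under eq_fun do rewrite AE subrr mulr0; rewrite mulr0; exact: cvg_cst.
rewrite mxE => c.
have -> : expR (- y) = \int[lebesgue_measure]_(z in `[y, +oo[) (1 * expR (- z)).
  by under eq_Rintegral do rewrite mul1r; rewrite /Rintegral integral_expRN.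
have -> : (fun n => n.+1%:R * tail n y) = (fun n => n.+1%:R *
    fine (gaussian_law (A n) (upset (\row_i (b n + (const_mx y : 'rV[R]_1) 0 i / b n))))).
  apply/funext => n; congr (_ * _); rewrite -(coord_tail (@ord0 n) j0) gaussian_law_colsub.
  have [_ _ h3] := factorP (@ord0 n); rewrite -h3.
    congr (fine (P n _)); apply/seteqP; split => w /= h.
      by move=> i; rewrite !mxE.
    by have := h 0; rewrite !mxE.
  rewrite (_ : mkset _ = [set z : 'rV[R]_d | b n + y / b n < z 0 j0]).
    by apply: measurable_lt_fun => //; exact: measurable_coord.
  apply/seteqP; split => z /= h; first by have := h 0; rewrite !mxE.
  by move=> i; rewrite !mxE.
exact: c.
Qed.

Lemma tail_ge0 n y : 0 <= tail n y.
Proof. by rewrite /tail fine_ge0. Qed.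

Lemma tail_bounded y : exists C, forall n, tail n y <= C / n.+1%:R.
Proof.
have /cvg_seq_bounded[M [_ hM]] : cvgn (fun n => n.+1%:R * tail n y).
  by apply: cvgP; exact: cvg_tail.
exists (M + 1) => n; rewrite ler_pdivlMr// mulrC.
apply: le_trans (ler_norm _) _; apply: hM => //; by rewrite ltrDl.
Qed.

Definition exceed n (i : 'I_n.+1) (x : 'rV[R]_d) : R :=
  fine (P n (X n i @^-1` (~` orthant (threshold (b n) x)))).

Lemma exceedE n (i : 'I_n.+1) x :
  exceed i x = fine (gaussian_law (projT2 (factor i)) (~` orthant (threshold (b n) x))).
Proof.
have [_ _ h3] := factorP i; rewrite /exceed h3//.
by apply: measurableC; exact: measurable_orthant.
Qed.

Lemma measurable_X n (i : 'I_n.+1) (B : set 'rV[R]_d) : measurable B -> measurable (X n i @^-1` B).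
Proof. by move=> mB; rewrite -[X in measurable X]setTI; exact: (@measurable_funP _ _ _ _ setT (X n i)). Qed.

(** Union bound over the coordinates, whose tails are [O(1/n)] by the Gumbel limit. *)
Lemma exceed_bounded x : exists C, forall n (i : 'I_n.+1), 0 <= exceed i x <= C / n.+1%:R.
Proof.
have /choice[C hC] : forall j : 'I_d, exists C, forall n, tail n (x 0 j) <= C / n.+1%:R.
  by move=> j; exact: tail_bounded.
exists (\sum_j C j) => n i; rewrite fine_ge0//= mulr_suml.
apply: (@le_trans _ _ (\sum_j tail n (x 0 j))); last by apply: ler_sum => j _; exact: hC.
under eq_bigr => j _ do rewrite -(coord_tail i j).
apply: fine_probability_union_le.
- by apply: measurable_X; apply: measurableC; exact: measurable_orthant.
- move=> j; apply: (@measurable_X n i [set z : 'rV[R]_d | b n + x 0 j / b n < z 0 j]).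
  by apply: measurable_lt_fun => //; exact: measurable_coord.
- move=> w /= /existsNP[j /negP]; rewrite -ltNge mxE => h; exists j => //.
  by rewrite mem_index_enum.
Qed.

(** By the hypothesis on [sq_measure], [eta] is carried by this set, at whose points the local
    limits are available. *)
Definition D0_roots : set 'M[R]_d := [set La | nonneg_mx La /\ D0 (sq_mx La)].

Lemma measurable_D0_roots : measurable D0_roots.
Proof.
rewrite (_ : D0_roots = @nonneg_mx R d `&` (@sq_mx R d @^-1` @D0 R d)); last first.
  by apply/seteqP; split.
apply: measurableI; first exact: measurable_nonneg_mx.
rewrite -[X in measurable X]setTI; apply: measurable_sq_mx => //.
exact: measurable_D0.
Qed.

Lemma eta_D0_roots : eta D0_roots = 1%E.
Proof.
have mS : measurable (@sq_mx R d @^-1` @D0 R d).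
  by rewrite -[X in measurable X]setTI; apply: measurable_sq_mx => //; exact: measurable_D0.
have mE := @measurable_nonneg_mx R d.
have D1 : fine (eta (~` D0_roots)) <= 0.
  apply: (@le_trans _ _ (fine (eta (~` @nonneg_mx R d `|` ~` (@sq_mx R d @^-1` @D0 R d))))).
    apply: le_fine_probability.
    - by apply: measurableC; exact: measurable_D0_roots.
    - by apply: measurableU; exact: measurableC.
    - rewrite -setCI; apply: subsetC => L [h1 h2]; by split.
  apply: le_trans (fine_probabilityU _ _ _) _; [exact: measurableC|exact: measurableC|].
  rewrite !fine_probabilityC// heta.
  have -> : eta (@sq_mx R d @^-1` @D0 R d) = 1%E by exact: hD0.
  by rewrite subrr addr0.
rewrite fine_probabilityC in D1; last exact: measurable_D0_roots.
apply/eqP; rewrite eq_le probability_le1/=; last exact: measurable_D0_roots.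
rewrite -(fineK (fin_num_measure eta _ measurable_D0_roots)) lee_fin.
by rewrite -subr_le0.
Qed.

(** Otherwise there are vectors, in rows of index at least [q], whose matrices tend to [La] while
    the scaled probabilities stay [e] away from the limit, contrary to [gaussian_exceed_cvg]. *)
Lemma exceed_local_cvg (x : 'rV[R]_d) (La : 'M[R]_d) : D0_roots La -> forall e : R, 0 < e ->
  exists delta N, 0 < delta /\ forall n (i : 'I_n.+1), (N <= n)%N ->
    `|La - Lam (b n) (Sigma n i)| < delta ->
    `|- (n.+1%:R * exceed i x) - ln (H_df La x)| <= e.
Proof.
move=> [_ LD] e e0; apply: contrapT => hno.
(* The position [i] depends on its row, hence the dependent pair; [q <= projT1 p] suffices for the
   row indices to tend to infinity. *)
have /choice[f hf] : forall q : nat, exists p : {n : nat & 'I_n.+1}, [/\ (q <= projT1 p)%N,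
    `|La - Lam (b (projT1 p)) (Sigma _ (projT2 p))| < q.+1%:R^-1 &
    e < `|- ((projT1 p).+1%:R * exceed (projT2 p) x) - ln (H_df La x)|].
  move=> q; apply: contrapT => hq; apply: hno; exists q.+1%:R^-1, q; split => // n i qn Ln.
  by rewrite leNgt; apply/negP => h; apply: hq; exists (existT _ n i).
pose nn q := projT1 (f q).
have nnoo : nn @ \oo --> \oo.
  move=> A [N _ NA]; exists N => // q /= Nq; apply: NA => /=.
  by have [h _ _] := hf q; exact: leq_trans h.
pose A q := projT2 (factor (projT2 (f q))).
have cLam : (fun q => Lam (b (nn q)) (Sigma _ (projT2 (f q)))) @ \oo --> La.
  apply/cvgrPdist_lt => d0 d00; near=> q.
  have [_ h _] := hf q; apply: lt_trans h _.
  by near: q; exact: (near_infty_natSinv_lt (PosNum d00)).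
have AS q : (A q)^T *m A q = Sigma _ (projT2 (f q)) by have [] := factorP (projT2 (f q)).
have := @gaussian_exceed_cvg R d (fun q => projT1 (factor (projT2 (f q)))) A
  (fun q => (nn q).+1%:R) (fun q => b (nn q)) La x LD.
move=> /(_ _ _ _ _ _)/wrap[] => //.
- by move=> q i; rewrite AS; have [_ h _] := factorP (projT2 (f q)).
- exact: (cvg_comp _ _ nnoo boo).
- move=> i j; under eq_fun do rewrite AS.
  have cc : continuous (fun L : 'M[R]_d => L i j) by exact: coord_continuous.
  exact: (cvg_comp _ _ cLam (cc La)).
move=> /cvgrPdist_le/(_ e e0)[N _ /(_ N (leqnn N))/= h].
have [_ _] := hf N; rewrite exceedE ltNge => /negP; apply.
by rewrite addrC; exact: h.
Unshelve. all: by end_near. Qed.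

(** The averaged values are [- (n.+1%:R * exceed i x)], so that the limit function is
    [ln (H_df La x)] itself; [C] bounds the values and [K] the limit function. *)
Lemma cvg_exceed_sum (x : 'rV[R]_d) : (fun n => \sum_(i < n.+1) exceed i x) @ \oo -->
  - \int[eta]_(La in @nonneg_mx R d) ln (H_df La x).
Proof.
have [C hC] := exceed_bounded x.
pose K := \sum_(k < d) \sum_(m : {ffun 'I_k.+1 -> 'I_d} | increasing_idx m) expR (- x 0 (m ord_max)).
have := @cvg_average_weak R d (fun n i => Lam (b n) (Sigma n i))
  (fun n i => - (n.+1%:R * exceed i x)) (Num.max C K) eta D0_roots (fun La => ln (H_df La x)).
move=> /(_ _ _ _ _ _ _ _ _)/wrap[].
- move=> n i; rewrite normrN; have /andP[h0 h1] := hC n i.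
  rewrite ger0_norm ?mulr_ge0// le_max; apply/orP; left.
  by rewrite mulrC -ler_pdivlMr.
- by move=> n i j l; rewrite mxE sqrtr_ge0.
- exact: hcvg.
- exact: measurable_D0_roots.
- by move=> La [].
- exact: eta_D0_roots.
- by move=> La [_ LD]; rewrite le_max ln_H_df_bound// orbT.
- by move=> La hL e e0; exact: exceed_local_cvg.
move=> /cvgN; apply: cvg_trans; apply: near_eq_cvg; apply: nearW => n /=.
transitivity (- (n.+1%:R^-1 * \sum_(i < n.+1) - (n.+1%:R * exceed i x))); first by [].
rewrite -mulrN -sumrN mulr_sumr; apply: eq_bigr => i _.
by rewrite opprK mulKf.
Qed.

Lemma cvg_exceed_prod (x : 'rV[R]_d) :
  (fun n => \prod_(i < n.+1) (1 - exceed i x)) @ \oo --> H_mix eta x.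
Proof.
have [C hC] := exceed_bounded x.
have := cvg_prod_onem hC (@cvg_exceed_sum x); rewrite opprK; exact.
Qed.

Definition row_max n : T n -> 'rV[R]_d :=
  normalized_max (b n) (fun i => X n i : T n -> 'rV[R]_d).

Lemma measurable_row_max n : measurable_fun setT (@row_max n).
Proof.
apply: measurable_fun_mx => i j; under eq_fun do rewrite mxE.
have mX (l : 'I_n.+1) : measurable_fun setT (fun w => b n * (X n l w 0 j - b n)).
  apply: measurable_funM => //; apply: measurable_funB => //.
  by apply: (measurableT_comp (measurable_coord 0 j)); exact: measurable_funP.
by apply: measurable_bigmaxr; exact: mX.
Qed.

(** The initial value of the iterated maximum is its term of index 0, so it adds no condition. *)
Lemma row_max_le n w j y :
  (row_max w 0 j <= y) <-> forall i, X n i w 0 j <= b n + y / b n.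
Proof.
have E i : (b n * (X n i w 0 j - b n) <= y) = (X n i w 0 j <= b n + y / b n).
  by rewrite mulrC -ler_pdivlMr ?b0// lerBlDl.
rewrite mxE; split=> [/bigmax_leP[_ h] i|h]; first by rewrite -E; exact: h.
by apply/bigmax_leP; split => [|i _]; rewrite E.
Qed.

Lemma cvg_row_max_df (x : 'rV[R]_d) :
  (fun n => fine (P n (@row_max n @^-1` orthant x))) @ \oo --> H_mix eta x.
Proof.
apply: cvg_trans (@cvg_exceed_prod x); apply: near_eq_cvg; apply: nearW => n.
have mO := measurable_orthant (threshold (b n) x).
rewrite (_ : _ @^-1` _ = \bigcap_(i in [set: 'I_n.+1])
    (X n i @^-1` orthant (threshold (b n) x))); last first.
  apply/seteqP; split => w h; first by move=> i _ j; rewrite mxE; exact: (row_max_le w j _).1.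
  by move=> j; apply/row_max_le => i; have := h i I j; rewrite mxE.
rewrite hindep//; apply: eq_bigr => i _.
have -> : exceed i x = 1 - fine (P n (X n i @^-1` orthant (threshold (b n) x))).
  exact: (fine_probabilityC (P n) (measurable_X i mO)).
exact: (subKr 1).
Qed.

Definition gumbel (y : R) := expR (- expR (- y)).

Lemma cvg_row_max_coord j y :
  (fun n => fine (P n [set w | @row_max n w 0 j <= y])) @ \oo --> gumbel y.
Proof.
have [C hC] := tail_bounded y.
have cS : (fun n => \sum_(i < n.+1) tail n y) @ \oo --> expR (- y).
  by under eq_fun do rewrite sumr_const card_ord -mulr_natl; exact: cvg_tail.
have tC n (i : 'I_n.+1) : 0 <= tail n y <= C / n.+1%:R by rewrite tail_ge0 hC.
apply: cvg_trans (cvg_prod_onem tC cS); apply: near_eq_cvg; apply: nearW => n.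
pose B := [set z : 'rV[R]_d | z 0 j <= b n + y / b n].
have BC : ~` B = [set z : 'rV[R]_d | b n + y / b n < z 0 j].
  by apply/seteqP; split => z /=; [move/negP; rewrite -ltNge|move=> h; apply/negP; rewrite -ltNge].
have mBC : measurable (~` B).
  by rewrite BC; apply: measurable_lt_fun => //; exact: measurable_coord.
have mB : measurable B by rewrite -(setCK B); exact: measurableC.
rewrite (_ : mkset _ = \bigcap_(i in [set: 'I_n.+1]) (X n i @^-1` B)); last first.
  apply/seteqP; split => w h; first by move=> i _; exact: (row_max_le w j _).1.
  by apply/row_max_le => i; exact: h.
rewrite hindep//; apply: eq_bigr => i _.
rewrite -(coord_tail i j).
have -> : [set w | b n + y / b n < X n i w 0 j] = ~` (X n i @^-1` B).
  by rewrite preimage_setC BC.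
rewrite (fine_probabilityC (P n) (measurable_X i mB)); exact: (subKr 1).
Qed.

Let mu n : probability 'rV[R]_d R := law (P n) (@measurable_row_max n).

Lemma cvg_halfspace j y : (fun n => fine (mu n (halfspace j y))) @ \oo --> gumbel y.
Proof. exact: cvg_row_max_coord. Qed.

Lemma gumbel_ge y : 1 - expR (- y) <= gumbel y.
Proof. exact: expR_ge1Dx. Qed.

Lemma gumbel_le y : gumbel (- y) <= expR (- y).
Proof.
rewrite /gumbel opprK ler_expR lerN2; apply: le_trans (expR_ge1Dx _).
by rewrite lerDr.
Qed.

(** Increments of [H_mix eta] are limits of increments of the distribution functions of the maxima,
    hence at most sums of increments of the continuous function [gumbel]. *)
Lemma H_mix_right_continuous (x : 'rV[R]_d) :
  (fun k => H_mix eta (x + const_mx k.+1%:R^-1)) @ \oo --> H_mix eta x.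
Proof.
pose x_ k : 'rV[R]_d := x + const_mx k.+1%:R^-1.
have xE k j : x_ k 0 j = x 0 j + k.+1%:R^-1 by rewrite !mxE.
have bd k : 0 <= H_mix eta (x_ k) - H_mix eta x <=
    \sum_(j < d) (gumbel (x 0 j + k.+1%:R^-1) - gumbel (x 0 j)).
  have c1 : (fun n => fine (mu n (orthant (x_ k))) - fine (mu n (orthant x))) @ \oo -->
      H_mix eta (x_ k) - H_mix eta x.
    by apply: cvgB; exact: cvg_row_max_df.
  have c2 : (fun n => \sum_(j < d) (fine (mu n (halfspace j (x_ k 0 j))) -
      fine (mu n (halfspace j (x 0 j))))) @ \oo -->
      \sum_(j < d) (gumbel (x_ k 0 j) - gumbel (x 0 j)).
    by apply: cvg_sumr => j _; apply: cvgB; exact: cvg_halfspace.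
  have inc n := @orthant_increment R d (mu n) x (x_ k).
  have xx j : x 0 j <= x_ k 0 j by rewrite xE lerDl.
  under eq_bigr do rewrite -xE.
  apply/andP; split.
    by apply: (cvgr_to_ge c1); apply: nearW => n; have /andP[] := inc n xx.
  rewrite -subr_ge0; apply: (cvgr_to_ge (cvgB c2 c1)); apply: nearW => n /=.
  by rewrite subr_ge0; have /andP[] := inc n xx.
have ci : (fun k : nat => k.+1%:R^-1 : R) @ \oo --> (0 : R) by exact: cvg_harmonic.
have cg : (fun k : nat => \sum_(j < d) (gumbel (x 0 j + k.+1%:R^-1) - gumbel (x 0 j))) @ \oo --> (0 : R).
  have s0 : \sum_(j < d) (gumbel (x 0 j + 0) - gumbel (x 0 j)) = 0.
    by rewrite big1// => j _; rewrite addr0 subrr.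
  suff : (fun k : nat => \sum_(j < d) (gumbel (x 0 j + k.+1%:R^-1) - gumbel (x 0 j))) @ \oo -->
      \sum_(j < d) (gumbel (x 0 j + 0) - gumbel (x 0 j)) by rewrite s0; apply.
  apply: cvg_sumr => j _; apply: cvgB; last exact: cvg_cst.
  rewrite /gumbel; apply: continuous_cvg; first exact: continuous_expR.
  apply: cvgN; apply: continuous_cvg; first exact: continuous_expR.
  by apply: cvgN; apply: cvgD => //; exact: cvg_cst.
have c0 : (fun k => H_mix eta (x_ k) - H_mix eta x) @ \oo --> (0 : R).
  by apply: (squeeze_cvgr _ (@cvg_cst _ _ _ _ _) cg); apply: nearW => k; exact: bd.
have cH : (fun _ : nat => H_mix eta x) @ \oo --> H_mix eta x by exact: cvg_cst.
have cD : (fun k => H_mix eta (x_ k) - H_mix eta x + H_mix eta x) @ \oo --> 0 + H_mix eta x.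
  exact: cvgD.
rewrite add0r in cD.
by apply: cvg_trans cD; apply: near_eq_cvg; apply: nearW => k /=; rewrite subrK.
Qed.

Lemma row_max_tight (e : R) : 0 < e -> exists M : R, \forall n \near \oo,
  1 - e <= fine (mu n [set y : 'rV[R]_d | forall j, `|y 0 j| <= M]).
Proof.
move=> e0; have d0 : 0 < d%:R :> R by rewrite ltr0n.
(* Each coordinate leaves the box with limiting probability at most [2 * t], so the total is at most
   [2 * d%:R * t = e / 2], strictly below [e]. *)
pose t := e / (4 * d%:R); have t0 : 0 < t by rewrite divr_gt0// mulr_gt0.
pose M := - ln t; have ME : expR (- M) = t by rewrite opprK lnK.
exists M.
have c : (fun n => 1 - \sum_(j < d) (1 - fine (mu n (halfspace j M)) +
    fine (mu n (halfspace j (- M))))) @ \oo --> 1 - \sum_(j < d) (1 - gumbel M + gumbel (- M)).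
  apply: cvgB; first exact: cvg_cst.
  apply: cvg_sumr => j _; apply: cvgD; last exact: cvg_halfspace.
  by apply: cvgB; [exact: cvg_cst|exact: cvg_halfspace].
have lt : 1 - e < 1 - \sum_(j < d) (1 - gumbel M + gumbel (- M)).
  rewrite ltrD2l ltrN2 sumr_const card_ord -mulr_natl.
  apply: (@le_lt_trans _ _ (d%:R * (t + t))).
    rewrite ler_wpM2l// -ME lerD ?gumbel_le//.
    by have := gumbel_ge M; lra.
  have -> : d%:R * (t + t) = e / 2 by rewrite /t; field; rewrite gt_eqF.
  by rewrite ltr_pdivrMr// ltr_pMr// ltr1n.
apply: filterS (cvgr_gt _ c _ lt) => n /ltW h; apply: le_trans h _.
exact: box_complement.
Qed.

Lemma row_max_weak_limit : exists G : probability 'rV[R]_d R,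
  (forall x, G (orthant x) = (H_mix eta x)%:E) /\ cvg_in_distribution P row_max G.
Proof.
have [G [GH Gf]] := @cvg_df_weak R d mu (H_mix eta)
  cvg_row_max_df H_mix_right_continuous row_max_tight.
exists G; split => // f cf [K fK].
have mf := continuous_measurable_mx cf.
apply: cvg_trans (Gf f K cf fK); apply: near_eq_cvg; apply: nearW => n.
rewrite /Rintegral; congr fine; apply: integral_distribution; first exact/measurable_EFinP.
by apply: (@bounded_integrable _ _ _ _ _ K) => //; apply: measurableT_comp => //; exact: measurable_row_max.
Qed.

End RowMaxima.

(* The row with index n has n.+1 vectors: it is row n+1 of the array. *)
Theorem theorem3p1 (R : realType) (d : nat) (hd : (0 < d)%N)
    (disp : nat -> measure_display) (T : forall n, measurableType (disp n))
    (P : forall n, probability (T n) R)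
    (X : forall n, 'I_n.+1 -> {mfun T n >-> 'rV[R]_d})
    (Sigma : forall n, 'I_n.+1 -> 'M[R]_d)
    (b : nat -> R)
    (eta : probability 'M[R]_d R)
    (hgauss : forall n i, gaussian_vector (P n) (X n i))
    (hstd : forall n i, std_normal_coords (P n) (X n i))
    (hcorr : forall n i, correlation_mx (P n) (X n i) = Sigma n i)
    (hindep : forall n,
       mutually_independent (P n) (fun i => X n i : T n -> 'rV[R]_d))
    (hb : forall n, b n = n.+1%:R * normal_pdf 0 1 (b n))
    (heta : eta (@nonneg_mx R d) = 1%E)
    (hcvg : weak_cvg_on (@nonneg_mx R d)
       (fun n => empirical_measure (fun i => Lam (b n) (Sigma n i))) eta)
    (hD0 : sq_measure eta (@D0 R d) = 1%E) :
  exists G : probability 'rV[R]_d R,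
    (forall x : 'rV[R]_d,
       G [set y : 'rV[R]_d | forall j, y 0 j <= x 0 j] = (H_mix eta x)%:E) /\
    cvg_in_distribution P
      (fun n => normalized_max (b n) (fun i => X n i : T n -> 'rV[R]_d)) G.
Proof. exact: row_max_weak_limit. Qed.
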